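(* Let $\mu$ be a centered probability measure on $\mathbb{Z}$ supported on $\{-1\}\cup\mathbb{N}$ such that $(\mu(n))_{n\in\mathbb{N}}$ is completely monotone. Then: (i) $\mu$ has BAR if and only if there exists $C>0$ such that $$n\sum_{k\ge n}k\mu(k)\le C\sum_{k=1}^n k^2\mu(k)\qquad\text{for all } n\ge1.$$ (ii) Assume that $\mu$ has BAR. Let $\sigma$ be a centered probability measure on $\mathbb{Z}$ such that there exists $c>0$ with $\sum_{n\in\mathbb{Z}}n^2|\sigma(n)-c\mu(n)|<\infty$. Then $\sigma\in\mathcal{H}\cap\mathcal{R}$. In particular (taking $c=1$ and $\sigma=\mu$), $\mu\in\mathcal{H}\cap\mathcal{R}$.
   Context: $\mathbb{N}=\{0,1,2,\ldots\}$. For a finite measure $\mu$ on $\mathbb{Z}$, $\hat\mu(\theta)=\sum_{n\in\mathbb{Z}}\mu(n)e^{in\theta}$; $\mu^{*n}$ is the $n$-th convolution power. A probability measure $\mu$ on $\mathbb{Z}$ is centered if $\sum_{n\in\mathbb{Z}}|n|\mu(n)<\infty$ and $\sum_{n\in\mathbb{Z}}n\mu(n)=0$. A real sequence $(t_n)_{n\in\mathbb{N}}$ is completely monotone if, with $\Delta t_n=t_n-t_{n+1}$ and $\Delta^0=\mathrm{Id}$, one has $\Delta^m t_n\ge0$ for all $m,n\ge0$. A probability measure $\mu$ on $\mathbb{Z}$ is strictly aperiodic if $|\hat\mu(\theta)|<1$ for every $\theta\in(0,2\pi)$; it has BAR (bounded angular ratio) if it is strictly aperiodic and $\sup_{\theta\in(0,2\pi)}\frac{|1-\hat\mu(\theta)|}{1-|\hat\mu(\theta)|}<\infty$.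 Hypothesis (H): a probability measure $\mu$ on $\mathbb{Z}$ satisfies (H) if $\hat\mu$ is twice continuously differentiable on $[-\pi,\pi]\setminus\{0\}$ and there exist an even continuous function $\psi$ on $[-\pi,\pi]$, vanishing at $0$ and continuously differentiable on $[-\pi,\pi]\setminus\{0\}$, and constants $c,C>0$ such that for every $\theta\in(0,\pi]$: $|\hat\mu(\theta)|\le 1-c\psi(\theta)$; $|\theta\hat\mu'(\theta)|\le C\psi(\theta)$; $|\hat\mu'(\theta)|\le C\psi'(\theta)$; $|\theta\hat\mu''(\theta)|\le C\psi'(\theta)$. $\mathcal{H}$ denotes the set of probability measures satisfying (H). Ritt: $\mu$ is Ritt if $\sup_{n\ge1}n\|\mu^{*n}-\mu^{*(n+1)}\|_{\ell^1(\mathbb{Z})}<\infty$. $\mathcal{R}$ denotes the set of Ritt probability measures on $\mathbb{Z}$.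
   Formalization: Part (i) assumes μ ≠ δ₀ (δ₀ satisfies the inequality but not BAR); part (ii) assumes σ strictly aperiodic when σ has a finite second moment (otherwise σ = (δ₁+δ₋₁)/2 is a counterexample). *)

(* Defs.v *)
From Stdlib Require Import Reals ZArith.
From Coquelicot Require Import Coquelicot.
Open Scope R_scope.

(* A family on Z is split into its restrictions to n >= 0 and n < 0.  [Zsum] is
   a total function, meaningful for families that are [Zsummable], that is,
   absolutely summable. *)
Definition Zsummable (f : Z -> R) : Prop :=
  ex_series (fun n : nat => Rabs (f (Z.of_nat n))) /\
  ex_series (fun n : nat => Rabs (f (- Z.of_nat (S n))%Z)).

Definition Zsum (f : Z -> R) : R :=
  Series (fun n : nat => f (Z.of_nat n)) +
  Series (fun n : nat => f (- Z.of_nat (S n))%Z).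

Definition CZsum (f : Z -> C) : C :=
  (Zsum (fun n => Re (f n)), Zsum (fun n => Im (f n))).

(* Measures on Z are identified with their mass functions. *)
Definition is_probability (mu : Z -> R) : Prop :=
  (forall n, 0 <= mu n) /\ Zsummable mu /\ Zsum mu = 1.

Definition centered (mu : Z -> R) : Prop :=
  Zsummable (fun n => Rabs (IZR n) * mu n) /\ Zsum (fun n => IZR n * mu n) = 0.

Definition finite_second_moment (mu : Z -> R) : Prop :=
  Zsummable (fun n => IZR n ^ 2 * mu n).

Definition delta0 (n : Z) : R := if Z.eq_dec n 0 then 1 else 0.

Definition conv (mu nu : Z -> R) (n : Z) : R :=
  Zsum (fun k => mu k * nu (n - k)%Z).

Fixpoint conv_pow (mu : Z -> R) (n : nat) : Z -> R :=
  match n with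
  | O => delta0
  | S m => conv mu (conv_pow mu m)
  end.

Definition l1norm (f : Z -> R) : R := Zsum (fun n => Rabs (f n)).

(* e^{it} *)
Definition cis (t : R) : C := (cos t, sin t).

Definition fourier (mu : Z -> R) (theta : R) : C :=
  CZsum (fun n => (RtoC (mu n) * cis (IZR n * theta))%C).

Definition Delta (t : nat -> R) (n : nat) : R := t n - t (S n).

Definition completely_monotone (t : nat -> R) : Prop :=
  forall m n : nat, 0 <= Nat.iter m Delta t n.

Definition strictly_aperiodic (mu : Z -> R) : Prop :=
  forall theta, 0 < theta < 2 * PI -> Cmod (fourier mu theta) < 1.

Definition BAR (mu : Z -> R) : Prop :=
  strictly_aperiodic mu /\
  exists K, forall theta, 0 < theta < 2 * PI ->
    Cmod (1 - fourier mu theta)%C / (1 - Cmod (fourier mu theta)) <= K.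

(* Derivative at [x] relative to the domain [D]; one-sided at an end point. *)
Definition is_derive_on {V : NormedModule R_AbsRing}
    (D : R -> Prop) (f : R -> V) (x : R) (l : V) : Prop :=
  filterdiff f (within D (locally x)) (fun y : R => scal y l).

Definition Ipi (x : R) : Prop := - PI <= x <= PI.

Definition Ipi_star (x : R) : Prop := Ipi x /\ x <> 0.

(* [f1], [f2] are the first two derivatives of the Fourier transform of [mu],
   and [psi1] is the derivative of [psi]; points of [Ipi_star] are not isolated
   in it, so these are uniquely determined there.  Values of [psi] outside
   [-PI, PI] are irrelevant. *)
Definition hypothesis_H (mu : Z -> R) : Prop :=
  exists f1 f2 : R -> C,
    (forall x, Ipi_star x ->
       is_derive_on (V := C_R_NormedModule) Ipi_star (fourier mu) x (f1 x)) /\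
    (forall x, Ipi_star x ->
       is_derive_on (V := C_R_NormedModule) Ipi_star f1 x (f2 x)) /\
    continuous_on Ipi_star f2 /\
    exists psi psi1 : R -> R,
      (forall x, Ipi x -> psi (- x) = psi x) /\
      continuous_on Ipi psi /\
      psi 0 = 0 /\
      (forall x, Ipi_star x ->
         is_derive_on (V := R_NormedModule) Ipi_star psi x (psi1 x)) /\
      continuous_on Ipi_star psi1 /\
      exists c K : R, 0 < c /\ 0 < K /\
        forall theta, 0 < theta <= PI ->
          Cmod (fourier mu theta) <= 1 - c * psi theta /\
          Cmod (RtoC theta * f1 theta)%C <= K * psi theta /\
          Cmod (f1 theta) <= K * psi1 theta /\
          Cmod (RtoC theta * f2 theta)%C <= K * psi1 theta.

Definition class_H (mu : Z -> R) : Prop := is_probability mu /\ hypothesis_H mu.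

Definition class_R (mu : Z -> R) : Prop :=
  is_probability mu /\
  exists K, forall n : nat, (1 <= n)%nat ->
    INR n * l1norm (fun k => conv_pow mu n k - conv_pow mu (S n) k) <= K.

(* Main.v *)
Require Import Defs.
From Stdlib Require Import Reals ZArith Lia Lra Psatz Classical FunctionalExtensionality.
From Coquelicot Require Import Coquelicot.
Open Scope R_scope.

(** Write [p] for the measure, [p^] for its Fourier transform, and put
    [psi(t) = sum_k p(k) w(k t)] with [w(x) = sqrt (1 + x^2) - 1], which is comparable to
    [min (x^2, |x|)].  Subtracting [0 = i t sum_k k p(k)] and [0 = i sum_k k p(k)], centring gives
    [|1 - p^(t)| <= 6 psi(t)] and [|t p^'(t)| <= 4 psi(t)] for every centred probability
    ([one_minus_fourier_le], [moment_fourier_le]).  The content of the theorem is that under the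
    tail condition, and only then, [Re (1 - p^)] is as large as [psi].

    Put [S_N = sum_{k <= N} k^2 p(k)] and [T_N = sum_{k >= N} k p(k)], and let [N ~ 1/t].  Then
    [psi(t)] is at most of order [t^2 S_N + t T_N], while
    [Re (1 - p^(t)) = sum_k p(k) (1 - cos k t)] is at least of order [t^2 S_N]; so the tail
    condition [N T_N <= C S_N] yields [psi <= K Re (1 - p^)] near the origin
    ([gauge_sum_le_of_tail_condition]).  Conversely the imaginary part of [1 - p^(t)] is
    [sum_k p(k) (k sin t - sin k t)], because [sum_k k p(k) = 0].  No term with [k >= -1] is
    negative and the tail alone makes the sum at least of order [t T_N], so that bounded
    angular ratio forces the tail condition ([tail_condition_of_angular_bound]).

    A centred [s] with [sum_k k^2 |s(k) - c p(k)|] finite inherits the lower bound on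
    [Re (1 - s^)] by its own gauge sum: both sides differ from those of [c p] by [O(t^2)],
    and an atom of [s] off the origin contributes at least that much to [Re (1 - s^)]
    ([gauge_sum_le_real_part]).  Together with strict aperiodicity this gives
    [|s^| <= 1 - c psi] on [[-pi, pi]] ([modulus_gap]).

    For (H) it remains to differentiate twice, and [sum_k k^2 p(k)] may diverge.  But [p]
    decreases on the natural numbers, so the differences of [k p(k)] have a finite first moment.
    They are the coefficients of [(1 - e^{it})] times the series of [k p(k)], so that away
    from [0] this series can be differentiated after division by [1 - e^{it}], and Abel
    summation bounds the result by a multiple of [psi(t) / t^2] ([moment_diff_weighted],
    [moment_fourier'_le]).  The same follows for [s], whose transform differs from [c p^] by a
    function with bounded second derivative ([perturbation_class_H]).  As [w(x) <= x w'(x)], one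
    has [psi(t) <= t psi'(t)], and (H) holds with [psi] the gauge sum.

    For the Ritt property let [h] solve [n psi(h) = 1].  The function [psi(t) / t] is
    non-decreasing, so [n psi(t)] lies below, respectively above, [t / h] according as
    [t <= h] or [t >= h].  Therefore [f = s^^n (1 - s^)] and [h f'] are bounded by
    [(A / n) h / sqrt (h^2 + t^2)], and Bessel's inequality for [f] and [f'] followed by
    Carlson's interpolation bounds the [l^1] norm of the coefficients of [f] by a multiple
    of [1 / n], uniformly for bounded [h] ([l1_of_lorentz], [Ritt_of_gap]). *)

(** * Absolutely convergent sums over the integers *)

(** The window runs over [-(M+1) <= k <= M]: both halves have the same number of
    terms, in accordance with the two series that make up [Zsum]. *)
Definition zpart (f : Z -> R) (M : nat) : R :=
  sum_n (fun n => f (Z.of_nat n)) M + sum_n (fun n => f (- Z.of_nat (S n))%Z) M.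

Lemma zpart_S f M :
  zpart f (S M) = zpart f M + (f (Z.of_nat (S M)) + f (- Z.of_nat (S (S M)))%Z).
Proof.
  unfold zpart. rewrite !sum_Sn. unfold plus; simpl. ring.
Qed.

Lemma zpart_O f : zpart f 0 = f 0%Z + f (-1)%Z.
Proof. unfold zpart. rewrite !sum_O. reflexivity. Qed.

Lemma zpart_ext f g M : (forall k, f k = g k) -> zpart f M = zpart g M.
Proof. intros H. unfold zpart. f_equal; apply sum_n_ext; intros; apply H. Qed.

Lemma zpart_plus f g M : zpart (fun k => f k + g k) M = zpart f M + zpart g M.
Proof. induction M; [rewrite !zpart_O | rewrite !zpart_S, IHM]; ring. Qed.

Lemma zpart_scal c f M : zpart (fun k => c * f k) M = c * zpart f M.
Proof. induction M; [rewrite !zpart_O | rewrite !zpart_S, IHM]; ring. Qed.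

Lemma zpart_le f g M : (forall k, f k <= g k) -> zpart f M <= zpart g M.
Proof.
  intros H. induction M; [rewrite !zpart_O | rewrite !zpart_S].
  - generalize (H 0%Z), (H (-1)%Z); lra.
  - generalize (H (Z.of_nat (S M))), (H (- Z.of_nat (S (S M)))%Z); lra.
Qed.

Lemma zpart_0 M : zpart (fun _ => 0) M = 0.
Proof. induction M; [rewrite zpart_O | rewrite zpart_S, IHM]; ring. Qed.

Lemma zpart_nonneg f M : (forall k, 0 <= f k) -> 0 <= zpart f M.
Proof. intros H. rewrite <- (zpart_0 M). now apply zpart_le. Qed.

Lemma zpart_incr f M N :
  (forall k, 0 <= f k) -> (M <= N)%nat -> zpart f M <= zpart f N.
Proof.
  intros H L. induction L; [lra|]. rewrite zpart_S.
  generalize (H (Z.of_nat (S m))), (H (- Z.of_nat (S (S m)))%Z); lra.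
Qed.

(** Used to read pointwise summability off a bound on double sums. *)
Lemma zpart_term f k :
  (forall j, 0 <= f j) -> exists N, forall M, (N <= M)%nat -> f k <= zpart f M.
Proof.
  intros H. exists (Z.abs_nat k). intros M L.
  apply Rle_trans with (zpart f (Z.abs_nat k)); [|now apply zpart_incr].
  destruct (Z.abs_nat k) as [|n] eqn:E.
  - replace k with 0%Z by lia. rewrite zpart_O. generalize (H (-1)%Z); lra.
  - destruct (Z_le_gt_dec 0 k).
    + replace k with (Z.of_nat (S n)) by lia. rewrite zpart_S.
      generalize (H (- Z.of_nat (S (S n)))%Z), (zpart_nonneg f n H); lra.
    + replace k with (- Z.of_nat (S n))%Z by lia.
      destruct n.
      * rewrite zpart_S, zpart_O.
        generalize (H 0%Z), (H (Z.of_nat 1)), (H (- Z.of_nat 2)%Z).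
        change (- Z.of_nat 1)%Z with (-1)%Z. lra.
      * rewrite zpart_S, zpart_S.
        generalize (H (Z.of_nat (S (S n)))), (H (- Z.of_nat (S (S (S n))))%Z),
          (zpart_nonneg f n H), (H (Z.of_nat (S n))); lra.
Qed.

Lemma zpart_switch (F : Z -> Z -> R) M N :
  zpart (fun j => zpart (fun k => F j k) N) M =
  zpart (fun k => zpart (fun j => F j k) M) N.
Proof.
  induction M.
  - rewrite zpart_O, <- zpart_plus. apply zpart_ext; intros; now rewrite zpart_O.
  - rewrite zpart_S, IHM, <- !zpart_plus.
    apply zpart_ext; intros; now rewrite zpart_S.
Qed.

Lemma zpart_lim f : Zsummable f -> is_lim_seq (zpart f) (Zsum f).
Proof.
  intros [H1 H2]. apply ex_series_Rabs in H1, H2.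
  unfold Zsum, zpart. apply (is_lim_seq_plus' _ _ _ _).
  - exact (Series_correct _ H1).
  - exact (Series_correct _ H2).
Qed.

Lemma Zsummable_le f g : (forall k, Rabs (f k) <= g k) -> Zsummable g -> Zsummable f.
Proof.
  intros H [H1 H2]. split.
  - apply (ex_series_le (V := R_CompleteNormedModule)) with (b := fun n => Rabs (g (Z.of_nat n))); [|assumption].
    intros n. unfold norm; simpl. unfold abs; simpl. rewrite Rabs_Rabsolu.
    eapply Rle_trans; [apply H | apply Rle_abs].
  - apply (ex_series_le (V := R_CompleteNormedModule)) with (b := fun n => Rabs (g (- Z.of_nat (S n))%Z)); [|assumption].
    intros n. unfold norm; simpl. unfold abs; simpl. rewrite Rabs_Rabsolu.
    eapply Rle_trans; [apply H | apply Rle_abs].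
Qed.

Lemma Zsummable_ext f g : (forall k, f k = g k) -> Zsummable f -> Zsummable g.
Proof. intros H. rewrite (functional_extensionality f g H). auto. Qed.

Lemma Zsum_ext f g : (forall k, f k = g k) -> Zsum f = Zsum g.
Proof. intros H. now rewrite (functional_extensionality f g H). Qed.

Lemma Zsummable_abs f : Zsummable f -> Zsummable (fun k => Rabs (f k)).
Proof.
  intros [H1 H2]; split; [eapply ex_series_ext, H1 | eapply ex_series_ext, H2];
    intros; simpl; now rewrite Rabs_Rabsolu.
Qed.

Lemma Zsummable_plus f g : Zsummable f -> Zsummable g -> Zsummable (fun k => f k + g k).
Proof.
  intros [F1 F2] [G1 G2].
  apply Zsummable_le with (fun k => Rabs (f k) + Rabs (g k)); [intros; apply Rabs_triang|].
  split.
  - eapply ex_series_ext, (ex_series_plus _ _ F1 G1). intros; simpl.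
    rewrite (Rabs_pos_eq (_ + _)); [reflexivity|]. apply Rplus_le_le_0_compat; apply Rabs_pos.
  - eapply ex_series_ext, (ex_series_plus _ _ F2 G2). intros; simpl.
    rewrite (Rabs_pos_eq (_ + _)); [reflexivity|]. apply Rplus_le_le_0_compat; apply Rabs_pos.
Qed.

Lemma Zsummable_scal c f : Zsummable f -> Zsummable (fun k => c * f k).
Proof.
  intros [F1 F2]. split.
  - eapply ex_series_ext, (ex_series_scal_l (Rabs c) _ F1). intros; simpl. now rewrite Rabs_mult.
  - eapply ex_series_ext, (ex_series_scal_l (Rabs c) _ F2). intros; simpl. now rewrite Rabs_mult.
Qed.

Lemma Zsummable_minus f g : Zsummable f -> Zsummable g -> Zsummable (fun k => f k - g k).
Proof.
  intros Hf Hg. apply Zsummable_ext with (fun k => f k + (-1) * g k); [intros; ring|].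
  now apply Zsummable_plus, Zsummable_scal.
Qed.

Lemma Zsummable_bound f B : (forall M, zpart (fun k => Rabs (f k)) M <= B) -> Zsummable f.
Proof.
  intros H. split.
  - destruct (ex_finite_lim_seq_incr (sum_n (fun n => Rabs (f (Z.of_nat n)))) B) as [l Hl].
    + intros n. rewrite sum_Sn. unfold plus; simpl. generalize (Rabs_pos (f (Z.of_nat (S n)))); simpl; lra.
    + intros n. eapply Rle_trans; [|apply (H n)]. unfold zpart.
      assert (0 <= sum_n (fun m => Rabs (f (- Z.of_nat (S m))%Z)) n); [|lra].
      induction n; [rewrite sum_O | rewrite sum_Sn; unfold plus; simpl; apply Rplus_le_le_0_compat; auto];
        apply Rabs_pos.
    + exists l. exact Hl.
  - destruct (ex_finite_lim_seq_incr (sum_n (fun n => Rabs (f (- Z.of_nat (S n))%Z))) B) as [l Hl].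
    + intros n. rewrite sum_Sn. unfold plus; simpl plus. generalize (Rabs_pos (f (- Z.of_nat (S (S n)))%Z)); simpl; lra.
    + intros n. eapply Rle_trans; [|apply (H n)]. unfold zpart.
      assert (0 <= sum_n (fun m => Rabs (f (Z.of_nat m))) n); [|lra].
      induction n; [rewrite sum_O | rewrite sum_Sn; unfold plus; simpl; apply Rplus_le_le_0_compat; auto];
        apply Rabs_pos.
    + exists l. exact Hl.
Qed.

Lemma Zsummable_0 : Zsummable (fun _ => 0).
Proof.
  apply Zsummable_bound with 0. intros M.
  rewrite (zpart_ext _ (fun _ => 0)) by (intros; apply Rabs_R0). rewrite zpart_0. lra.
Qed.

Lemma Zsum_plus f g :
  Zsummable f -> Zsummable g -> Zsum (fun k => f k + g k) = Zsum f + Zsum g.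
Proof.
  intros [F1 F2] [G1 G2]. unfold Zsum.
  rewrite !Series_plus; try (now apply ex_series_Rabs). ring.
Qed.

Lemma Zsum_scal c f : Zsum (fun k => c * f k) = c * Zsum f.
Proof. unfold Zsum. rewrite !Series_scal_l. ring. Qed.

Lemma Zsum_minus f g :
  Zsummable f -> Zsummable g -> Zsum (fun k => f k - g k) = Zsum f - Zsum g.
Proof.
  intros Hf Hg. rewrite (Zsum_ext _ (fun k => f k + (-1) * g k)) by (intros; ring).
  rewrite Zsum_plus, Zsum_scal; auto using Zsummable_scal. ring.
Qed.

Lemma Zsum_0 : Zsum (fun _ => 0) = 0.
Proof.
  rewrite (Zsum_ext _ (fun _ => 0 * 0)) by (intros; ring). rewrite Zsum_scal. ring.
Qed.

Lemma Zsum_le f g :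
  (forall k, f k <= g k) -> Zsummable f -> Zsummable g -> Zsum f <= Zsum g.
Proof.
  intros H Hf Hg.
  apply (is_lim_seq_le (zpart f) (zpart g) (Zsum f) (Zsum g)); auto using zpart_lim.
  intros; now apply zpart_le.
Qed.

Lemma Zsum_nonneg f : (forall k, 0 <= f k) -> Zsummable f -> 0 <= Zsum f.
Proof. intros H Hf. rewrite <- Zsum_0. apply Zsum_le; auto using Zsummable_0. Qed.

Lemma zpart_le_Zsum f M : (forall k, 0 <= f k) -> Zsummable f -> zpart f M <= Zsum f.
Proof.
  intros H Hf. apply (is_lim_seq_incr_compare (zpart f)); [now apply zpart_lim|].
  intros; apply zpart_incr; auto.
Qed.

Lemma Zsum_term f k : (forall j, 0 <= f j) -> Zsummable f -> f k <= Zsum f.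
Proof.
  intros H Hf. destruct (zpart_term f k H) as [N HN].
  eapply Rle_trans; [apply (HN N); lia | now apply zpart_le_Zsum].
Qed.

Lemma Zsum_le_bound f B : Zsummable f -> (forall M, zpart f M <= B) -> Zsum f <= B.
Proof.
  intros Hf H. apply (is_lim_seq_le (zpart f) (fun _ => B) (Zsum f) B); auto using zpart_lim.
  apply is_lim_seq_const.
Qed.

Lemma Zsum_abs f : Zsummable f -> Rabs (Zsum f) <= Zsum (fun k => Rabs (f k)).
Proof.
  intros Hf. apply Rabs_le. split.
  - apply Ropp_le_cancel. rewrite Ropp_involutive.
    rewrite <- (Rmult_1_l (Zsum f)), Ropp_mult_distr_l, <- Zsum_scal.
    apply Zsum_le; auto using Zsummable_abs, Zsummable_scal.
    intros k. generalize (Rle_abs (- f k)). rewrite Rabs_Ropp. lra.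
  - apply Zsum_le; auto using Zsummable_abs. intros; apply Rle_abs.
Qed.

(** The sums of [f + |f| >= 0] and of [|f| - f >= 0] dominate their own partial
    sums. *)
Lemma Zsum_tail f M : Zsummable f ->
  Rabs (Zsum f - zpart f M) <= Zsum (fun k => Rabs (f k)) - zpart (fun k => Rabs (f k)) M.
Proof.
  intros Hf. pose proof (Zsummable_abs f Hf) as Ha.
  assert (H1 : zpart (fun k => f k + Rabs (f k)) M <= Zsum (fun k => f k + Rabs (f k))).
  { apply zpart_le_Zsum; [|now apply Zsummable_plus].
    intros k. generalize (Rle_abs (- f k)). rewrite Rabs_Ropp. lra. }
  assert (H2 : zpart (fun k => Rabs (f k) + (-1) * f k) M <= Zsum (fun k => Rabs (f k) + (-1) * f k)).
  { apply zpart_le_Zsum; [|now apply Zsummable_plus; auto using Zsummable_scal].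
    intros k. generalize (Rle_abs (f k)). lra. }
  rewrite zpart_plus, Zsum_plus in H1 by auto.
  rewrite zpart_plus, Zsum_plus, zpart_scal, Zsum_scal in H2 by auto using Zsummable_scal.
  apply Rabs_le; lra.
Qed.

Lemma Zsummable_tail_small f eps : Zsummable f -> 0 < eps ->
  exists N, forall M, (N <= M)%nat ->
    Zsum (fun k => Rabs (f k)) - zpart (fun k => Rabs (f k)) M < eps.
Proof.
  intros Hf He. pose proof (zpart_lim _ (Zsummable_abs f Hf)) as L.
  apply is_lim_seq_spec in L. destruct (L (mkposreal eps He)) as [N HN].
  exists N. intros M HM. specialize (HN M HM). simpl in HN.
  apply Rabs_def2 in HN. lra.
Qed.

Lemma zpart_filterlim {T} (F : (T -> Prop) -> Prop) {FF : Filter F}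
  (u : T -> Z -> R) (l : Z -> R) M :
  (forall k, filterlim (fun t => u t k) F (locally (l k))) ->
  filterlim (fun t => zpart (u t) M) F (locally (zpart l M)).
Proof.
  intros H.
  assert (P : forall f g : T -> R, forall a b : R, filterlim f F (locally a) ->
     filterlim g F (locally b) -> filterlim (fun t => f t + g t) F (locally (a + b))).
  { intros f g a b Hf Hg. eapply filterlim_comp_2; [exact Hf | exact Hg|].
    exact (filterlim_plus (V := R_NormedModule) a b). }
  induction M.
  - apply filterlim_ext with (fun t => u t 0%Z + u t (-1)%Z); [intros; now rewrite zpart_O|].
    rewrite zpart_O. now apply P.
  - apply filterlim_ext with (fun t => zpart (u t) M + (u t (Z.of_nat (S M)) + u t (- Z.of_nat (S (S M)))%Z));
      [intros; now rewrite zpart_S|].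
    rewrite zpart_S. apply P; [assumption | now apply P].
Qed.

(** Dominated convergence for sums over [Z]: cut at an index beyond which the
    dominating sum is small, and use that finite sums commute with limits. *)
Lemma Zsum_filterlim {T} (F : (T -> Prop) -> Prop) {FF : ProperFilter F}
  (u : T -> Z -> R) (l B : Z -> R) :
  Zsummable B -> F (fun t => forall k, Rabs (u t k) <= B k) ->
  (forall k, filterlim (fun t => u t k) F (locally (l k))) ->
  filterlim (fun t => Zsum (u t)) F (locally (Zsum l)).
Proof.
  intros HB Hd Hl.
  assert (HlB : forall k, Rabs (l k) <= B k).
  { intros k.
    assert (L : filterlim (fun t => Rabs (u t k)) F (locally (Rabs (l k)))).
    { eapply filterlim_comp; [apply Hl|]. exact (filterlim_norm (V := R_NormedModule) (l k)). }
    apply (filterlim_le (F := F) (fun t => Rabs (u t k)) (fun _ => B k) (Rabs (l k)) (B k)).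
    - apply filter_imp with (2 := Hd). auto.
    - exact L.
    - apply filterlim_const. }
  assert (Sl : Zsummable l) by now apply Zsummable_le with B.
  assert (B0 : forall k, 0 <= B k).
  { intros k. eapply Rle_trans; [apply Rabs_pos | apply (HlB k)]. }
  apply filterlim_locally. intros [eps He].
  destruct (Zsummable_tail_small B (eps / 3) HB) as [N HN]; [lra|].
  specialize (HN N (le_n N)).
  pose proof (zpart_filterlim F u l N Hl) as Lp.
  apply (proj1 (filterlim_locally _ _)) with (eps := mkposreal (eps/3) ltac:(lra)) in Lp.
  apply filter_imp with (2 := filter_and _ _ Hd Lp).
  intros t [Ht Hp].
  assert (St : Zsummable (u t)) by now apply Zsummable_le with B.
  assert (tail : forall f, (forall k, Rabs (f k) <= B k) -> Rabs (Zsum f - zpart f N) < eps / 3).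
  { intros f Hf. assert (Sf : Zsummable f) by now apply Zsummable_le with B.
    eapply Rle_lt_trans; [now apply Zsum_tail|].
    eapply Rle_lt_trans; [|exact HN].
    assert (Q : zpart (fun k => Rabs (B k) - Rabs (f k)) N <= Zsum (fun k => Rabs (B k) - Rabs (f k))).
    { apply zpart_le_Zsum.
      - intros k. rewrite (Rabs_pos_eq (B k)) by auto. generalize (Hf k); lra.
      - apply Zsummable_minus; now apply Zsummable_abs. }
    rewrite Zsum_minus in Q by now apply Zsummable_abs.
    rewrite (zpart_ext _ (fun k => Rabs (B k) + (-1) * Rabs (f k))) in Q by (intros; ring).
    rewrite zpart_plus, zpart_scal in Q. lra. }
  pose proof (tail (u t) Ht) as T1. pose proof (tail l HlB) as T2.
  unfold ball in Hp |- *; simpl in Hp |- *; unfold AbsRing_ball, abs, minus, plus, opp in Hp |- *; simpl in Hp |- *.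
  apply Rabs_def2 in T1, T2, Hp. apply Rabs_def1; lra.
Qed.

(** Finite double sums commute and are bounded by the iterated sum; let one
    window grow, then the other. *)
Lemma Zsum_Tonelli_le (F : Z -> Z -> R) :
  (forall j k, 0 <= F j k) -> (forall j, Zsummable (F j)) ->
  Zsummable (fun j => Zsum (F j)) ->
  (forall k, Zsummable (fun j => F j k)) /\
  Zsummable (fun k => Zsum (fun j => F j k)) /\
  Zsum (fun k => Zsum (fun j => F j k)) <= Zsum (fun j => Zsum (F j)).
Proof.
  intros H0 H1 H2. set (B := Zsum (fun j => Zsum (F j))).
  assert (Z0 : forall j, 0 <= Zsum (F j)) by (intros; apply Zsum_nonneg; auto).
  assert (fin : forall M N, zpart (fun k => zpart (fun j => F j k) M) N <= B).
  { intros M N. rewrite <- zpart_switch.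
    apply Rle_trans with (zpart (fun j => Zsum (F j)) M).
    - apply zpart_le. intros; apply zpart_le_Zsum; auto.
    - apply zpart_le_Zsum; auto. }
  assert (A : forall k, Zsummable (fun j => F j k)).
  { intros k. apply Zsummable_bound with B. intros M.
    rewrite (zpart_ext _ (fun j => F j k)) by (intros; now apply Rabs_pos_eq).
    destruct (zpart_term (fun k => zpart (fun j => F j k) M) k) as [N HN].
    - intros; apply zpart_nonneg; auto.
    - eapply Rle_trans; [apply (HN N); lia | apply fin]. }
  assert (C : forall N, zpart (fun k => Zsum (fun j => F j k)) N <= B).
  { intros N.
    apply (is_lim_seq_le (fun M => zpart (fun k => zpart (fun j => F j k) M) N) (fun _ => B)
             (zpart (fun k => Zsum (fun j => F j k)) N) B); [intros; apply fin | | apply is_lim_seq_const].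
    apply (zpart_filterlim eventually (fun M k => zpart (fun j => F j k) M)
             (fun k => Zsum (fun j => F j k))).
    intros k. exact (zpart_lim _ (A k)). }
  assert (D : Zsummable (fun k => Zsum (fun j => F j k))).
  { apply Zsummable_bound with B. intros N.
    rewrite (zpart_ext _ (fun k => Zsum (fun j => F j k))); [apply C|].
    intros; apply Rabs_pos_eq, Zsum_nonneg; auto. }
  repeat split; auto; try apply A; try apply D. now apply Zsum_le_bound.
Qed.

(** Fubini: Tonelli applied to the two non-negative families [F + |F|] and [|F|]. *)
Lemma Zsum_Fubini (F : Z -> Z -> R) :
  (forall j, Zsummable (F j)) -> Zsummable (fun j => Zsum (fun k => Rabs (F j k))) ->
  (forall k, Zsummable (fun j => F j k)) /\
  Zsummable (fun k => Zsum (fun j => Rabs (F j k))) /\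
  Zsum (fun k => Zsum (fun j => F j k)) = Zsum (fun j => Zsum (F j)).
Proof.
  intros H1 H2.
  assert (Ton : forall G : Z -> Z -> R, (forall j k, 0 <= G j k) -> (forall j, Zsummable (G j)) ->
    Zsummable (fun j => Zsum (G j)) ->
    Zsum (fun k => Zsum (fun j => G j k)) = Zsum (fun j => Zsum (G j))).
  { intros G G0 G1 G2. destruct (Zsum_Tonelli_le G G0 G1 G2) as (A & B & C).
    destruct (Zsum_Tonelli_le (fun k j => G j k)) as (_ & _ & D); auto.
    apply Rle_antisym; [exact C | exact D]. }
  assert (P : forall j k, 0 <= F j k + Rabs (F j k)).
  { intros. generalize (Rle_abs (- F j k)). rewrite Rabs_Ropp. lra. }
  assert (P' : forall j k, 0 <= Rabs (F j k)) by (intros; apply Rabs_pos).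
  assert (S1 : forall j, Zsummable (fun k => Rabs (F j k))) by (intros; now apply Zsummable_abs).
  assert (S2 : forall j, Zsummable (fun k => F j k + Rabs (F j k))) by (intros; now apply Zsummable_plus).
  assert (S3 : Zsummable (fun j => Zsum (F j))).
  { apply Zsummable_le with (2 := H2). intros; now apply Zsum_abs. }
  assert (S4 : Zsummable (fun j => Zsum (fun k => F j k + Rabs (F j k)))).
  { eapply Zsummable_ext; [|exact (Zsummable_plus _ _ S3 H2)].
    intros; simpl. now rewrite Zsum_plus. }
  destruct (Zsum_Tonelli_le _ P' S1 H2) as (A1 & B1 & _).
  pose proof (Ton _ P' S1 H2) as E1. pose proof (Ton _ P S2 S4) as E2.
  assert (A : forall k, Zsummable (fun j => F j k)).
  { intros k. eapply Zsummable_le; [|exact (A1 k)]. intros; simpl; apply Rle_refl. }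
  assert (S5 : Zsummable (fun k => Zsum (fun j => F j k))).
  { apply Zsummable_le with (2 := B1). intros; now apply Zsum_abs. }
  split; [exact A | split; [exact B1|]].
  rewrite (Zsum_ext _ (fun k => Zsum (fun j => F j k) + Zsum (fun j => Rabs (F j k)))) in E2
    by (intros; rewrite Zsum_plus; auto).
  rewrite (Zsum_ext (fun j => Zsum (fun k => F j k + Rabs (F j k)))
    (fun j => Zsum (F j) + Zsum (fun k => Rabs (F j k)))) in E2
    by (intros; rewrite Zsum_plus; auto).
  rewrite !Zsum_plus in E2 by auto. lra.
Qed.

Lemma zpart_shift1 f M :
  zpart (fun k => f (k + 1)%Z) M =
  zpart f M + f (Z.of_nat (S M)) - f (- Z.of_nat (S M))%Z.
Proof.
  induction M.
  - rewrite !zpart_O. simpl. ring.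
  - rewrite !zpart_S, IHM.
    replace (Z.of_nat (S M) + 1)%Z with (Z.of_nat (S (S M))) by lia.
    replace (- Z.of_nat (S (S M)) + 1)%Z with (- Z.of_nat (S M))%Z by lia. ring.
Qed.

Lemma Zsummable_shift1 f : Zsummable f -> Zsummable (fun k => f (k + 1)%Z).
Proof.
  intros Hf. apply Zsummable_bound with (2 * Zsum (fun k => Rabs (f k))). intros M.
  rewrite (zpart_shift1 (fun k => Rabs (f k))).
  generalize (zpart_le_Zsum (fun k => Rabs (f k)) M (fun k => Rabs_pos (f k)) (Zsummable_abs _ Hf)).
  generalize (Zsum_term (fun k => Rabs (f k)) (Z.of_nat (S M)) (fun k => Rabs_pos (f k)) (Zsummable_abs _ Hf)).
  generalize (Rabs_pos (f (- Z.of_nat (S M))%Z)). simpl. lra.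
Qed.

Lemma Zsummable_terms_lim f (v : nat -> Z) :
  Zsummable f -> (forall M, (Z.of_nat M < Z.abs (v M))%Z) -> is_lim_seq (fun M => f (v M)) 0.
Proof.
  intros Hf Hv. apply is_lim_seq_spec. intros [eps He].
  destruct (Zsummable_tail_small f (eps / 2) Hf) as [N HN]; [lra|].
  exists (S N). intros M HM. simpl. rewrite Rminus_0_r.
  specialize (HN N (le_n N)).
  (* the part of [|f|] outside a window has a sum at most [eps / 2] and contains [f (v M)] *)
  set (g := fun k : Z => if Z_le_gt_dec (Z.abs k) (Z.of_nat (S N)) then 0 else Rabs (f k)).
  assert (G0 : forall k, 0 <= g k).
  { intros k; unfold g; destruct Z_le_gt_dec; [lra | apply Rabs_pos]. }
  assert (Gf : forall k, g k <= Rabs (f k)).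
  { intros k; unfold g; destruct Z_le_gt_dec; [apply Rabs_pos | lra]. }
  assert (Gs : Zsummable g).
  { apply Zsummable_le with (2 := Zsummable_abs _ Hf). intros; rewrite Rabs_pos_eq; auto. }
  assert (E : zpart g N = 0).
  { unfold zpart.
    rewrite (sum_n_ext_loc _ (fun _ => 0)), (sum_n_ext_loc (fun n => g (- Z.of_nat (S n))%Z) (fun _ => 0)).
    - rewrite !sum_n_const. ring.
    - intros n Hn. unfold g. destruct Z_le_gt_dec; [reflexivity | lia].
    - intros n Hn. unfold g. destruct Z_le_gt_dec; [reflexivity | lia]. }
  assert (Q : zpart (fun k => Rabs (f k) - g k) N <= Zsum (fun k => Rabs (f k) - g k)).
  { apply zpart_le_Zsum; [intros k; generalize (Gf k); lra|].
    apply Zsummable_minus; auto using Zsummable_abs. }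
  rewrite Zsum_minus in Q by auto using Zsummable_abs.
  rewrite (zpart_ext _ (fun k => Rabs (f k) + (-1) * g k)) in Q by (intros; ring).
  rewrite zpart_plus, zpart_scal, E in Q.
  pose proof (Zsum_term g (v M) G0 Gs) as Tm.
  assert (Ev : g (v M) = Rabs (f (v M))).
  { unfold g. specialize (Hv M). destruct Z_le_gt_dec; [lia | reflexivity]. }
  rewrite Ev in Tm. lra.
Qed.

Lemma Zsum_shift1 f : Zsummable f -> Zsum (fun k => f (k + 1)%Z) = Zsum f.
Proof.
  intros Hf.
  assert (L : is_lim_seq (zpart (fun k => f (k + 1)%Z)) (Zsum f + 0 - 0)).
  { eapply is_lim_seq_ext; [intros; symmetry; apply zpart_shift1|].
    apply is_lim_seq_minus'.
    - apply is_lim_seq_plus'; [now apply zpart_lim|].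
      apply (Zsummable_terms_lim f (fun M => Z.of_nat (S M)) Hf). intros; lia.
    - apply (Zsummable_terms_lim f (fun M => - Z.of_nat (S M))%Z Hf). intros; lia. }
  pose proof (zpart_lim _ (Zsummable_shift1 f Hf)) as L'.
  apply is_lim_seq_unique in L. apply is_lim_seq_unique in L'.
  rewrite L in L'. injection L'. lra.
Qed.

Lemma Zsummable_shift_minus1 f : Zsummable f -> Zsummable (fun k => f (k - 1)%Z).
Proof.
  intros Hf. apply Zsummable_bound with (2 * Zsum (fun k => Rabs (f k))). intros M.
  pose proof (zpart_shift1 (fun k => Rabs (f (k - 1)%Z)) M) as E. simpl in E.
  rewrite (zpart_ext (fun k => Rabs (f (k + 1 - 1)%Z)) (fun k => Rabs (f k))) in E
    by (intros; do 2 f_equal; lia).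
  generalize (zpart_le_Zsum (fun k => Rabs (f k)) M (fun k => Rabs_pos (f k)) (Zsummable_abs _ Hf)).
  generalize (Zsum_term (fun k => Rabs (f k)) (- Z.of_nat (S M) - 1)%Z (fun k => Rabs_pos (f k)) (Zsummable_abs _ Hf)).
  generalize (Rabs_pos (f (Z.of_nat (S M) - 1)%Z)). simpl in *. lra.
Qed.

(** The window moved by one differs from the original in two boundary terms,
    which tend to zero. *)
Lemma Zsum_shift f j : Zsummable f ->
  Zsummable (fun k => f (k + j)%Z) /\ Zsum (fun k => f (k + j)%Z) = Zsum f.
Proof.
  intros Hf. induction j as [| j [A B] | j [A B]] using Z.peano_ind.
  - split; [eapply Zsummable_ext; [|exact Hf] | apply Zsum_ext]; intros; f_equal; lia.
  - split.
    + eapply Zsummable_ext; [|exact (Zsummable_shift1 _ A)]. intros; simpl; f_equal; lia.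
    + rewrite <- B, <- (Zsum_shift1 _ A). apply Zsum_ext; intros; simpl; f_equal; lia.
  - assert (C : Zsummable (fun k => f (k + Z.pred j)%Z)).
    { eapply Zsummable_ext; [|exact (Zsummable_shift_minus1 _ A)]. intros; simpl; f_equal; lia. }
    split; [exact C|].
    rewrite <- B, <- (Zsum_shift1 _ C). apply Zsum_ext; intros; simpl; f_equal; lia.
Qed.

(** * Elementary estimates for trigonometric functions *)

Lemma one_minus_cos x : 1 - cos x = 2 * sin (x / 2) ^ 2.
Proof. replace x with (2 * (x / 2)) at 1 by field. rewrite cos_2a_sin. ring. Qed.

Lemma abs_sin_le x : Rabs (sin x) <= Rabs x.
Proof.
  assert (P : forall y, 0 <= y -> Rabs (sin y) <= y).
  { intros y Hy. destruct (Rle_lt_dec y PI).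
    - rewrite Rabs_pos_eq by now apply sin_ge_0.
      destruct Hy as [Hy | <-]; [apply Rlt_le, sin_lt_x, Hy | rewrite sin_0; lra].
    - generalize (SIN_bound y) PI2_1. intros. apply Rabs_le. lra. }
  destruct (Rle_lt_dec 0 x).
  - rewrite (Rabs_pos_eq x) by assumption. now apply P.
  - rewrite (Rabs_left x), <- (Ropp_involutive x), sin_neg, Rabs_Ropp, Ropp_involutive by lra.
    apply P; lra.
Qed.

Lemma sin_cubic_bound x : 0 <= x <= 2 -> x - x ^ 3 / 6 <= sin x <= x.
Proof.
  intros [H0 H2]. split.
  - destruct (pre_sin_bound x 0) as [L _]; [lra | lra|].
    eapply Rle_trans; [|exact L]. right. unfold sin_approx, sin_term. simpl. field.
  - destruct H0 as [H0 | <-]; [apply Rlt_le, sin_lt_x, H0 | rewrite sin_0; lra].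
Qed.

Lemma sin_cubic_abs x : Rabs x <= 2 -> Rabs (x - sin x) <= Rabs x ^ 3 / 6.
Proof.
  intros H. destruct (Rle_lt_dec 0 x).
  - rewrite (Rabs_pos_eq x) in * by assumption.
    destruct (sin_cubic_bound x); [lra|]. rewrite Rabs_pos_eq; lra.
  - rewrite (Rabs_left x) in * by assumption.
    destruct (sin_cubic_bound (- x)); [lra|]. rewrite sin_neg in *.
    rewrite <- Rabs_Ropp, Rabs_pos_eq; lra.
Qed.

Lemma one_minus_cos_le x : 1 - cos x <= x ^ 2 / 2.
Proof.
  rewrite one_minus_cos.
  assert (sin (x/2) ^ 2 <= (x/2) ^ 2); [|lra].
  rewrite <- !Rsqr_pow2. apply Rsqr_le_abs_1, abs_sin_le.
Qed.

Lemma one_minus_cos_ge x : Rabs x <= 2 -> x ^ 2 / 3 <= 1 - cos x.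
Proof.
  intros H. rewrite one_minus_cos.
  assert (P : forall y, 0 <= y <= 2 -> y ^ 2 / 3 <= 2 * sin (y / 2) ^ 2).
  { intros y Hy. destruct (sin_cubic_bound (y / 2)); [lra|].
    assert (5 / 6 * (y / 2) <= sin (y / 2)) by nra. nra. }
  destruct (Rle_lt_dec 0 x).
  - apply P. rewrite Rabs_pos_eq in H; lra.
  - rewrite Rabs_left in H by assumption.
    specialize (P (- x) ltac:(lra)). replace (- x / 2) with (- (x / 2)) in P by field.
    rewrite sin_neg in P. nra.
Qed.

(** * The gauge [sqrt (1 + x^2) - 1] *)

(** A smooth substitute for [min (x^2, |x|)]. *)
Definition gauge (x : R) : R := sqrt (1 + x ^ 2) - 1.

Lemma bracket_spec x :
  1 <= sqrt (1 + x ^ 2) /\ sqrt (1 + x ^ 2) <= 1 + Rabs x /\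
  sqrt (1 + x ^ 2) * sqrt (1 + x ^ 2) = 1 + x ^ 2.
Proof.
  assert (S : sqrt (1 + x ^ 2) * sqrt (1 + x ^ 2) = 1 + x ^ 2) by (apply sqrt_sqrt; nra).
  repeat split; auto.
  - rewrite <- sqrt_1 at 1. apply sqrt_le_1; nra.
  - rewrite <- (sqrt_pow2 (1 + Rabs x)) by (generalize (Rabs_pos x); lra).
    apply sqrt_le_1_alt. rewrite <- (pow2_abs x). generalize (Rabs_pos x); nra.
Qed.

Lemma gauge_even x : gauge (- x) = gauge x.
Proof. unfold gauge. do 2 f_equal. ring. Qed.

Lemma gauge_0 : gauge 0 = 0.
Proof. unfold gauge. replace (1 + 0 ^ 2) with 1 by ring. rewrite sqrt_1. ring. Qed.

Lemma gauge_nonneg x : 0 <= gauge x.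
Proof. unfold gauge. generalize (bracket_spec x). lra. Qed.

Lemma gauge_le_abs x : gauge x <= Rabs x.
Proof. unfold gauge. generalize (bracket_spec x). lra. Qed.

Lemma gauge_le_sq x : gauge x <= x ^ 2 / 2.
Proof. unfold gauge. generalize (bracket_spec x). nra. Qed.

Lemma gauge_ge_sq x : Rabs x <= 4 -> x ^ 2 <= 6 * gauge x.
Proof.
  intros H. unfold gauge. destruct (bracket_spec x) as (A & B & C). nra.
Qed.

Lemma gauge_ge_sq2 x : Rabs x <= 2 -> x ^ 2 <= 4 * gauge x.
Proof.
  intros H. unfold gauge. destruct (bracket_spec x) as (A & B & C). nra.
Qed.

Lemma gauge_ge_abs x : 2 <= Rabs x -> Rabs x <= 2 * gauge x.
Proof.
  intros H. unfold gauge. destruct (bracket_spec x) as (A & B & C).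
  rewrite <- (pow2_abs x) in *. nra.
Qed.

Lemma gauge_incr x y : Rabs x <= Rabs y -> gauge x <= gauge y.
Proof.
  intros H. unfold gauge. apply Rplus_le_compat_r, sqrt_le_1; try nra.
  apply Rplus_le_compat_l. rewrite <- !Rsqr_pow2. now apply Rsqr_le_abs_1.
Qed.

Lemma gauge_dilate_ge l x : 1 <= l -> l * gauge x <= gauge (l * x).
Proof.
  intros H. unfold gauge. destruct (bracket_spec x) as (A & B & C).
  destruct (bracket_spec (l * x)) as (A' & B' & C').
  set (s := sqrt (1 + x ^ 2)) in *. set (t := sqrt (1 + (l * x) ^ 2)) in *.
  assert (t * t >= (1 + l * (s - 1)) * (1 + l * (s - 1))).
  { rewrite C'. replace ((l * x) ^ 2) with (l * l * (s * s - 1)) by (rewrite C; ring).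
    assert (0 <= (l - 1) * (l * (s - 1))) by (repeat apply Rmult_le_pos; lra). nra. }
  assert (1 + l * (s - 1) <= t); [|lra].
  assert (0 <= l * (s - 1)) by nra. nra.
Qed.

Lemma gauge_dilate_le l x : 1 <= l -> gauge (l * x) <= l ^ 2 * gauge x.
Proof.
  intros H. unfold gauge. destruct (bracket_spec x) as (A & B & C).
  destruct (bracket_spec (l * x)) as (A' & B' & C').
  set (s := sqrt (1 + x ^ 2)) in *. set (t := sqrt (1 + (l * x) ^ 2)) in *.
  assert (E : (t - 1) * (t + 1) = l ^ 2 * (s - 1) * (s + 1)).
  { replace ((t - 1) * (t + 1)) with (t * t - 1) by ring.
    rewrite C'. replace (l ^ 2 * (s - 1) * (s + 1)) with (l ^ 2 * (s * s - 1)) by ring.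
    rewrite C. ring. }
  assert (s <= t).
  { apply sqrt_le_1; try nra. apply Rplus_le_compat_l.
    replace ((l * x) ^ 2) with (l ^ 2 * x ^ 2) by ring.
    assert (0 <= x ^ 2) by nra. assert (1 <= l ^ 2) by nra. nra. }
  apply Rmult_le_reg_r with (t + 1); [lra|]. rewrite E.
  apply Rmult_le_compat_l; [|lra]. apply Rmult_le_pos; nra.
Qed.

Definition gauge' (x : R) : R := x / sqrt (1 + x ^ 2).

Lemma gauge_derive x : is_derive gauge x (gauge' x).
Proof.
  unfold gauge, gauge'. auto_derive.
  - nra.
  - replace (1 + x * (x * 1)) with (1 + x ^ 2) by ring.
    generalize (bracket_spec x). intros. field. lra.
Qed.

Lemma gauge'_bound x : Rabs (gauge' x) <= 1.
Proof.
  unfold gauge', Rdiv. destruct (bracket_spec x) as (A & B & C).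
  rewrite Rabs_mult, Rabs_inv, (Rabs_pos_eq (sqrt _)) by lra.
  apply Rmult_le_reg_r with (sqrt (1 + x ^ 2)); [lra|].
  rewrite Rmult_assoc, Rinv_l, Rmult_1_r, Rmult_1_l by lra.
  rewrite <- (pow2_abs x) in *. generalize (Rabs_pos x); nra.
Qed.

Lemma gauge'_continuous x : continuous gauge' x.
Proof.
  apply (ex_derive_continuous (V := R_NormedModule)). unfold gauge'. auto_derive.
  generalize (bracket_spec x). replace (1 + x * (x * 1)) with (1 + x ^ 2) by ring.
  intros H. repeat split; nra.
Qed.

Lemma gauge_le_mul_gauge' x : gauge x <= x * gauge' x.
Proof.
  unfold gauge, gauge'. destruct (bracket_spec x) as (A & B & C).
  set (s := sqrt (1 + x ^ 2)) in *.
  replace (x * (x / s)) with (x ^ 2 / s) by (field; lra).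
  apply Rmult_le_reg_r with s; [lra|].
  unfold Rdiv. rewrite Rmult_assoc, Rinv_l by lra. nra.
Qed.

(** [|e^{ix} - 1|] *)
Definition chord (x : R) : R := 2 * Rabs (sin (x / 2)).

Lemma chord_sq x : chord x ^ 2 = (cos x - 1) ^ 2 + sin x ^ 2.
Proof.
  unfold chord. replace ((2 * Rabs (sin (x / 2))) ^ 2) with (2 * (2 * Rabs (sin (x / 2)) ^ 2)) by ring.
  rewrite pow2_abs, <- one_minus_cos. generalize (sin2_cos2 x). unfold Rsqr. nra.
Qed.

Lemma chord_nonneg x : 0 <= chord x.
Proof. unfold chord. generalize (Rabs_pos (sin (x / 2))). lra. Qed.

Lemma chord_le_gauge x : Rabs x * chord x <= 4 * gauge x.
Proof.
  destruct (Rle_lt_dec (Rabs x) 2) as [H | H].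
  - assert (chord x <= Rabs x).
    { unfold chord. generalize (abs_sin_le (x / 2)). unfold Rdiv.
      rewrite (Rabs_mult x), (Rabs_pos_eq (/ 2)) by lra. lra. }
    generalize (gauge_ge_sq2 x H) (Rabs_pos x). rewrite <- (pow2_abs x). nra.
  - assert (chord x <= 2).
    { unfold chord. assert (Rabs (sin (x/2)) <= 1); [|lra].
      apply Rabs_le, SIN_bound. }
    generalize (gauge_ge_abs x ltac:(lra)). nra.
Qed.

Lemma one_minus_cos_le_gauge x : 1 - cos x <= 2 * gauge x.
Proof.
  destruct (Rle_lt_dec (Rabs x) 2) as [H | H].
  - generalize (gauge_ge_sq2 x H) (one_minus_cos_le x). lra.
  - generalize (gauge_ge_abs x ltac:(lra)) (COS_bound x). lra.
Qed.

Lemma sin_linear_le_gauge x : Rabs (x - sin x) <= 4 * gauge x.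
Proof.
  destruct (Rle_lt_dec (Rabs x) 2) as [H | H].
  - generalize (gauge_ge_sq2 x H) (sin_cubic_abs x H) (Rabs_pos x).
    rewrite <- (pow2_abs x). nra.
  - generalize (gauge_ge_abs x ltac:(lra)) (abs_sin_le x) (Rabs_triang x (- sin x)).
    rewrite Rabs_Ropp. unfold Rminus. lra.
Qed.

(** * Fourier series with summable coefficients *)

Definition moment (p : Z -> R) (k : Z) : R := IZR k * p k.

Lemma Zsummable_mult p b B :
  Zsummable p -> (forall k, Rabs (b k) <= B) -> Zsummable (fun k => p k * b k).
Proof.
  intros Hp Hb. apply Zsummable_le with (fun k => B * Rabs (p k)).
  - intros k. rewrite Rabs_mult, Rmult_comm. apply Rmult_le_compat_r; [apply Rabs_pos | apply Hb].
  - now apply Zsummable_scal, Zsummable_abs.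
Qed.

Lemma Zsummable_cos p t : Zsummable p -> Zsummable (fun k => p k * cos (IZR k * t)).
Proof. intros Hp. apply Zsummable_mult with 1; [exact Hp | intros; apply Rabs_le, COS_bound]. Qed.

Lemma Zsummable_sin p t : Zsummable p -> Zsummable (fun k => p k * sin (IZR k * t)).
Proof. intros Hp. apply Zsummable_mult with 1; [exact Hp | intros; apply Rabs_le, SIN_bound]. Qed.

Lemma fourier_pair p t :
  fourier p t = (Zsum (fun k => p k * cos (IZR k * t)), Zsum (fun k => p k * sin (IZR k * t))).
Proof.
  unfold fourier, CZsum. f_equal; apply Zsum_ext; intros k; simpl; ring.
Qed.

Lemma Re_fourier p t : Re (fourier p t) = Zsum (fun k => p k * cos (IZR k * t)).
Proof. now rewrite fourier_pair. Qed.

Lemma Im_fourier p t : Im (fourier p t) = Zsum (fun k => p k * sin (IZR k * t)).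
Proof. now rewrite fourier_pair. Qed.

Lemma fourier_0 p : fourier p 0 = RtoC (Zsum p).
Proof.
  rewrite fourier_pair. unfold RtoC. f_equal.
  - apply Zsum_ext. intros. rewrite Rmult_0_r, cos_0. ring.
  - rewrite (Zsum_ext _ (fun _ => 0)); [apply Zsum_0|].
    intros. rewrite Rmult_0_r, sin_0. ring.
Qed.

Lemma fourier_ext p q t : (forall k, p k = q k) -> fourier p t = fourier q t.
Proof. intros H. now rewrite (functional_extensionality p q H). Qed.

Lemma fourier_opp p t : fourier p (- t) = Cconj (fourier p t).
Proof.
  rewrite !fourier_pair. unfold Cconj; simpl. f_equal.
  - apply Zsum_ext. intros. now rewrite <- Ropp_mult_distr_r, cos_neg.
  - transitivity ((-1) * Zsum (fun k => p k * sin (IZR k * t))); [|ring].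
    rewrite <- Zsum_scal. apply Zsum_ext. intros. rewrite <- Ropp_mult_distr_r, sin_neg. ring.
Qed.

Lemma fourier_2PI p t : fourier p (t + 2 * PI) = fourier p t.
Proof.
  assert (P : forall k : Z, exists a : Z, IZR k * (t + 2 * PI) = IZR k * t + 2 * IZR a * PI).
  { intros k. exists k. ring. }
  assert (Q : forall x (a : Z), cos (x + 2 * IZR a * PI) = cos x /\ sin (x + 2 * IZR a * PI) = sin x).
  { intros x a. destruct (Z_le_gt_dec 0 a).
    - replace a with (Z.of_nat (Z.to_nat a)) by lia. rewrite <- INR_IZR_INZ.
      split; [apply cos_period | apply sin_period].
    - pose proof (cos_period (x + 2 * IZR a * PI) (Z.to_nat (- a))) as A.
      pose proof (sin_period (x + 2 * IZR a * PI) (Z.to_nat (- a))) as B.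
      replace (x + 2 * IZR a * PI + 2 * INR (Z.to_nat (- a)) * PI) with x in A, B; [now split|].
      rewrite INR_IZR_INZ, Z2Nat.id, opp_IZR by lia. ring. }
  rewrite !fourier_pair. f_equal; apply Zsum_ext; intros k; destruct (P k) as [a ->];
    destruct (Q (IZR k * t) a) as [E1 E2]; now rewrite ?E1, ?E2.
Qed.

Lemma fourier_plus p q t : Zsummable p -> Zsummable q ->
  fourier (fun k => p k + q k) t = (fourier p t + fourier q t)%C.
Proof.
  intros Hp Hq. rewrite !fourier_pair. unfold Cplus; simpl. f_equal.
  - rewrite <- Zsum_plus by auto using Zsummable_cos. apply Zsum_ext; intros; ring.
  - rewrite <- Zsum_plus by auto using Zsummable_sin. apply Zsum_ext; intros; ring.
Qed.

Lemma fourier_scal c p t : fourier (fun k => c * p k) t = (RtoC c * fourier p t)%C.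
Proof.
  rewrite !fourier_pair. unfold Cmult; simpl. f_equal.
  - rewrite Rmult_0_l, Rminus_0_r, <- Zsum_scal. apply Zsum_ext; intros; ring.
  - rewrite Rmult_0_l, Rplus_0_r, <- Zsum_scal. apply Zsum_ext; intros; ring.
Qed.

Lemma fourier_minus p q t : Zsummable p -> Zsummable q ->
  fourier (fun k => p k - q k) t = (fourier p t - fourier q t)%C.
Proof.
  intros Hp Hq. rewrite (fourier_ext _ (fun k => p k + (-1) * q k)) by (intros; ring).
  rewrite fourier_plus, fourier_scal by auto using Zsummable_scal.
  apply injective_projections; simpl; ring.
Qed.

Lemma fourier_delta0 t : fourier delta0 t = 1%C.
Proof.
  assert (E : forall g : Z -> R, Zsum (fun k => delta0 k * g k) = g 0%Z).
  { intros g. unfold Zsum.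
    rewrite (Series_ext (fun n => delta0 (- Z.of_nat (S n)) * g (- Z.of_nat (S n))%Z) (fun n => 0 * 0)).
    2: { intros n. unfold delta0. destruct Z.eq_dec; [lia | ring]. }
    rewrite Series_scal_l, Rmult_0_l, Rplus_0_r.
    rewrite (Series_ext _ (fun n => g 0%Z * (match n with O => 1 | _ => 0 end))).
    2: { intros [|n]; unfold delta0; destruct Z.eq_dec; try lia; simpl; ring. }
    rewrite Series_scal_l. rewrite (is_series_unique _ 1); [ring|].
    apply (is_series_decr_1 (K := R_AbsRing) (V := R_NormedModule)).
    unfold plus, opp; simpl. rewrite Rplus_opp_r.
    apply filterlim_ext with (fun _ : nat => 0); [|apply filterlim_const].
    intros n. induction n; [now rewrite sum_O | rewrite sum_Sn, <- IHn; unfold plus; simpl; ring]. }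
  rewrite fourier_pair, !E, Rmult_0_l, cos_0, sin_0. reflexivity.
Qed.

Lemma Cmod_pair_le x y : Cmod (x, y) <= Rabs x + Rabs y.
Proof.
  unfold Cmod; simpl fst; simpl snd.
  rewrite <- (sqrt_pow2 (Rabs x + Rabs y)) by (apply Rplus_le_le_0_compat; apply Rabs_pos).
  apply sqrt_le_1_alt. rewrite <- (pow2_abs x), <- (pow2_abs y).
  generalize (Rabs_pos x) (Rabs_pos y). nra.
Qed.

Lemma dot_le_Cmod (z : C) a b r : 0 <= r -> a ^ 2 + b ^ 2 <= r ^ 2 ->
  Rabs (Re z * a + Im z * b) <= Cmod z * r.
Proof.
  intros Hr H. apply Rsqr_incr_0_var; [|apply Rmult_le_pos; auto; apply Cmod_ge_0].
  rewrite <- Rsqr_abs. unfold Rsqr.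
  replace (Cmod z * r * (Cmod z * r)) with (Cmod z ^ 2 * r ^ 2) by ring.
  rewrite Cmod2_alt. set (x := Re z). set (y := Im z).
  apply Rle_trans with ((x ^ 2 + y ^ 2) * (a ^ 2 + b ^ 2)).
  - assert (0 <= (x * b - y * a) ^ 2) by apply pow2_ge_0. nra.
  - apply Rmult_le_compat_l; [|assumption]. generalize (pow2_ge_0 x) (pow2_ge_0 y). lra.
Qed.

(** Testing [z] against itself turns the triangle inequality for complex sums
    into an inequality between real sums. *)
Lemma Cmod_le_of_dot (z : C) (a b q : Z -> R) :
  Zsummable q -> Zsummable (fun k => Re z * a k + Im z * b k) ->
  (forall k, a k ^ 2 + b k ^ 2 <= q k ^ 2) -> (forall k, 0 <= q k) ->
  Cmod z ^ 2 = Zsum (fun k => Re z * a k + Im z * b k) ->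
  Cmod z <= Zsum q.
Proof.
  intros Hq Hs Hab H0 E.
  assert (L : Cmod z ^ 2 <= Cmod z * Zsum q).
  { rewrite E, <- Zsum_scal. apply Zsum_le; auto using Zsummable_scal.
    intros k. eapply Rle_trans; [apply Rle_abs|]. now apply dot_le_Cmod. }
  destruct (Rle_lt_or_eq_dec 0 (Cmod z) (Cmod_ge_0 z)) as [P | <-]; [nra|].
  now apply Zsum_nonneg.
Qed.

Lemma fourier_bound p t : Zsummable p -> Cmod (fourier p t) <= Zsum (fun k => Rabs (p k)).
Proof.
  intros Hp. set (z := fourier p t).
  apply Cmod_le_of_dot with (fun k => p k * cos (IZR k * t)) (fun k => p k * sin (IZR k * t)).
  - now apply Zsummable_abs.
  - auto using Zsummable_plus, Zsummable_scal, Zsummable_cos, Zsummable_sin.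
  - intros k. rewrite pow2_abs. generalize (sin2_cos2 (IZR k * t)). unfold Rsqr. intros.
    replace ((p k * cos (IZR k * t)) ^ 2 + (p k * sin (IZR k * t)) ^ 2) with
      (p k ^ 2 * (sin (IZR k * t) * sin (IZR k * t) + cos (IZR k * t) * cos (IZR k * t))) by ring.
    rewrite H. lra.
  - intros; apply Rabs_pos.
  - rewrite Zsum_plus, !Zsum_scal by auto using Zsummable_scal, Zsummable_cos, Zsummable_sin.
    unfold z. rewrite <- Re_fourier, <- Im_fourier, Cmod2_alt. ring.
Qed.

(** When the coefficients sum to zero, each [e^{ikt}] may be replaced by
    [e^{ikt} - 1], which is small near the origin. *)
Lemma fourier_chord_bound p q t : Zsummable p -> Zsum p = 0 -> Zsummable q ->
  (forall k, Rabs (p k) * chord (IZR k * t) <= q k) ->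
  Cmod (fourier p t) <= Zsum q.
Proof.
  intros Hp H0 Hq Hc. set (z := fourier p t).
  apply Cmod_le_of_dot with (fun k => p k * cos (IZR k * t) - p k) (fun k => p k * sin (IZR k * t)).
  - exact Hq.
  - auto 6 using Zsummable_plus, Zsummable_scal, Zsummable_cos, Zsummable_sin, Zsummable_minus.
  - intros k. apply Rle_trans with ((Rabs (p k) * chord (IZR k * t)) ^ 2).
    + rewrite (Rpow_mult_distr (Rabs (p k))), pow2_abs, chord_sq. right. ring.
    + apply pow_incr. split; auto. apply Rmult_le_pos; [apply Rabs_pos | apply chord_nonneg].
  - intros k. eapply Rle_trans; [|apply Hc]. apply Rmult_le_pos; [apply Rabs_pos | apply chord_nonneg].
  - rewrite Zsum_plus, !Zsum_scal, Zsum_minus, H0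
      by auto using Zsummable_scal, Zsummable_cos, Zsummable_sin, Zsummable_minus.
    unfold z. rewrite <- Re_fourier, <- Im_fourier, Cmod2_alt. ring.
Qed.

Lemma fourier_shift p t : Zsummable p ->
  fourier (fun k => p (k - 1)%Z) t = (cis t * fourier p t)%C.
Proof.
  intros Hp.
  destruct (Zsum_shift (fun k => p k * cos (IZR (k + 1) * t)) (-1)) as [_ E1].
  { apply Zsummable_mult with 1; [exact Hp | intros; apply Rabs_le, COS_bound]. }
  destruct (Zsum_shift (fun k => p k * sin (IZR (k + 1) * t)) (-1)) as [_ E2].
  { apply Zsummable_mult with 1; [exact Hp | intros; apply Rabs_le, SIN_bound]. }
  rewrite !fourier_pair. unfold cis, Cmult; simpl. f_equal.
  - rewrite <- !Zsum_scal, <- Zsum_minus by auto using Zsummable_scal, Zsummable_cos, Zsummable_sin.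
    transitivity (Zsum (fun k => p (k + -1)%Z * cos (IZR (k + -1 + 1) * t))).
    + apply Zsum_ext. intros k. do 4 f_equal. lia.
    + rewrite E1. apply Zsum_ext. intros k. rewrite plus_IZR, Rmult_plus_distr_r, Rmult_1_l, cos_plus. ring.
  - rewrite <- !Zsum_scal, <- Zsum_plus by auto using Zsummable_scal, Zsummable_cos, Zsummable_sin.
    transitivity (Zsum (fun k => p (k + -1)%Z * sin (IZR (k + -1 + 1) * t))).
    + apply Zsum_ext. intros k. do 4 f_equal. lia.
    + rewrite E2. apply Zsum_ext. intros k. rewrite plus_IZR, Rmult_plus_distr_r, Rmult_1_l, sin_plus. ring.
Qed.

(** Termwise differentiation under a summable bound on the derivatives: by the
    mean value theorem the same bound dominates the difference quotients. *)
Lemma Zsum_derive (f g : Z -> R -> R) (B : Z -> R) x :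
  Zsummable B -> (forall k y, is_derive (f k) y (g k y)) ->
  (forall k y, Rabs (g k y) <= B k) -> (forall y, Zsummable (fun k => f k y)) ->
  is_derive (fun y => Zsum (fun k => f k y)) x (Zsum (fun k => g k x)).
Proof.
  intros HB Hd Hg Hf. apply is_derive_Reals.
  assert (PF : ProperFilter (locally' 0)).
  { apply Build_ProperFilter; [|apply locally'_filter].
    intros P [d Hd0]. exists (d / 2). apply (Hd0 (d / 2)).
    - unfold ball; simpl. unfold AbsRing_ball, abs, minus, plus, opp; simpl.
      generalize (cond_pos d). intros. rewrite Ropp_0, Rplus_0_r, Rabs_pos_eq; lra.
    - generalize (cond_pos d). intros. lra. }
  assert (L : filterlim (fun h => Zsum (fun k => (f k (x + h) - f k x) / h)) (locally' 0)
                (locally (Zsum (fun k => g k x)))).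
  { apply (Zsum_filterlim (locally' 0) _ _ B HB).
    - exists (mkposreal 1 Rlt_0_1). intros h _ Hh k.
      destruct (MVT_gen (f k) x (x + h) (g k)) as (c & _ & E).
      + intros; apply Hd.
      + intros y _. apply continuity_pt_filterlim.
        apply (ex_derive_continuous (V := R_NormedModule)). eexists; apply Hd.
      + rewrite E. replace (g k c * (x + h - x) / h) with (g k c) by (field; exact Hh). apply Hg.
    - intros k. apply filterlim_locally. intros eps.
      pose proof (proj1 (is_derive_Reals _ _ _) (Hd k x) eps (cond_pos eps)) as [d Hd'].
      exists d. intros h Hh Hn. apply Hd'; [exact Hn|].
      unfold ball in Hh; simpl in Hh. unfold AbsRing_ball, abs, minus, plus, opp in Hh; simpl in Hh.
      now rewrite Ropp_0, Rplus_0_r in Hh. }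
  intros eps He. apply (proj1 (filterlim_locally _ _)) with (eps := mkposreal eps He) in L.
  destruct L as [d L]. exists d. intros h Hn Hh.
  assert (Bh : ball 0 d h).
  { unfold ball; simpl. unfold AbsRing_ball, abs, minus, plus, opp; simpl. now rewrite Ropp_0, Rplus_0_r. }
  specialize (L h Bh Hn).
  unfold ball in L; simpl in L. unfold AbsRing_ball, abs, minus, plus, opp in L; simpl in L.
  replace ((Zsum (fun k => f k (x + h)) - Zsum (fun k => f k x)) / h) with
    (Zsum (fun k => (f k (x + h) - f k x) / h)); [exact L|].
  unfold Rdiv. rewrite <- Zsum_minus by auto. rewrite Rmult_comm, <- Zsum_scal.
  apply Zsum_ext; intros; ring.
Qed.

Lemma Zsum_continuous (f : Z -> R -> R) (B : Z -> R) x :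
  Zsummable B -> (forall k, continuous (f k) x) -> (forall k y, Rabs (f k y) <= B k) ->
  continuous (fun y => Zsum (fun k => f k y)) x.
Proof.
  intros HB Hc Hb. apply (Zsum_filterlim (locally x) (fun y k => f k y) (fun k => f k x) B HB).
  - apply filter_forall. auto.
  - intros k; apply Hc.
Qed.

Lemma continuous_pair (u v : R -> R) x : continuous u x -> continuous v x ->
  continuous (fun t => (u t, v t) : C) x.
Proof.
  intros Hu Hv. apply filterlim_locally. intros eps.
  apply (proj1 (filterlim_locally _ _)) with (eps := eps) in Hu.
  apply (proj1 (filterlim_locally _ _)) with (eps := eps) in Hv.
  generalize (filter_and _ _ Hu Hv). apply filter_imp. intros t [A B]. split; assumption.
Qed.

Lemma is_derive_pair (u v : R -> R) x du dv : is_derive u x du -> is_derive v x dv ->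
  is_derive (V := C_R_NormedModule) (fun t => (u t, v t)) x (du, dv).
Proof.
  intros Hu Hv.
  apply (is_derive_scal_l (V := C_R_NormedModule) u x du (1, 0)) in Hu.
  apply (is_derive_scal_l (V := C_R_NormedModule) v x dv (0, 1)) in Hv.
  pose proof (is_derive_plus (V := C_R_NormedModule) _ _ _ _ _ Hu Hv) as D.
  match type of D with is_derive _ _ ?l => replace (du, dv) with l end.
  - eapply is_derive_ext; [|exact D]. intros t. unfold plus, scal, mult; simpl.
    unfold prod_plus, prod_scal, plus, scal, mult; simpl. unfold mult; simpl. f_equal; ring.
  - unfold plus, scal, mult; simpl. unfold prod_plus, prod_scal, plus, scal, mult; simpl.
    unfold mult; simpl. f_equal; ring.
Qed.

Lemma fourier_derive_parts p x : Zsummable p -> Zsummable (moment p) ->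
  is_derive (fun t => Re (fourier p t)) x (- Im (fourier (moment p) x)) /\
  is_derive (fun t => Im (fourier p t)) x (Re (fourier (moment p) x)).
Proof.
  intros Hp Hm. split.
  - apply is_derive_ext with (fun t => Zsum (fun k => p k * cos (IZR k * t))).
    { intros; now rewrite Re_fourier. }
    replace (- Im (fourier (moment p) x)) with (Zsum (fun k => - (moment p k * sin (IZR k * x)))).
    2: { rewrite Im_fourier, (Zsum_ext _ (fun k => (-1) * (moment p k * sin (IZR k * x)))) by (intros; ring).
         rewrite Zsum_scal. ring. }
    apply (Zsum_derive (fun k t => p k * cos (IZR k * t)) (fun k t => - (moment p k * sin (IZR k * t)))
             (fun k => Rabs (moment p k))).
    + now apply Zsummable_abs.
    + intros k y. unfold moment. auto_derive; [exact I | ring].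
    + intros k y. rewrite Rabs_Ropp, Rabs_mult. rewrite <- (Rmult_1_r (Rabs (moment p k))) at 2.
      apply Rmult_le_compat_l; [apply Rabs_pos | apply Rabs_le, SIN_bound].
    + intros y. now apply Zsummable_cos.
  - apply is_derive_ext with (fun t => Zsum (fun k => p k * sin (IZR k * t))).
    { intros; now rewrite Im_fourier. }
    rewrite Re_fourier.
    apply (Zsum_derive (fun k t => p k * sin (IZR k * t)) (fun k t => moment p k * cos (IZR k * t))
             (fun k => Rabs (moment p k))).
    + now apply Zsummable_abs.
    + intros k y. unfold moment. auto_derive; [exact I | ring].
    + intros k y. rewrite Rabs_mult. rewrite <- (Rmult_1_r (Rabs (moment p k))) at 2.
      apply Rmult_le_compat_l; [apply Rabs_pos | apply Rabs_le, COS_bound].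
    + intros y. now apply Zsummable_sin.
Qed.

Lemma fourier_continuous_parts p x : Zsummable p ->
  continuous (fun t => Re (fourier p t)) x /\ continuous (fun t => Im (fourier p t)) x.
Proof.
  intros Hp. split.
  - apply continuous_ext with (fun t => Zsum (fun k => p k * cos (IZR k * t))).
    { intros; now rewrite Re_fourier. }
    apply (Zsum_continuous (fun k t => p k * cos (IZR k * t)) (fun k => Rabs (p k))).
    + now apply Zsummable_abs.
    + intros k. apply (ex_derive_continuous (V := R_NormedModule)). auto_derive. exact I.
    + intros k y. rewrite Rabs_mult. rewrite <- (Rmult_1_r (Rabs (p k))) at 2.
      apply Rmult_le_compat_l; [apply Rabs_pos | apply Rabs_le, COS_bound].
  - apply continuous_ext with (fun t => Zsum (fun k => p k * sin (IZR k * t))).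
    { intros; now rewrite Im_fourier. }
    apply (Zsum_continuous (fun k t => p k * sin (IZR k * t)) (fun k => Rabs (p k))).
    + now apply Zsummable_abs.
    + intros k. apply (ex_derive_continuous (V := R_NormedModule)). auto_derive. exact I.
    + intros k y. rewrite Rabs_mult. rewrite <- (Rmult_1_r (Rabs (p k))) at 2.
      apply Rmult_le_compat_l; [apply Rabs_pos | apply Rabs_le, SIN_bound].
Qed.

(** * Convolution *)

(** The bounded factor [b] makes one statement serve for the sum of a convolution
    ([b = 1]) and for its Fourier transform (sine and cosine). *)
Lemma conv_Fubini p q b : Zsummable p -> Zsummable q -> (forall n, Rabs (b n) <= 1) ->
  (forall n, Zsummable (fun k => p k * q (n - k)%Z * b n)) /\
  Zsummable (fun n => Zsum (fun k => Rabs (p k * q (n - k)%Z * b n))) /\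
  Zsum (fun n => Zsum (fun k => p k * q (n - k)%Z * b n)) =
  Zsum (fun k => p k * Zsum (fun m => q m * b (m + k)%Z)).
Proof.
  intros Hp Hq Hb.
  assert (Sq : forall k, Zsummable (fun n => q (n - k)%Z)).
  { intros k. apply (Zsum_shift q (- k) Hq). }
  assert (S1 : forall k, Zsummable (fun n => p k * q (n - k)%Z * b n)).
  { intros k. apply Zsummable_mult with 1; [|exact Hb]. now apply (Zsummable_scal (p k)). }
  destruct (Zsum_Fubini (fun k n => p k * q (n - k)%Z * b n) S1) as (A & B & C).
  - apply Zsummable_le with (fun k => Zsum (fun n => Rabs (q n)) * Rabs (p k));
      [|now apply Zsummable_scal, Zsummable_abs].
    intros k. rewrite Rabs_pos_eq.
    2: { apply Zsum_nonneg; [intros; apply Rabs_pos | apply Zsummable_abs, S1]. }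
    destruct (Zsum_shift (fun n => Rabs (q n)) (- k) (Zsummable_abs _ Hq)) as [A E].
    rewrite <- E, Rmult_comm, <- Zsum_scal.
    apply Zsum_le; [|apply Zsummable_abs, S1 | now apply Zsummable_scal].
    intros n. rewrite !Rabs_mult. change (n + - k)%Z with (n - k)%Z.
    generalize (Hb n) (Rabs_pos (p k)) (Rabs_pos (q (n - k)%Z)) (Rabs_pos (b n)). intros.
    rewrite <- (Rmult_1_r (Rabs (p k) * Rabs (q (n - k)%Z))) at 2.
    apply Rmult_le_compat_l; [now apply Rmult_le_pos | assumption].
  - split; [exact A | split; [exact B|]]. rewrite C. apply Zsum_ext. intros k.
    rewrite <- Zsum_scal.
    destruct (Zsum_shift (fun m => p k * (q m * b (m + k)%Z)) (- k)) as [_ E].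
    { apply Zsummable_scal, Zsummable_mult with 1; [exact Hq | intros; apply Hb]. }
    rewrite <- E. apply Zsum_ext. intros n.
    replace (n + - k + k)%Z with n by lia. change (n + - k)%Z with (n - k)%Z. ring.
Qed.

Lemma conv_summable_terms p q n : Zsummable p -> Zsummable q ->
  Zsummable (fun k => p k * q (n - k)%Z).
Proof.
  intros Hp Hq. destruct (conv_Fubini p q (fun _ => 1) Hp Hq) as (A & _ & _).
  - intros; rewrite Rabs_R1; lra.
  - eapply Zsummable_ext; [|exact (A n)]. intros; simpl; ring.
Qed.

Lemma conv_summable p q : Zsummable p -> Zsummable q -> Zsummable (conv p q).
Proof.
  intros Hp Hq. destruct (conv_Fubini p q (fun _ => 1) Hp Hq) as (A & B & _).
  - intros; rewrite Rabs_R1; lra.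
  - apply Zsummable_le with (2 := B). intros n. unfold conv.
    rewrite (Zsum_ext _ (fun k => p k * q (n - k)%Z * 1)) by (intros; ring).
    apply Zsum_abs, A.
Qed.

Lemma conv_fourier p q t : Zsummable p -> Zsummable q ->
  fourier (conv p q) t = (fourier p t * fourier q t)%C.
Proof.
  intros Hp Hq.
  assert (E : forall b, (forall n, Rabs (b n) <= 1) ->
    Zsum (fun n => conv p q n * b n) = Zsum (fun k => p k * Zsum (fun m => q m * b (m + k)%Z))).
  { intros b Hb. destruct (conv_Fubini p q b Hp Hq Hb) as (_ & _ & <-).
    apply Zsum_ext. intros n. unfold conv. rewrite Rmult_comm, <- Zsum_scal.
    apply Zsum_ext; intros; ring. }
  rewrite !fourier_pair. unfold Cmult; simpl. f_equal.
  - rewrite (E (fun n => cos (IZR n * t))) by (intros; apply Rabs_le, COS_bound).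
    set (A := Zsum (fun k => q k * cos (IZR k * t))). set (B := Zsum (fun k => q k * sin (IZR k * t))).
    rewrite (Zsum_ext _ (fun k => A * (p k * cos (IZR k * t)) - B * (p k * sin (IZR k * t)))).
    { rewrite Zsum_minus, !Zsum_scal by auto using Zsummable_scal, Zsummable_cos, Zsummable_sin. ring. }
    intros k. unfold A, B.
    rewrite (Zsum_ext (fun m => q m * cos (IZR (m + k) * t))
      (fun m => cos (IZR k * t) * (q m * cos (IZR m * t)) - sin (IZR k * t) * (q m * sin (IZR m * t)))).
    { rewrite Zsum_minus, !Zsum_scal by auto using Zsummable_scal, Zsummable_cos, Zsummable_sin. ring. }
    intros m. rewrite plus_IZR, Rmult_plus_distr_r, cos_plus. ring.
  - rewrite (E (fun n => sin (IZR n * t))) by (intros; apply Rabs_le, SIN_bound).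
    set (A := Zsum (fun k => q k * cos (IZR k * t))). set (B := Zsum (fun k => q k * sin (IZR k * t))).
    rewrite (Zsum_ext _ (fun k => B * (p k * cos (IZR k * t)) + A * (p k * sin (IZR k * t)))).
    { rewrite Zsum_plus, !Zsum_scal by auto using Zsummable_scal, Zsummable_cos, Zsummable_sin. ring. }
    intros k. unfold A, B.
    rewrite (Zsum_ext (fun m => q m * sin (IZR (m + k) * t))
      (fun m => cos (IZR k * t) * (q m * sin (IZR m * t)) + sin (IZR k * t) * (q m * cos (IZR m * t)))).
    { rewrite Zsum_plus, !Zsum_scal by auto using Zsummable_scal, Zsummable_cos, Zsummable_sin. ring. }
    intros m. rewrite plus_IZR, Rmult_plus_distr_r, sin_plus. ring.
Qed.

(** Multiplication by the index is a derivation for convolution, as [n = k + (n - k)].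
    On the Fourier side this is the product rule, obtained without differentiating. *)
Lemma moment_conv p q n : Zsummable p -> Zsummable q ->
  Zsummable (moment p) -> Zsummable (moment q) ->
  moment (conv p q) n = conv (moment p) q n + conv p (moment q) n.
Proof.
  intros Hp Hq Mp Mq. unfold conv, moment at 1.
  rewrite <- Zsum_scal, <- Zsum_plus by now apply conv_summable_terms.
  apply Zsum_ext. intros k. unfold moment. rewrite minus_IZR. ring.
Qed.

Lemma conv_pow_summable p n : Zsummable p -> Zsummable (conv_pow p n).
Proof.
  intros Hp. induction n; simpl; [|now apply conv_summable].
  apply Zsummable_bound with 1. intros M.
  assert (E : zpart (fun k => Rabs (delta0 k)) M = 1).
  { induction M.
    - rewrite zpart_O. unfold delta0; simpl. rewrite Rabs_R1, Rabs_R0. ring.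
    - rewrite zpart_S, IHM. unfold delta0.
      destruct Z.eq_dec; [lia|]. destruct Z.eq_dec; [lia|]. rewrite Rabs_R0. ring. }
  lra.
Qed.

Lemma conv_pow_fourier p n t : Zsummable p ->
  fourier (conv_pow p n) t = (fourier p t ^ n)%C.
Proof.
  intros Hp. induction n; simpl; [apply fourier_delta0|].
  rewrite conv_fourier, IHn by auto using conv_pow_summable. reflexivity.
Qed.

Lemma moment_delta0 k : moment delta0 k = 0.
Proof. unfold moment, delta0. destruct Z.eq_dec; subst; ring. Qed.

Lemma conv_pow_moment_summable p n : Zsummable p -> Zsummable (moment p) ->
  Zsummable (moment (conv_pow p n)).
Proof.
  intros Hp Mp. induction n; simpl.
  - apply Zsummable_ext with (2 := Zsummable_0). intros; now rewrite moment_delta0.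
  - apply Zsummable_ext with (fun k => conv (moment p) (conv_pow p n) k + conv p (moment (conv_pow p n)) k).
    + intros; symmetry; apply moment_conv; auto using conv_pow_summable.
    + apply Zsummable_plus; auto using conv_summable, conv_pow_summable.
Qed.

Lemma conv_pow_moment_fourier p n t : Zsummable p -> Zsummable (moment p) ->
  fourier (moment (conv_pow p (S n))) t =
  (RtoC (INR (S n)) * fourier p t ^ n * fourier (moment p) t)%C.
Proof.
  intros Hp Mp.
  assert (Step : forall m, fourier (moment (conv_pow p (S m))) t =
    (fourier (moment p) t * fourier p t ^ m + fourier p t * fourier (moment (conv_pow p m)) t)%C).
  { intros m. simpl conv_pow.
    rewrite (fourier_ext _ (fun k => conv (moment p) (conv_pow p m) k + conv p (moment (conv_pow p m)) k)).
    - rewrite fourier_plus, !conv_fourier, conv_pow_fourier;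
        auto using conv_summable, conv_pow_summable, conv_pow_moment_summable.
    - intros; apply moment_conv; auto using conv_pow_summable, conv_pow_moment_summable. }
  induction n.
  - rewrite Step. simpl conv_pow.
    rewrite (fourier_ext (moment delta0) (fun k => 0 * 0)) by (intros; rewrite moment_delta0; ring).
    rewrite (fourier_scal 0). simpl. ring.
  - rewrite Step, IHn, (S_INR (S n)), RtoC_plus. simpl Cpow. ring.
Qed.

(** * The gauge sum of a measure *)

(** The [psi] of hypothesis (H). With [N ~ 1/|t|] it collects the two quantities that
    the theorem compares, [t^2] times the sum of [k^2 p(k)] up to [N] and [|t|] times that
    of [|k| p(k)] beyond. *)
Definition gauge_sum (p : Z -> R) (t : R) : R := Zsum (fun k => p k * gauge (IZR k * t)).

Definition gauge_sum' (p : Z -> R) (t : R) : R := Zsum (fun k => moment p k * gauge' (IZR k * t)).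

Lemma gauge_sum_summable p t : Zsummable (moment p) ->
  Zsummable (fun k => p k * gauge (IZR k * t)).
Proof.
  intros Mp. apply Zsummable_le with (fun k => Rabs t * Rabs (moment p k)).
  - intros k. rewrite Rabs_mult, (Rabs_pos_eq (gauge _)) by apply gauge_nonneg.
    unfold moment. rewrite Rabs_mult.
    apply Rle_trans with (Rabs (p k) * Rabs (IZR k * t)).
    + apply Rmult_le_compat_l; [apply Rabs_pos | apply gauge_le_abs].
    + rewrite Rabs_mult. right; ring.
  - now apply Zsummable_scal, Zsummable_abs.
Qed.

Lemma gauge_sum_even p t : gauge_sum p (- t) = gauge_sum p t.
Proof.
  apply Zsum_ext. intros k. now rewrite <- Ropp_mult_distr_r, gauge_even.
Qed.

Lemma gauge_sum_0 p : gauge_sum p 0 = 0.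
Proof.
  transitivity (Zsum (fun _ => 0)); [|apply Zsum_0].
  apply Zsum_ext. intros k.
  rewrite Rmult_0_r, gauge_0. ring.
Qed.

Lemma gauge_sum_nonneg p t : (forall k, 0 <= p k) -> Zsummable (moment p) -> 0 <= gauge_sum p t.
Proof.
  intros H Mp. apply Zsum_nonneg; [|now apply gauge_sum_summable].
  intros k. apply Rmult_le_pos; [apply H | apply gauge_nonneg].
Qed.

(** In other words [gauge_sum p t / t] is non-decreasing in [t]. *)
Lemma gauge_sum_dilate p l t : (forall k, 0 <= p k) -> Zsummable (moment p) ->
  1 <= l -> l * gauge_sum p t <= gauge_sum p (l * t).
Proof.
  intros H Mp Hl. unfold gauge_sum. rewrite <- Zsum_scal.
  apply Zsum_le; auto using Zsummable_scal, gauge_sum_summable. intros k.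
  replace (IZR k * (l * t)) with (l * (IZR k * t)) by ring.
  generalize (gauge_dilate_ge l (IZR k * t) Hl) (H k). intros. nra.
Qed.

Lemma gauge_sum_incr p s t : (forall k, 0 <= p k) -> Zsummable (moment p) ->
  Rabs s <= Rabs t -> gauge_sum p s <= gauge_sum p t.
Proof.
  intros H Mp Hs. apply Zsum_le; auto using gauge_sum_summable. intros k.
  apply Rmult_le_compat_l; [apply H | apply gauge_incr]. rewrite !Rabs_mult.
  apply Rmult_le_compat_l; [apply Rabs_pos | assumption].
Qed.

Lemma gauge_sum_derive p t : Zsummable (moment p) ->
  is_derive (gauge_sum p) t (gauge_sum' p t).
Proof.
  intros Mp. apply (Zsum_derive (fun k t => p k * gauge (IZR k * t))
    (fun k t => moment p k * gauge' (IZR k * t)) (fun k => Rabs (moment p k))).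
  - now apply Zsummable_abs.
  - intros k y. unfold moment.
    replace (IZR k * p k * gauge' (IZR k * y)) with (p k * (scal (IZR k) (gauge' (IZR k * y))))
      by (unfold scal; simpl; unfold mult; simpl; ring).
    apply is_derive_scal.
    apply (is_derive_comp (V := R_NormedModule) gauge (fun y => IZR k * y) y); [apply gauge_derive|].
    auto_derive; [exact I | ring].
  - intros k y. rewrite Rabs_mult, <- (Rmult_1_r (Rabs (moment p k))) at 1.
    rewrite Rmult_1_r. rewrite <- (Rmult_1_r (Rabs (moment p k))) at 2.
    apply Rmult_le_compat_l; [apply Rabs_pos | apply gauge'_bound].
  - intros y. now apply gauge_sum_summable.
Qed.

Lemma gauge_sum_continuous p t : Zsummable (moment p) -> continuous (gauge_sum p) t.
Proof.
  intros Mp. apply (ex_derive_continuous (V := R_NormedModule)).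
  eexists. now apply gauge_sum_derive.
Qed.

Lemma gauge_sum'_summable p t : Zsummable (moment p) ->
  Zsummable (fun k => moment p k * gauge' (IZR k * t)).
Proof. intros Mp. apply Zsummable_mult with 1; [exact Mp | intros; apply gauge'_bound]. Qed.

Lemma gauge_sum'_continuous p t : Zsummable (moment p) -> continuous (gauge_sum' p) t.
Proof.
  intros Mp. apply (Zsum_continuous (fun k t => moment p k * gauge' (IZR k * t)) (fun k => Rabs (moment p k))).
  - now apply Zsummable_abs.
  - intros k. apply (continuous_scal_r (V := R_NormedModule) (moment p k)).
    apply (continuous_comp (fun y => IZR k * y) gauge'); [|apply gauge'_continuous].
    apply (ex_derive_continuous (V := R_NormedModule)). auto_derive. exact I.
  - intros k y. rewrite Rabs_mult. rewrite <- (Rmult_1_r (Rabs (moment p k))) at 2.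
    apply Rmult_le_compat_l; [apply Rabs_pos | apply gauge'_bound].
Qed.

Lemma gauge_sum_le_mul_gauge_sum' p t : (forall k, 0 <= p k) -> Zsummable (moment p) ->
  gauge_sum p t <= t * gauge_sum' p t.
Proof.
  intros H Mp. unfold gauge_sum, gauge_sum'. rewrite <- Zsum_scal.
  apply Zsum_le; auto using Zsummable_scal, gauge_sum_summable, gauge_sum'_summable.
  intros k. unfold moment.
  replace (t * (IZR k * p k * gauge' (IZR k * t))) with (p k * ((IZR k * t) * gauge' (IZR k * t))) by ring.
  apply Rmult_le_compat_l; [apply H | apply gauge_le_mul_gauge'].
Qed.

Lemma IZR_abs_ge_1 n : n <> 0%Z -> 1 <= Rabs (IZR n).
Proof. intros H. rewrite <- abs_IZR. apply (IZR_le 1). lia. Qed.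

(** An atom off the origin is enough for a quadratic lower bound on [[-PI, PI]], where
    [|t| <= 4]. *)
Lemma gauge_sum_ge_sq p n t : (forall k, 0 <= p k) -> Zsummable (moment p) ->
  n <> 0%Z -> Rabs t <= 4 -> p n / 6 * t ^ 2 <= gauge_sum p t.
Proof.
  intros H Mp Hn Ht.
  apply Rle_trans with (p n * gauge (IZR n * t)).
  - assert (gauge t <= gauge (IZR n * t)).
    { apply gauge_incr. rewrite Rabs_mult. generalize (IZR_abs_ge_1 n Hn) (Rabs_pos t). nra. }
    generalize (gauge_ge_sq t Ht) (H n). nra.
  - apply (Zsum_term (fun k => p k * gauge (IZR k * t))); [|now apply gauge_sum_summable].
    intros; apply Rmult_le_pos; [apply H | apply gauge_nonneg].
Qed.

(** * Centred probability measures *)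

Lemma centered_moment p : centered p -> Zsummable (moment p) /\ Zsum (moment p) = 0.
Proof.
  intros [A B]. split; [|exact B].
  apply Zsummable_le with (2 := Zsummable_abs _ A). intros k. unfold moment.
  rewrite !Rabs_mult, Rabs_Rabsolu. apply Rle_refl.
Qed.

Lemma Re_one_minus_fourier p t : Zsummable p -> Zsum p = 1 ->
  Re (1 - fourier p t)%C = Zsum (fun k => p k * (1 - cos (IZR k * t))).
Proof.
  intros Hp H1.
  rewrite (Zsum_ext _ (fun k => p k - p k * cos (IZR k * t))) by (intros; ring).
  rewrite Zsum_minus, H1, <- Re_fourier by auto using Zsummable_cos. reflexivity.
Qed.

Lemma Zsummable_one_minus_cos p t : Zsummable p -> Zsummable (fun k => p k * (1 - cos (IZR k * t))).
Proof.
  intros Hp. apply Zsummable_mult with 2; [exact Hp|].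
  intros. apply Rabs_le. generalize (COS_bound (IZR k * t)). lra.
Qed.

Lemma one_minus_fourier_le p t : is_probability p -> centered p ->
  Cmod (1 - fourier p t) <= 6 * gauge_sum p t.
Proof.
  intros (H0 & Hp & H1) Hc. destruct (centered_moment p Hc) as [Mp M0].
  rewrite (surjective_pairing (1 - fourier p t)%C).
  eapply Rle_trans; [apply Cmod_pair_le|].
  change (fst (1 - fourier p t)%C) with (Re (1 - fourier p t)%C).
  rewrite Re_one_minus_fourier by assumption.
  replace (snd (1 - fourier p t)%C) with (- Im (fourier p t)) by (simpl; unfold Im; ring).
  assert (A : Rabs (Zsum (fun k => p k * (1 - cos (IZR k * t)))) <= 2 * gauge_sum p t).
  { rewrite Rabs_pos_eq.
    - unfold gauge_sum. rewrite <- Zsum_scal.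
      apply Zsum_le; auto using Zsummable_scal, gauge_sum_summable, Zsummable_one_minus_cos.
      intros k. generalize (one_minus_cos_le_gauge (IZR k * t)) (H0 k). nra.
    - apply Zsum_nonneg; [|now apply Zsummable_one_minus_cos]. intros k.
      apply Rmult_le_pos; [apply H0|]. generalize (COS_bound (IZR k * t)). lra. }
  assert (E : - Im (fourier p t) = Zsum (fun k => p k * (IZR k * t - sin (IZR k * t)))).
  { rewrite (Zsum_ext _ (fun k => t * moment p k - p k * sin (IZR k * t)))
      by (intros; unfold moment; ring).
    rewrite Zsum_minus, Zsum_scal, M0, <- Im_fourier by auto using Zsummable_scal, Zsummable_sin. ring. }
  assert (S : Zsummable (fun k => p k * (IZR k * t - sin (IZR k * t)))).
  { apply Zsummable_ext with (fun k => t * moment p k - p k * sin (IZR k * t));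
      [intros; unfold moment; ring|].
    auto using Zsummable_minus, Zsummable_scal, Zsummable_sin. }
  assert (B : Rabs (- Im (fourier p t)) <= 4 * gauge_sum p t).
  { rewrite E. eapply Rle_trans; [now apply Zsum_abs|].
    unfold gauge_sum. rewrite <- Zsum_scal.
    apply Zsum_le; auto using Zsummable_scal, gauge_sum_summable, Zsummable_abs.
    intros k. rewrite Rabs_mult, (Rabs_pos_eq (p k)) by apply H0.
    generalize (sin_linear_le_gauge (IZR k * t)) (H0 k). nra. }
  lra.
Qed.

Lemma moment_fourier_le p t : is_probability p -> centered p ->
  Rabs t * Cmod (fourier (moment p) t) <= 4 * gauge_sum p t.
Proof.
  intros (H0 & Hp & H1) Hc. destruct (centered_moment p Hc) as [Mp M0].
  destruct (Req_dec t 0) as [-> | Ht].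
  { rewrite Rabs_R0, gauge_sum_0. lra. }
  assert (Pt : 0 < Rabs t) by now apply Rabs_pos_lt.
  assert (Q : Cmod (fourier (moment p) t) <= Zsum (fun k => 4 / Rabs t * (p k * gauge (IZR k * t)))).
  { apply fourier_chord_bound; auto using Zsummable_scal, gauge_sum_summable.
    intros k. apply Rmult_le_reg_l with (Rabs t); [assumption|].
    replace (Rabs t * (4 / Rabs t * (p k * gauge (IZR k * t)))) with (p k * (4 * gauge (IZR k * t)))
      by (field; lra).
    unfold moment. rewrite Rabs_mult, (Rabs_pos_eq (p k)) by apply H0.
    replace (Rabs t * (Rabs (IZR k) * p k * chord (IZR k * t))) with
      (p k * (Rabs (IZR k * t) * chord (IZR k * t))) by (rewrite Rabs_mult; ring).
    apply Rmult_le_compat_l; [apply H0 | apply chord_le_gauge]. }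
  rewrite Zsum_scal in Q. fold (gauge_sum p t) in Q.
  apply Rmult_le_compat_l with (r := Rabs t) in Q; [|lra].
  replace (Rabs t * (4 / Rabs t * gauge_sum p t)) with (4 * gauge_sum p t) in Q by (field; lra).
  exact Q.
Qed.

Lemma fourier_le_1 p t : is_probability p -> Cmod (fourier p t) <= 1.
Proof.
  intros (H0 & Hp & H1). eapply Rle_trans; [now apply fourier_bound|].
  rewrite (Zsum_ext _ p); [lra|]. intros; now apply Rabs_pos_eq.
Qed.

(** If [|p^(t)| = 1] then [e^{ikt}] takes one and the same value on the whole
    support, so that two adjacent atoms force [e^{it} = 1]. *)
Lemma adjacent_atoms_strictly_aperiodic p j : is_probability p ->
  0 < p j -> 0 < p (j + 1)%Z -> strictly_aperiodic p.
Proof.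
  intros Hprob Pj Pj1 t Ht. pose proof (fourier_le_1 p t Hprob) as L1.
  destruct Hprob as (H0 & Hp & H1).
  destruct (Rle_lt_or_eq_dec _ _ L1) as [L | E]; [exact L | exfalso].
  set (x := Re (fourier p t)). set (y := Im (fourier p t)).
  assert (N : x ^ 2 + y ^ 2 = 1).
  { unfold x, y. rewrite <- Cmod2_alt, E. ring. }
  set (d := fun k => p k * (1 - (x * cos (IZR k * t) + y * sin (IZR k * t)))).
  assert (Dsq : forall k, 2 * d k = p k * ((x - cos (IZR k * t)) ^ 2 + (y - sin (IZR k * t)) ^ 2)).
  { intros k. unfold d. generalize (sin2_cos2 (IZR k * t)). unfold Rsqr. intros.
    replace ((x - cos (IZR k * t)) ^ 2 + (y - sin (IZR k * t)) ^ 2) with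
     ((x ^ 2 + y ^ 2) + (sin (IZR k * t) * sin (IZR k * t) + cos (IZR k * t) * cos (IZR k * t))
       - 2 * (x * cos (IZR k * t) + y * sin (IZR k * t))) by ring.
    rewrite H, N. ring. }
  assert (D0 : forall k, 0 <= d k).
  { intros k. assert (0 <= 2 * d k); [|lra]. rewrite Dsq. apply Rmult_le_pos; [apply H0|].
    generalize (pow2_ge_0 (x - cos (IZR k * t))) (pow2_ge_0 (y - sin (IZR k * t))). lra. }
  assert (Sd : Zsummable (fun k => p k - (x * (p k * cos (IZR k * t)) + y * (p k * sin (IZR k * t))))).
  { auto 6 using Zsummable_minus, Zsummable_plus, Zsummable_scal, Zsummable_cos, Zsummable_sin. }
  assert (Z0 : Zsum d = 0).
  { unfold d. rewrite (Zsum_ext _ (fun k => p k - (x * (p k * cos (IZR k * t)) + y * (p k * sin (IZR k * t)))))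
      by (intros; ring).
    rewrite Zsum_minus, Zsum_plus, !Zsum_scal, <- Re_fourier, <- Im_fourier, H1
      by auto using Zsummable_plus, Zsummable_scal, Zsummable_cos, Zsummable_sin.
    fold x y. lra. }
  assert (V : forall k, 0 < p k -> cos (IZR k * t) = x /\ sin (IZR k * t) = y).
  { intros k Pk. assert (dk : d k = 0).
    { apply Rle_antisym; [|apply D0]. rewrite <- Z0. apply Zsum_term; [exact D0|].
      eapply Zsummable_ext; [|exact Sd]. intros; unfold d; ring. }
    pose proof (Dsq k) as Q. rewrite dk, Rmult_0_r in Q.
    generalize (pow2_ge_0 (x - cos (IZR k * t))) (pow2_ge_0 (y - sin (IZR k * t))). intros.
    assert ((x - cos (IZR k * t)) ^ 2 + (y - sin (IZR k * t)) ^ 2 = 0) by nra.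
    split; nra. }
  destruct (V j Pj) as [C1 S1]. destruct (V (j + 1)%Z Pj1) as [C2 S2].
  assert (C : cos t = 1).
  { replace t with (IZR (j + 1) * t - IZR j * t) by (rewrite plus_IZR; ring).
    rewrite cos_minus, C1, C2, S1, S2. nra. }
  assert (S : sin (t / 2) = 0) by (generalize (one_minus_cos t); nra).
  assert (0 < sin (t / 2)) by (apply sin_gt_0; lra). lra.
Qed.

Lemma strictly_aperiodic_atom p : is_probability p -> strictly_aperiodic p ->
  exists n, n <> 0%Z /\ 0 < p n.
Proof.
  intros (H0 & Hp & H1) Ha. apply NNPP. intros N.
  assert (Z : forall n, n <> 0%Z -> p n = 0).
  { intros n Hn. apply NNPP. intros P. apply N. exists n. split; [exact Hn|].
    generalize (H0 n). lra. }
  specialize (Ha PI ltac:(generalize PI_RGT_0; lra)).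
  replace (fourier p PI) with (RtoC 1) in Ha; [rewrite Cmod_R, Rabs_R1 in Ha; lra|].
  rewrite <- H1, <- fourier_0, !fourier_pair.
  f_equal; apply Zsum_ext; intros k; destruct (Z.eq_dec k 0) as [-> | Hk];
    rewrite ?Rmult_0_l, ?Rmult_0_r, ?(Z k) by assumption; ring.
Qed.

(** Near the origin the quadratic term in
    [|p^|^2 = 1 - 2 Re (1 - p^) + |1 - p^|^2] is absorbed by the linear one;
    away from it strict aperiodicity and compactness leave a gap. *)
Lemma modulus_gap p K d : is_probability p -> centered p -> strictly_aperiodic p ->
  0 < d -> 0 < K ->
  (forall t, 0 < t <= d -> gauge_sum p t <= K * Re (1 - fourier p t)%C) ->
  exists c, 0 < c /\ forall t, Rabs t <= PI -> Cmod (fourier p t) <= 1 - c * gauge_sum p t.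
Proof.
  intros Hprob Hc Ha Hd HK H. pose proof Hprob as (H0 & Hp & H1).
  destruct (centered_moment p Hc) as [Mp M0].
  (* the constant [36] is the square of the one in [|1 - p^| <= 6 psi] *)
  assert (near : exists e, 0 < e <= d /\ forall t, 0 < t <= e -> 36 * K * gauge_sum p t <= 1).
  { pose proof (gauge_sum_continuous p 0 Mp) as L.
    apply (proj1 (filterlim_locally _ _)) with (eps := mkposreal (/ (36 * K)) ltac:(apply Rinv_0_lt_compat; lra)) in L.
    destruct L as [e L]. exists (Rmin d (e / 2)). split.
    - generalize (Rmin_l d (e / 2)) (cond_pos e). intros. split; [apply Rmin_case; lra | lra].
    - intros t Ht. generalize (Rmin_r d (e / 2)) (cond_pos e). intros.
      assert (B : ball 0 e t).
      { unfold ball; simpl; unfold AbsRing_ball, abs, minus, plus, opp; simpl.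
        rewrite Ropp_0, Rplus_0_r, Rabs_pos_eq; lra. }
      specialize (L t B). unfold ball in L; simpl in L; unfold AbsRing_ball, abs, minus, plus, opp in L; simpl in L.
      rewrite gauge_sum_0, Ropp_0, Rplus_0_r in L.
      apply Rabs_def2 in L. destruct L as [L _].
      apply Rmult_lt_compat_l with (r := 36 * K) in L; [|lra].
      rewrite Rinv_r in L; lra. }
  destruct near as (e & [He Hed] & near).
  assert (N1 : forall t, 0 < t <= e -> Cmod (fourier p t) <= 1 - / (2 * K) * gauge_sum p t).
  { intros t Ht. set (u := (1 - fourier p t)%C).
    pose proof (H t ltac:(lra)) as A. pose proof (near t Ht) as B.
    pose proof (one_minus_fourier_le p t Hprob Hc) as C. fold u in A, C.
    pose proof (gauge_sum_nonneg p t H0 Mp) as G. pose proof (Cmod_ge_0 u) as U0.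
    assert (E : Cmod (fourier p t) ^ 2 = 1 - 2 * Re u + Cmod u ^ 2).
    { rewrite !Cmod2_alt. unfold u; simpl. unfold Re, Im. ring. }
    assert (U2 : Cmod u ^ 2 <= 36 * gauge_sum p t * gauge_sum p t) by nra.
    assert (gauge_sum p t = (/ K * K) * gauge_sum p t) by (rewrite Rinv_l; lra).
    assert (iK : 0 < / K) by now apply Rinv_0_lt_compat.
    assert (U3 : Cmod u ^ 2 <= Re u).
    { apply Rle_trans with (1 := U2). apply Rmult_le_reg_l with K; [assumption|]. nra. }
    rewrite Rinv_mult.
    assert (/ K * gauge_sum p t <= Re u).
    { apply Rmult_le_reg_l with K; [assumption|].
      rewrite <- Rmult_assoc, Rinv_r, Rmult_1_l; lra. }
    pose proof (Cmod_ge_0 (fourier p t)). nra. }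
  destruct (Rle_lt_dec PI e) as [Big | Small].
  - exists (/ (2 * K)). split; [apply Rinv_0_lt_compat; lra|]. intros t Ht.
    destruct (Rtotal_order t 0) as [L | [-> | L]].
    + rewrite <- (Ropp_involutive t), fourier_opp, Cmod_conj, gauge_sum_even.
      apply N1. rewrite Rabs_left in Ht; lra.
    + rewrite gauge_sum_0, Rmult_0_r, Rminus_0_r. now apply fourier_le_1.
    + apply N1. rewrite Rabs_pos_eq in Ht; lra.
  - set (f := fun t => Re (fourier p t) ^ 2 + Im (fourier p t) ^ 2).
    destruct (continuity_ab_maj f e PI) as (m & Hm & Im_).
    { lra. }
    { intros t _. apply continuity_pt_filterlim.
      destruct (fourier_continuous_parts p t Hp) as [A B].
      assert (sq : forall g : R -> R, continuous g t -> continuous (fun s => g s ^ 2) t).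
      { intros g Hg. apply continuous_ext with (fun s => mult (g s) (g s)); [intros; unfold mult; simpl; ring|].
        now apply (continuous_mult (K := R_AbsRing)). }
      apply (continuous_plus (V := R_NormedModule) (fun s => Re (fourier p s) ^ 2) (fun s => Im (fourier p s) ^ 2));
        now apply sq. }
    assert (m1 : f m < 1).
    { unfold f. rewrite <- Cmod2_alt. generalize (Ha m ltac:(lra)) (Cmod_ge_0 (fourier p m)). nra. }
    set (G := gauge_sum p PI). assert (G0 : 0 <= G) by now apply gauge_sum_nonneg.
    set (c1 := (1 - f m) / (2 * (G + 1))).
    assert (c1p : 0 < c1) by (apply Rdiv_lt_0_compat; lra).
    assert (ip : 0 < / (2 * K)) by (apply Rinv_0_lt_compat; lra).
    assert (N2 : forall t, 0 < t <= PI ->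
      Cmod (fourier p t) <= 1 - Rmin c1 (/ (2 * K)) * gauge_sum p t).
    { intros t Ht. pose proof (gauge_sum_nonneg p t H0 Mp) as Gt.
      destruct (Rle_lt_dec t e) as [Le | Lt].
      - eapply Rle_trans; [apply N1; lra|]. generalize (Rmin_r c1 (/ (2 * K))). nra.
      - pose proof (Hm t ltac:(lra)) as A. unfold f at 1 in A. rewrite <- Cmod2_alt in A.
        assert (gauge_sum p t <= G).
        { apply gauge_sum_incr; auto. rewrite !Rabs_pos_eq; lra. }
        assert (c1 * gauge_sum p t <= (1 - f m) / 2).
        { replace ((1 - f m) / 2) with (c1 * (G + 1)) by (unfold c1; field; lra). nra. }
        assert (Rmin c1 (/ (2 * K)) * gauge_sum p t <= c1 * gauge_sum p t)
          by (apply Rmult_le_compat_r; [exact Gt | apply Rmin_l]).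
        assert (0 <= (1 - Cmod (fourier p t)) ^ 2) by apply pow2_ge_0. nra. }
    exists (Rmin c1 (/ (2 * K))). split; [now apply Rmin_case|]. intros t Ht.
    destruct (Rtotal_order t 0) as [L | [-> | L]].
    + rewrite <- (Ropp_involutive t), fourier_opp, Cmod_conj, gauge_sum_even.
      apply N2. rewrite Rabs_left in Ht; lra.
    + rewrite gauge_sum_0, Rmult_0_r, Rminus_0_r. now apply fourier_le_1.
    + apply N2. rewrite Rabs_pos_eq in Ht; lra.
Qed.

(** * The tail condition and bounded angular ratio *)

Definition tail_moment (p : Z -> R) (n : nat) : R :=
  Series (fun j => INR (n + j) * p (Z.of_nat (n + j))).

Definition head_moment (p : Z -> R) (n : nat) : R :=
  sum_n_m (fun k => INR k ^ 2 * p (Z.of_nat k)) 1 n.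

Definition skip_free_decreasing (p : Z -> R) : Prop :=
  is_probability p /\ centered p /\ (forall n, (n < -1)%Z -> p n = 0) /\
  forall n : nat, p (Z.of_nat (S n)) <= p (Z.of_nat n).

Lemma ex_series_shift (a : nat -> R) n : ex_series a -> ex_series (fun j => a (n + j)%nat).
Proof. apply (ex_series_incr_n a n). Qed.

Lemma ex_series_scal_R c (a : nat -> R) : ex_series a -> ex_series (fun n => c * a n).
Proof. exact (ex_series_scal_l (K := R_AbsRing) (V := R_NormedModule) c a). Qed.

Lemma Series_nonneg (a : nat -> R) : (forall n, 0 <= a n) -> ex_series a -> 0 <= Series a.
Proof.
  intros H Ha. rewrite <- (Rmult_0_l (Series a)), <- Series_scal_l.
  apply Series_le; [|exact Ha]. intros n. split; [lra | rewrite Rmult_0_l; apply H].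
Qed.

Lemma sum_n_first (a : nat -> R) n : sum_n a n = a 0%nat + sum_n_m a 1 n.
Proof. unfold sum_n. now rewrite sum_Sn_m by lia. Qed.

Lemma Zsummable_nat f : Zsummable f -> ex_series (fun n => f (Z.of_nat n)).
Proof. intros [H _]. now apply ex_series_Rabs. Qed.

Lemma Series_split (a : nat -> R) n : ex_series a ->
  Series a = a 0%nat + sum_n_m a 1 n + Series (fun j => a (S n + j)%nat).
Proof.
  intros Ha. rewrite (Series_incr_n a (S n)) by (auto; lia).
  rewrite <- sum_n_first, sum_n_Reals. reflexivity.
Qed.

Lemma Zsum_head_tail f n : Zsummable f -> (forall k, (k < -1)%Z -> f k = 0) ->
  (forall k, 0 <= f k) ->
  Zsum f <= f (-1)%Z + f 0%Z + sum_n_m (fun k => f (Z.of_nat k)) 1 n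
            + Series (fun j => f (Z.of_nat (n + j))).
Proof.
  intros Hf Hs H0. unfold Zsum. rewrite (Series_split _ n) by now apply Zsummable_nat.
  assert (E : Series (fun n => f (- Z.of_nat (S n))%Z) = f (-1)%Z).
  { rewrite Series_incr_1 by (destruct Hf as [_ H]; now apply ex_series_Rabs).
    rewrite (Series_ext _ (fun _ => 0 * 0)), Series_scal_l.
    - simpl. ring.
    - intros k. rewrite Hs by lia. ring. }
  rewrite E.
  assert (S : Series (fun j => f (Z.of_nat (S n + j))) <= Series (fun j => f (Z.of_nat (n + j)))).
  { rewrite (Series_incr_1 (fun j => f (Z.of_nat (n + j)))).
    - rewrite (Series_ext (fun j => f (Z.of_nat (S n + j))) (fun k => f (Z.of_nat (n + S k)))).
      + generalize (H0 (Z.of_nat (n + 0))). lra.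
      + intros k. do 2 f_equal. lia.
    - apply (ex_series_shift (fun k => f (Z.of_nat k))). now apply Zsummable_nat. }
  change (Z.of_nat 0) with 0%Z. lra.
Qed.

Lemma Zsum_ge_nat f : Zsummable f -> (forall k, 0 <= f k) ->
  Series (fun n => f (Z.of_nat n)) <= Zsum f.
Proof.
  intros Hf H0. unfold Zsum.
  assert (0 <= Series (fun n => f (- Z.of_nat (S n))%Z)); [|lra].
  apply Series_nonneg; auto. destruct Hf as [_ H]. now apply ex_series_Rabs.
Qed.

Lemma sum_n_m_nonneg (a : nat -> R) n m : (forall k, 0 <= a k) -> 0 <= sum_n_m a n m.
Proof.
  intros H. induction m.
  - destruct n; [rewrite sum_n_n; apply H | rewrite sum_n_m_zero by lia; apply Rle_refl].
  - destruct (le_lt_dec n (S m)).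
    + rewrite sum_n_Sm by assumption. apply Rplus_le_le_0_compat; auto.
    + rewrite sum_n_m_zero by lia. apply Rle_refl.
Qed.

Lemma Zsum_ge_head f n : Zsummable f -> (forall k, 0 <= f k) ->
  sum_n_m (fun k => f (Z.of_nat k)) 1 n <= Zsum f.
Proof.
  intros Hf H0. eapply Rle_trans; [|now apply Zsum_ge_nat].
  rewrite (Series_split _ n) by now apply Zsummable_nat.
  generalize (H0 (Z.of_nat 0)). intros.
  assert (0 <= Series (fun j => f (Z.of_nat (S n + j)))); [|lra].
  apply Series_nonneg; auto.
  apply (ex_series_shift (fun k => f (Z.of_nat k))). now apply Zsummable_nat.
Qed.

Lemma Zsum_ge_tail f n : Zsummable f -> (forall k, 0 <= f k) ->
  Series (fun j => f (Z.of_nat (n + j))) <= Zsum f.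
Proof.
  intros Hf H0. eapply Rle_trans; [|now apply Zsum_ge_nat].
  destruct n; [apply Rle_refl|].
  rewrite (Series_incr_n (fun n => f (Z.of_nat n)) (S n)) by (lia || now apply Zsummable_nat).
  rewrite <- sum_n_Reals, sum_n_first.
  generalize (H0 (Z.of_nat 0)) (sum_n_m_nonneg (fun k => f (Z.of_nat k)) 1 n (fun k => H0 _)).
  simpl. lra.
Qed.

Lemma sum_n_m_le_loc (a b : nat -> R) n m :
  (forall k, (n <= k <= m)%nat -> a k <= b k) -> sum_n_m a n m <= sum_n_m b n m.
Proof.
  intros H. induction m.
  - destruct n; [rewrite !sum_n_n; apply H; lia | rewrite !sum_n_m_zero by lia; apply Rle_refl].
  - destruct (le_lt_dec n (S m)).
    + rewrite !sum_n_Sm by assumption. apply Rplus_le_compat; [apply IHm; intros; apply H; lia | apply H; lia].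
    + rewrite !sum_n_m_zero by lia. apply Rle_refl.
Qed.

Lemma sum_n_m_scal c (a : nat -> R) n m : sum_n_m (fun k => c * a k) n m = c * sum_n_m a n m.
Proof. exact (sum_n_m_mult_l (K := R_Ring) c a n m). Qed.

Lemma tail_moment_summable p n : Zsummable (moment p) ->
  ex_series (fun j => INR (n + j) * p (Z.of_nat (n + j))).
Proof.
  intros Mp. apply (ex_series_shift (fun k => INR k * p (Z.of_nat k)) n).
  eapply ex_series_ext; [|exact (Zsummable_nat _ Mp)].
  intros k. unfold moment. now rewrite INR_IZR_INZ.
Qed.

Lemma decreasing_le p m n : (forall n : nat, p (Z.of_nat (S n)) <= p (Z.of_nat n)) ->
  (m <= n)%nat -> p (Z.of_nat n) <= p (Z.of_nat m).
Proof.
  intros H L. induction L; [lra|]. eapply Rle_trans; [apply H | exact IHL].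
Qed.

(** Centring ties the atom at [-1] to the others, so that vanishing at [1]
    propagates to every non-zero integer. *)
Lemma skip_free_atom_1 p : skip_free_decreasing p -> p <> delta0 -> 0 < p 1%Z.
Proof.
  intros ((H0 & Hp & H1) & Hc & Hs & Hd) Hne.
  destruct (centered_moment p Hc) as [Mp M0].
  destruct (Rle_lt_or_eq_dec _ _ (H0 1%Z)) as [L | E]; [exact L | exfalso].
  apply Hne.
  assert (Z1 : forall n, (1 <= n)%nat -> p (Z.of_nat n) = 0).
  { intros n Hn. apply Rle_antisym; [|apply H0]. rewrite E. now apply (decreasing_le p 1 n). }
  assert (Zm : forall k, k <> 0%Z -> k <> (-1)%Z -> p k = 0).
  { intros k K0 K1. destruct (Z_lt_le_dec k (-1)); [now apply Hs|].
    replace k with (Z.of_nat (Z.to_nat k)) by lia. apply Z1. lia. }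
  assert (Zneg : p (-1)%Z = 0).
  { apply Rle_antisym; [|apply H0].
    assert (E0 : Zsum (fun k => (-1) * moment p k) = 0) by (rewrite Zsum_scal, M0; ring).
    rewrite <- E0. eapply Rle_trans; [|apply (Zsum_term (fun k => (-1) * moment p k) (-1)%Z)].
    - unfold moment. lra.
    - intros k. unfold moment. destruct (Z.eq_dec k 0) as [-> |]; [lra|].
      destruct (Z.eq_dec k (-1)) as [-> |]; [generalize (H0 (-1)%Z); lra|].
      rewrite Zm by assumption. lra.
    - now apply Zsummable_scal. }
  assert (Z' : forall k, k <> 0%Z -> p k = 0).
  { intros k Hk. destruct (Z.eq_dec k (-1)) as [-> |]; auto. }
  assert (E0 : p = fun k => p 0%Z * delta0 k).
  { apply functional_extensionality. intros k. unfold delta0.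
    destruct Z.eq_dec as [-> |]; [ring | rewrite Z' by assumption; ring]. }
  assert (D : RtoC 1 = RtoC (p 0%Z)).
  { rewrite <- H1, <- fourier_0. rewrite E0 at 1.
    rewrite fourier_scal, fourier_delta0. ring. }
  injection D as D. rewrite E0, <- D. apply functional_extensionality. intros; ring.
Qed.

Lemma skip_free_strictly_aperiodic p :
  skip_free_decreasing p -> p <> delta0 -> strictly_aperiodic p.
Proof.
  intros H Hne. pose proof (skip_free_atom_1 p H Hne) as P1.
  destruct H as (Hprob & _ & _ & Hd).
  apply (adjacent_atoms_strictly_aperiodic p 0 Hprob); [|exact P1].
  eapply Rlt_le_trans; [exact P1 | apply (Hd 0%nat)].
Qed.

Lemma head_moment_ge_1 p n : (forall k, 0 <= p k) -> (1 <= n)%nat -> p 1%Z <= head_moment p n.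
Proof.
  intros H Hn. unfold head_moment. induction n; [lia|]. destruct n.
  - rewrite sum_n_n. simpl. lra.
  - rewrite sum_n_Sm by lia. eapply Rle_trans; [apply IHn; lia|].
    rewrite <- (Rplus_0_r (sum_n_m _ _ _)) at 1. apply Rplus_le_compat_l.
    apply Rmult_le_pos; [apply pow2_ge_0 | apply H].
Qed.

(** With [N ~ 1/t], the gauge sum is at most [t^2 S_N + t T_N] and the real part
    at least a multiple of [t^2 S_N], where [S_N] and [T_N] are the head and tail
    moments: the tail condition says exactly that the first bound is of the order of
    the second. *)
Lemma gauge_sum_le_of_tail_condition p C : skip_free_decreasing p -> 0 < p 1%Z -> 0 < C ->
  (forall n, (1 <= n)%nat -> INR n * tail_moment p n <= C * head_moment p n) ->
  exists K, 0 < K /\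
    forall t, 0 < t <= 1 -> gauge_sum p t <= K * Re (1 - fourier p t)%C.
Proof.
  intros ((H0 & Hp & H1) & Hc & Hs & Hd) P1 HC HT.
  destruct (centered_moment p Hc) as [Mp M0].
  set (B := p (-1)%Z / p 1%Z). assert (B0 : 0 <= B).
  { unfold B, Rdiv. apply Rmult_le_pos; [apply H0 | now apply Rlt_le, Rinv_0_lt_compat]. }
  exists (3 * (B + 1 + C)). split; [lra|]. intros t Ht.
  assert (exists N, (1 <= N)%nat /\ 1 <= INR N * t <= 2) as (N & HN & N1 & N2).
  { exists (Z.to_nat (up (/ t))). destruct (archimed (/ t)) as [A1 A2].
    assert (it : 1 <= / t) by (rewrite <- Rinv_1; apply Rinv_le_contravar; lra).
    assert (1 < up (/ t))%Z by (apply lt_IZR; lra).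
    rewrite INR_IZR_INZ, Z2Nat.id by lia.
    split; [lia|]. assert (/ t * t = 1) by (apply Rinv_l; lra). split; nra. }
  set (S := head_moment p N). set (T := tail_moment p N).
  assert (S1 : p 1%Z <= S) by now apply head_moment_ge_1.
  assert (B1 : p (-1)%Z <= B * S).
  { replace (p (-1)%Z) with (B * p 1%Z) by (unfold B; field; lra). now apply Rmult_le_compat_l. }
  assert (T1 : T <= C * t * S).
  { pose proof (HT N HN) as A. fold T S in A.
    apply Rmult_le_reg_l with (INR N); [apply lt_0_INR; lia|].
    eapply Rle_trans; [exact A|]. assert (0 <= C * S) by nra. nra. }
  assert (Up : gauge_sum p t <= p (-1)%Z * t ^ 2 + t ^ 2 * S + t * T).
  { eapply Rle_trans; [apply Zsum_head_tail with (n := N)|].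
    - now apply gauge_sum_summable.
    - intros k Hk. rewrite Hs by assumption. ring.
    - intros k. apply Rmult_le_pos; [apply H0 | apply gauge_nonneg].
    - cbv beta. rewrite Rmult_0_l, gauge_0, Rmult_0_r, Rplus_0_r.
      apply Rplus_le_compat; [apply Rplus_le_compat|].
      + apply Rmult_le_compat_l; [apply H0|].
        generalize (gauge_le_sq (-1 * t)). nra.
      + unfold S, head_moment. rewrite <- sum_n_m_scal. apply sum_n_m_le_loc. intros k _.
        rewrite <- INR_IZR_INZ. generalize (gauge_le_sq (INR k * t)) (H0 (Z.of_nat k)).
        generalize (gauge_nonneg (INR k * t)). rewrite Rpow_mult_distr. intros. nra.
      + unfold T, tail_moment. rewrite <- Series_scal_l. apply Series_le.
        * intros j. split; [apply Rmult_le_pos; [apply H0 | apply gauge_nonneg]|].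
          rewrite <- INR_IZR_INZ. generalize (gauge_le_abs (INR (N + j) * t)) (H0 (Z.of_nat (N + j))).
          rewrite Rabs_pos_eq by (apply Rmult_le_pos; [apply pos_INR | lra]). nra.
        * apply ex_series_scal_R. now apply tail_moment_summable. }
  assert (Lo : t ^ 2 / 3 * S <= Re (1 - fourier p t)%C).
  { rewrite Re_one_minus_fourier by assumption.
    eapply Rle_trans; [|apply Zsum_ge_head with (n := N)].
    - unfold S, head_moment. rewrite <- sum_n_m_scal. apply sum_n_m_le_loc. intros k Hk.
      rewrite <- INR_IZR_INZ. replace (t ^ 2 / 3 * (INR k ^ 2 * p (Z.of_nat k))) with
        (p (Z.of_nat k) * ((INR k * t) ^ 2 / 3)) by field.
      apply Rmult_le_compat_l; [apply H0|]. apply one_minus_cos_ge.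
      rewrite Rabs_pos_eq by (apply Rmult_le_pos; [apply pos_INR | lra]).
      eapply Rle_trans; [|exact N2]. apply Rmult_le_compat_r; [lra | apply le_INR; lia].
    - now apply Zsummable_one_minus_cos.
    - intros k. apply Rmult_le_pos; [apply H0|]. generalize (COS_bound (IZR k * t)). lra. }
  apply Rle_trans with ((B + 1 + C) * (t ^ 2 * S)).
  - assert (0 <= t ^ 2) by nra.
    assert (p (-1)%Z * t ^ 2 <= B * S * t ^ 2) by now apply Rmult_le_compat_r.
    assert (t * T <= t * (C * t * S)) by (apply Rmult_le_compat_l; lra). nra.
  - assert (0 <= B + 1 + C) by lra. nra.
Qed.

Lemma abs_sin_nat_mul_le n t : Rabs (sin (INR n * t)) <= INR n * Rabs (sin t).
Proof.
  induction n.
  - simpl. rewrite !Rmult_0_l, sin_0, Rabs_R0. lra.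
  - rewrite S_INR, !Rmult_plus_distr_r, !Rmult_1_l, sin_plus.
    eapply Rle_trans; [apply Rabs_triang|]. rewrite !Rabs_mult.
    assert (C1 : Rabs (cos t) <= 1) by apply Rabs_le, COS_bound.
    assert (C2 : Rabs (cos (INR n * t)) <= 1) by apply Rabs_le, COS_bound.
    generalize (Rabs_pos (sin (INR n * t))) (Rabs_pos (sin t)) (Rabs_pos (cos t)) (Rabs_pos (cos (INR n * t))).
    nra.
Qed.

(** As [p] decreases, [p(n) n^3 / 3] is at most the head moment at [n], while each
    further term up to [L n] is at most [(L n)^2 p(n)]. *)
Lemma head_moment_dilate p L n : (forall k, 0 <= p k) ->
  (forall n : nat, p (Z.of_nat (S n)) <= p (Z.of_nat n)) -> (1 <= L)%nat -> (1 <= n)%nat ->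
  head_moment p (L * n) <= (1 + 3 * INR L ^ 3) * head_moment p n.
Proof.
  intros H0 Hd HL Hn.
  assert (A : forall m, (n <= m)%nat ->
    head_moment p m <= head_moment p n + p (Z.of_nat n) * INR m ^ 3).
  { intros m Hm. induction Hm.
    - generalize (Rmult_le_pos _ _ (H0 (Z.of_nat n)) (pow_le _ 3 (pos_INR n))). lra.
    - unfold head_moment at 1. rewrite sum_n_Sm by lia. fold (head_moment p m).
      change (head_moment p m + INR (S m) ^ 2 * p (Z.of_nat (S m)) <=
        head_moment p n + p (Z.of_nat n) * INR (S m) ^ 3).
      assert (D : p (Z.of_nat (S m)) <= p (Z.of_nat n)) by (apply decreasing_le; [exact Hd | lia]).
      assert (E : INR (S m) ^ 2 * p (Z.of_nat (S m)) <= INR (S m) ^ 2 * p (Z.of_nat n))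
        by (apply Rmult_le_compat_l; [apply pow2_ge_0 | exact D]).
      assert (F : INR m ^ 3 + INR (S m) ^ 2 <= INR (S m) ^ 3).
      { rewrite S_INR. generalize (pos_INR m). intros. nra. }
      generalize (H0 (Z.of_nat n)). nra. }
  assert (B : forall m, (1 <= m)%nat -> p (Z.of_nat m) * INR m ^ 3 <= 3 * head_moment p m).
  { intros m Hm. induction Hm.
    - unfold head_moment. rewrite sum_n_n. generalize (H0 (Z.of_nat 1)). simpl. lra.
    - unfold head_moment. rewrite sum_n_Sm by lia. fold (head_moment p m).
      change (p (Z.of_nat (S m)) * INR (S m) ^ 3 <=
        3 * (head_moment p m + INR (S m) ^ 2 * p (Z.of_nat (S m)))).
      assert (E : p (Z.of_nat (S m)) * INR m ^ 3 <= p (Z.of_nat m) * INR m ^ 3)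
        by (apply Rmult_le_compat_r; [apply pow_le, pos_INR | apply Hd]).
      assert (F : INR (S m) ^ 3 <= INR m ^ 3 + 3 * INR (S m) ^ 2).
      { rewrite S_INR. generalize (pos_INR m). intros. nra. }
      generalize (H0 (Z.of_nat (S m))). nra. }
  eapply Rle_trans; [apply A; nia|]. rewrite mult_INR, Rpow_mult_distr.
  generalize (B n Hn) (pow_le _ 3 (pos_INR L)). nra.
Qed.

Lemma tail_moment_decr p m n : (forall k, 0 <= p k) -> Zsummable (moment p) ->
  (m <= n)%nat -> tail_moment p n <= tail_moment p m.
Proof.
  intros H0 Mp L. induction L; [lra|]. eapply Rle_trans; [|exact IHL].
  unfold tail_moment. rewrite (Series_incr_1 (fun j => INR (m0 + j) * _)) by now apply tail_moment_summable.
  rewrite (Series_ext (fun j => INR (S m0 + j) * p (Z.of_nat (S m0 + j)))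
    (fun j => INR (m0 + S j) * p (Z.of_nat (m0 + S j)))).
  - generalize (Rmult_le_pos _ _ (pos_INR (m0 + 0)) (H0 (Z.of_nat (m0 + 0)))). lra.
  - intros j. now rewrite Nat.add_succ_comm.
Qed.

(** At [t = 2/n] the imaginary part dominates [T_n / n], because every term
    [k sin t - sin k t] with [k >= -1] is non-negative and those with [k >= n] are at
    least [k t / 3].  The real part is at most of order [S_{Ln} / n^2 + T_n / (L n)],
    and for [L] large the tail on the right is absorbed by the left. *)
Lemma tail_condition_of_angular_bound p K : skip_free_decreasing p -> 0 < p 1%Z -> 0 < K ->
  (forall t, 0 < t <= 1 -> Cmod (1 - fourier p t)%C <= K * Re (1 - fourier p t)%C) ->
  exists C, 0 < C /\
    forall n, (1 <= n)%nat -> INR n * tail_moment p n <= C * head_moment p n.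
Proof.
  intros ((H0 & Hp & H1) & Hc & Hs & Hd) P1 HK HB.
  destruct (centered_moment p Hc) as [Mp M0].
  (* with [L >= 6 K] the tail on the right costs at most half of the one on the left *)
  set (L := Z.to_nat (up (6 * K))).
  assert (HL : 6 * K <= INR L).
  { unfold L. destruct (archimed (6 * K)) as [A1 A2].
    assert (0 < up (6 * K))%Z by (apply lt_IZR; lra).
    rewrite INR_IZR_INZ, Z2Nat.id by lia. lra. }
  assert (HL1 : (1 <= L)%nat) by (apply INR_lt; simpl; lra).
  set (B := p (-1)%Z / p 1%Z). assert (B0 : 0 <= B).
  { unfold B, Rdiv. apply Rmult_le_pos; [apply H0 | now apply Rlt_le, Rinv_0_lt_compat]. }
  assert (T0 : forall n, 0 <= tail_moment p n).
  { intros n. apply Series_nonneg; [|now apply tail_moment_summable].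
    intros; apply Rmult_le_pos; [apply pos_INR | apply H0]. }
  set (C1 := tail_moment p 1 / p 1%Z). assert (C10 : 0 <= C1).
  { unfold C1, Rdiv. apply Rmult_le_pos; [apply T0 | now apply Rlt_le, Rinv_0_lt_compat]. }
  set (C2 := 6 * K * (B + (1 + 3 * INR L ^ 3))).
  assert (L3 : 0 <= INR L ^ 3) by apply pow_le, pos_INR.
  assert (C20 : 0 < C2) by (unfold C2; nra).
  exists (C1 + C2). split; [lra|]. intros n Hn.
  assert (S1 : p 1%Z <= head_moment p n) by now apply head_moment_ge_1.
  destruct (Nat.eq_dec n 1) as [-> | Hn1].
  { assert (E : C1 * p 1%Z = tail_moment p 1) by (unfold C1; field; lra).
    simpl INR. assert (C1 * p 1%Z <= C1 * head_moment p 1) by now apply Rmult_le_compat_l. nra. }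
  assert (n2 : 2 <= INR n) by (apply (le_INR 2); lia).
  set (t := 2 / INR n). assert (nt : INR n * t = 2) by (unfold t; field; lra).
  assert (Ht : 0 < t <= 1) by nra.
  set (T := tail_moment p n) in *. set (S := head_moment p n) in *.
  specialize (T0 n). fold T in T0.
  assert (st : 5 / 6 * t <= sin t) by (destruct (sin_cubic_bound t); [lra | nra]).
  assert (Gs : forall k, 0 <= p k * (IZR k * sin t - sin (IZR k * t))).
  { intros k. destruct (Z_lt_le_dec k (-1)).
    - rewrite Hs by assumption. lra.
    - destruct (Z.eq_dec k (-1)) as [-> | Hk].
      + replace (-1 * t) with (- t) by ring. rewrite sin_neg. right; ring.
      + apply Rmult_le_pos; [apply H0|].
        replace k with (Z.of_nat (Z.to_nat k)) by lia. rewrite <- INR_IZR_INZ.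
        generalize (abs_sin_nat_mul_le (Z.to_nat k) t) (Rle_abs (sin (INR (Z.to_nat k) * t))).
        rewrite (Rabs_pos_eq (sin t)) by lra. lra. }
  assert (Sg : Zsummable (fun k => sin t * moment p k - p k * sin (IZR k * t))).
  { auto using Zsummable_minus, Zsummable_scal, Zsummable_sin. }
  assert (Im1 : t / 3 * T <= - Im (fourier p t)).
  { apply Rle_trans with (Zsum (fun k => p k * (IZR k * sin t - sin (IZR k * t)))).
    - eapply Rle_trans; [|apply Zsum_ge_tail with (n := n); [|exact Gs]].
      + unfold T, tail_moment. rewrite <- Series_scal_l. apply Series_le.
        * intros j. rewrite <- INR_IZR_INZ. set (m := (n + j)%nat).
          assert (mt : 2 <= INR m * t).
          { rewrite <- nt. apply Rmult_le_compat_r; [lra | apply le_INR; unfold m; lia]. }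
          assert (5 / 6 * (INR m * t) <= INR m * sin t) by (generalize (pos_INR m); nra).
          generalize (SIN_bound (INR m * t)) (H0 (Z.of_nat m)). intros.
          split; [apply Rmult_le_pos; [lra|]; apply Rmult_le_pos; [apply pos_INR | assumption]|].
          replace (t / 3 * (INR m * p (Z.of_nat m))) with (p (Z.of_nat m) * ((INR m * t) / 3)) by field.
          apply Rmult_le_compat_l; [assumption | lra].
        * apply (ex_series_shift (fun m => p (Z.of_nat m) * (IZR (Z.of_nat m) * sin t - sin (IZR (Z.of_nat m) * t)))).
          eapply ex_series_ext; [|exact (Zsummable_nat _ Sg)].
          intros; unfold moment; simpl; ring.
      + eapply Zsummable_ext; [|exact Sg]. intros; unfold moment; simpl; ring.
    - right. rewrite (Zsum_ext _ (fun k => sin t * moment p k - p k * sin (IZR k * t)))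
        by (intros; unfold moment; ring).
      rewrite Zsum_minus, Zsum_scal, M0, Im_fourier by auto using Zsummable_scal, Zsummable_sin. ring. }
  assert (Im2 : - Im (fourier p t) <= Cmod (1 - fourier p t)%C).
  { eapply Rle_trans; [|apply Rmax_Cmod]. eapply Rle_trans; [|apply Rmax_r].
    replace (snd (1 - fourier p t)%C) with (- Im (fourier p t)) by (simpl; unfold Im; ring).
    apply Rle_abs. }
  set (M := (L * n)%nat).
  assert (M0' : 0 < INR M) by (apply lt_0_INR; unfold M; nia).
  assert (Re1 : Re (1 - fourier p t)%C <= t ^ 2 / 2 * (p (-1)%Z + head_moment p M) + 2 / INR M * T).
  { rewrite Re_one_minus_fourier by assumption.
    eapply Rle_trans; [apply Zsum_head_tail with (n := M)|].
    - now apply Zsummable_one_minus_cos.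
    - intros k Hk. rewrite Hs by assumption. ring.
    - intros k. apply Rmult_le_pos; [apply H0|]. generalize (COS_bound (IZR k * t)). lra.
    - cbv beta. rewrite Rmult_0_l, cos_0, Rminus_diag, Rmult_0_r, Rplus_0_r, Rmult_plus_distr_l.
      apply Rplus_le_compat; [apply Rplus_le_compat|].
      + rewrite (Rmult_comm (t ^ 2 / 2)). apply Rmult_le_compat_l; [apply H0|].
        generalize (one_minus_cos_le (-1 * t)). nra.
      + unfold head_moment. rewrite <- sum_n_m_scal. apply sum_n_m_le_loc. intros k _.
        rewrite <- INR_IZR_INZ. generalize (one_minus_cos_le (INR k * t)) (H0 (Z.of_nat k)).
        rewrite Rpow_mult_distr. nra.
      + apply Rle_trans with (2 / INR M * tail_moment p M).
        * unfold tail_moment. rewrite <- Series_scal_l. apply Series_le.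
          -- intros j. generalize (COS_bound (IZR (Z.of_nat (M + j)) * t)) (H0 (Z.of_nat (M + j))). intros.
             split; [apply Rmult_le_pos; lra|].
             replace (2 / INR M * (INR (M + j) * p (Z.of_nat (M + j)))) with
               (p (Z.of_nat (M + j)) * (2 * (INR (M + j) / INR M))) by (field; lra).
             apply Rmult_le_compat_l; [assumption|].
             assert (1 <= INR (M + j) / INR M); [|lra].
             apply Rmult_le_reg_r with (INR M); [assumption|].
             unfold Rdiv. rewrite Rmult_assoc, Rinv_l, Rmult_1_l, Rmult_1_r by lra.
             apply le_INR; lia.
          -- apply ex_series_scal_R. now apply tail_moment_summable.
        * apply Rmult_le_compat_l; [apply Rlt_le, Rdiv_lt_0_compat; lra|].
          unfold T. apply tail_moment_decr; [exact H0 | exact Mp | unfold M; nia]. }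
  pose proof (HB t Ht) as A. pose proof (head_moment_dilate p L n H0 Hd HL1 Hn) as D.
  fold M S in D.
  assert (B1 : p (-1)%Z <= B * S).
  { replace (p (-1)%Z) with (B * p 1%Z) by (unfold B; field; lra). now apply Rmult_le_compat_l. }
  set (W := p (-1)%Z + head_moment p M) in *.
  assert (HW : W <= (B + (1 + 3 * INR L ^ 3)) * S) by (unfold W; lra).
  assert (E : t / 3 * T <= K * (t ^ 2 / 2 * W + 2 / INR M * T)).
  { eapply Rle_trans; [exact Im1|]. eapply Rle_trans; [exact Im2|].
    eapply Rle_trans; [exact A|]. apply Rmult_le_compat_l; [lra | exact Re1]. }
  assert (EM : K * (2 / INR M) <= t / 6).
  { unfold M, t. rewrite mult_INR. apply Rmult_le_reg_r with (INR L * INR n); [nra|].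
    replace (K * (2 / (INR L * INR n)) * (INR L * INR n)) with (2 * K) by (field; nra).
    replace (2 / INR n / 6 * (INR L * INR n)) with (INR L / 3) by (field; lra). lra. }
  assert (E2 : t / 6 * T <= K * (t ^ 2 / 2 * W)).
  { assert (K * (2 / INR M) * T <= t / 6 * T) by now apply Rmult_le_compat_r. nra. }
  assert (E3 : INR n * T <= 6 * K * W).
  { apply Rmult_le_reg_l with (t ^ 2 / 12); [nra|].
    replace (t ^ 2 / 12 * (INR n * T)) with (t / 6 * T * ((INR n * t) / 2)) by field.
    rewrite nt. nra. }
  assert (6 * K * W <= C2 * S).
  { unfold C2. rewrite (Rmult_assoc (6 * K)). apply Rmult_le_compat_l; [lra | exact HW]. }
  assert (0 <= C1 * S) by (apply Rmult_le_pos; lra). lra.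
Qed.

(** * Calculus of complex-valued functions of a real variable *)

(** Componentwise notions, so that the product rule for complex values reduces to
    that for real functions. *)
Definition Ccontinuous (u : R -> C) (x : R) : Prop :=
  continuous (fun t => Re (u t)) x /\ continuous (fun t => Im (u t)) x.

Definition Cderive (u : R -> C) (x : R) (l : C) : Prop :=
  is_derive (fun t => Re (u t)) x (Re l) /\ is_derive (fun t => Im (u t)) x (Im l).

Lemma Ccontinuous_continuous u x : Ccontinuous u x -> continuous u x.
Proof.
  intros [A B]. apply continuous_ext with (2 := continuous_pair _ _ _ A B).
  intros t. symmetry. apply surjective_pairing.
Qed.

Lemma Cderive_is_derive u x l : Cderive u x l -> is_derive (V := C_R_NormedModule) u x l.
Proof.
  intros [A B]. rewrite (surjective_pairing l).
  eapply is_derive_ext; [|exact (is_derive_pair _ _ _ _ _ A B)].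
  intros t. symmetry. apply surjective_pairing.
Qed.

Lemma Cderive_ext_loc u v x l : locally x (fun t => u t = v t) -> Cderive u x l -> Cderive v x l.
Proof.
  intros H [A B]. split; eapply is_derive_ext_loc; [|exact A| |exact B];
    apply filter_imp with (2 := H); intros t Ht; simpl; now rewrite Ht.
Qed.

Lemma continuous_mult_R (f g : R -> R) x :
  continuous f x -> continuous g x -> continuous (fun t => f t * g t) x.
Proof. exact (continuous_mult (K := R_AbsRing) f g x). Qed.

Lemma continuous_plus_R (f g : R -> R) x :
  continuous f x -> continuous g x -> continuous (fun t => f t + g t) x.
Proof. exact (continuous_plus (V := R_NormedModule) f g x). Qed.

Lemma continuous_minus_R (f g : R -> R) x :
  continuous f x -> continuous g x -> continuous (fun t => f t - g t) x.
Proof. exact (continuous_minus (V := R_NormedModule) f g x). Qed.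

Lemma Ccontinuous_plus u v x :
  Ccontinuous u x -> Ccontinuous v x -> Ccontinuous (fun t => u t + v t)%C x.
Proof.
  intros [A B] [C D]. split; [exact (continuous_plus_R _ _ _ A C) | exact (continuous_plus_R _ _ _ B D)].
Qed.

Lemma Ccontinuous_mult u v x :
  Ccontinuous u x -> Ccontinuous v x -> Ccontinuous (fun t => u t * v t)%C x.
Proof.
  intros [A B] [C D]. split.
  - exact (continuous_minus_R _ _ _ (continuous_mult_R _ _ _ A C) (continuous_mult_R _ _ _ B D)).
  - exact (continuous_plus_R _ _ _ (continuous_mult_R _ _ _ A D) (continuous_mult_R _ _ _ B C)).
Qed.

Lemma Ccontinuous_const c x : Ccontinuous (fun _ => c) x.
Proof. split; apply continuous_const. Qed.

Lemma Cderive_plus u v x du dv : Cderive u x du -> Cderive v x dv ->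
  Cderive (fun t => u t + v t)%C x (du + dv)%C.
Proof.
  intros [A B] [C D]. split.
  - exact (is_derive_plus (V := R_NormedModule) _ _ _ _ _ A C).
  - exact (is_derive_plus (V := R_NormedModule) _ _ _ _ _ B D).
Qed.

Lemma is_derive_mult_R (f g : R -> R) x df dg : is_derive f x df -> is_derive g x dg ->
  is_derive (fun t => f t * g t) x (df * g x + f x * dg).
Proof. intros A B. apply (is_derive_mult (K := R_AbsRing) f g x df dg A B Rmult_comm). Qed.

Lemma Cderive_mult u v x du dv : Cderive u x du -> Cderive v x dv ->
  Cderive (fun t => u t * v t)%C x (du * v x + u x * dv)%C.
Proof.
  intros [A B] [C D]. split.
  - replace (Re (du * v x + u x * dv)%C) with
      ((Re du * Re (v x) + Re (u x) * Re dv) - (Im du * Im (v x) + Im (u x) * Im dv))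
      by (unfold Re, Im; simpl; ring).
    exact (is_derive_minus (V := R_NormedModule) _ _ _ _ _ (is_derive_mult_R _ _ _ _ _ A C) (is_derive_mult_R _ _ _ _ _ B D)).
  - replace (Im (du * v x + u x * dv)%C) with
      ((Re du * Im (v x) + Re (u x) * Im dv) + (Im du * Re (v x) + Im (u x) * Re dv))
      by (unfold Re, Im; simpl; ring).
    exact (is_derive_plus (V := R_NormedModule) _ _ _ _ _ (is_derive_mult_R _ _ _ _ _ A D) (is_derive_mult_R _ _ _ _ _ B C)).
Qed.

Lemma Cderive_const c x : Cderive (fun _ => c) x 0%C.
Proof. split; simpl; apply (is_derive_const (V := R_NormedModule)). Qed.

Lemma Cderive_scal c u x du : Cderive u x du -> Cderive (fun t => c * u t)%C x (c * du)%C.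
Proof.
  intros H. replace (c * du)%C with (0 * u x + c * du)%C by ring.
  apply (Cderive_mult (fun _ => c) u); [apply Cderive_const | exact H].
Qed.

Lemma fourier_Ccontinuous p x : Zsummable p -> Ccontinuous (fourier p) x.
Proof. apply fourier_continuous_parts. Qed.

Lemma fourier_Cderive p x : Zsummable p -> Zsummable (moment p) ->
  Cderive (fourier p) x (Ci * fourier (moment p) x)%C.
Proof.
  intros Hp Mp. destruct (fourier_derive_parts p x Hp Mp) as [A B]. split.
  - replace (Re (Ci * fourier (moment p) x)%C) with (- Im (fourier (moment p) x)); [exact A|].
    unfold Re, Im; simpl; ring.
  - replace (Im (Ci * fourier (moment p) x)%C) with (Re (fourier (moment p) x)); [exact B|].
    unfold Re, Im; simpl; ring.
Qed.

(** The relative derivative quantifies over all limits of the filter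
    [within D (locally x)]; since [D x] holds this filter is proper and [x] is its only
    limit. *)
Lemma is_derive_on_of_is_derive {V : NormedModule R_AbsRing} (D : R -> Prop) (f : R -> V) x l :
  D x -> is_derive f x l -> is_derive_on D f x l.
Proof.
  intros Dx [L H]. split; [exact L|]. intros y Hy.
  assert (PF : ProperFilter (within D (locally x))).
  { constructor; [|apply within_filter, locally_filter].
    intros P HP. exists x. apply (locally_singleton _ _ HP). exact Dx. }
  assert (E : x = y).
  { apply (is_filter_lim_unique (V := R_NormedModule) (F := within D (locally x))); [|exact Hy].
    intros P HP. unfold within. apply filter_imp with (2 := HP). auto. }
  subst y. refine (is_domin_le (F := locally x) _ _ (H x (fun P HP => HP)) _).
  intros P HP. unfold within. apply filter_imp with (2 := HP). auto.
Qed.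

(** * The second derivative of the Fourier transform *)

(** Equal to [1 / (1 - e^{it})], in the form [(1 + i cot (t/2)) / 2] whose parts are real
    functions that can be differentiated. *)
Definition cinv (t : R) : C := (1 / 2, cos (t / 2) / (2 * sin (t / 2))).

Definition cinv' (t : R) : C := (0, - (1 / (4 * sin (t / 2) ^ 2))).

(** The only zero of [1 - e^{it}] in [[-pi, pi]] is the origin. *)
Lemma sin_half_neq_0 t : Ipi_star t -> sin (t / 2) <> 0.
Proof.
  intros [[A B] N]. generalize PI_RGT_0. intros.
  destruct (Rtotal_order t 0) as [L | [E | L]]; [|contradiction|].
  - assert (0 < sin (- (t / 2))) by (apply sin_gt_0; lra). rewrite sin_neg in *. lra.
  - assert (0 < sin (t / 2)) by (apply sin_gt_0; lra). lra.
Qed.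

Lemma cinv_spec t : sin (t / 2) <> 0 -> ((1 - cis t) * cinv t = 1)%C.
Proof.
  intros H. unfold cis, cinv.
  assert (C1 : cos t = 1 - 2 * sin (t / 2) ^ 2) by (generalize (one_minus_cos t); lra).
  assert (S1 : sin t = 2 * sin (t / 2) * cos (t / 2)).
  { replace t with (2 * (t / 2)) at 1 by field. apply sin_2a. }
  assert (N : cos (t / 2) ^ 2 = 1 - sin (t / 2) ^ 2).
  { generalize (sin2_cos2 (t / 2)). unfold Rsqr. nra. }
  apply injective_projections; simpl; rewrite C1, S1.
  - replace (1 + - (1 - 2 * sin (t / 2) ^ 2)) with (2 * sin (t / 2) ^ 2) by ring.
    replace (0 + - (2 * sin (t / 2) * cos (t / 2))) with (- (2 * sin (t / 2) * cos (t / 2))) by ring.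
    replace (- (2 * sin (t / 2) * cos (t / 2)) * (cos (t / 2) / (2 * sin (t / 2))))
      with (- cos (t / 2) ^ 2) by (field; exact H).
    rewrite N. field.
  - field. exact H.
Qed.

Lemma cinv_bound t : Ipi_star t -> Rabs t * Cmod (cinv t) <= 3 /\ Rabs t ^ 2 * Cmod (cinv' t) <= 9.
Proof.
  intros Ht. pose proof (sin_half_neq_0 t Ht) as Hs. destruct Ht as [[A B] N].
  assert (S0 : 0 < sin (t / 2) ^ 2) by (apply pow2_gt_0; exact Hs).
  assert (Lo : t ^ 2 <= 36 * sin (t / 2) ^ 2).
  { generalize (one_minus_cos t). intros E.
    destruct (Rle_lt_dec (Rabs t) 2) as [L | L].
    - generalize (one_minus_cos_ge t L). nra.
    - assert (cos (Rabs t) <= 0).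
      { assert (Rabs t <= PI) by (apply Rabs_le; lra).
        generalize PI_4 PI2_1. intros. apply cos_le_0; lra. }
      assert (Ec : cos t = cos (Rabs t)) by (unfold Rabs; destruct Rcase_abs; [now rewrite cos_neg | reflexivity]).
      assert (Rabs t <= 4) by (generalize PI_4; intros; apply Rabs_le; lra).
      rewrite <- (pow2_abs t). generalize (Rabs_pos t). nra. }
  assert (N1 : Cmod (cinv t) ^ 2 = / (4 * sin (t / 2) ^ 2)).
  { rewrite Cmod2_alt. unfold cinv, Re, Im; simpl fst; simpl snd.
    assert (E : cos (t / 2) ^ 2 = 1 - sin (t / 2) ^ 2).
    { generalize (sin2_cos2 (t / 2)). unfold Rsqr. nra. }
    replace ((cos (t / 2) / (2 * sin (t / 2))) ^ 2) with (cos (t / 2) ^ 2 / (4 * sin (t / 2) ^ 2))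
      by (field; exact Hs).
    rewrite E. field. exact Hs. }
  assert (N2 : Cmod (cinv' t) = / (4 * sin (t / 2) ^ 2)).
  { replace (cinv' t) with (Ci * RtoC (- (1 / (4 * sin (t / 2) ^ 2))))%C.
    2: { unfold cinv', Ci, RtoC, Cmult; simpl. f_equal; ring. }
    rewrite Cmod_mult, Cmod_Ci, Cmod_R, Rabs_Ropp, Rabs_pos_eq, Rmult_1_l.
    - unfold Rdiv. ring.
    - apply Rlt_le, Rdiv_lt_0_compat; lra. }
  assert (Q : t ^ 2 * / (4 * sin (t / 2) ^ 2) <= 9).
  { apply Rmult_le_reg_r with (4 * sin (t / 2) ^ 2); [lra|].
    rewrite Rmult_assoc, Rinv_l by lra. lra. }
  split.
  - apply Rsqr_incr_0_var; [|lra]. unfold Rsqr.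
    replace (Rabs t * Cmod (cinv t) * (Rabs t * Cmod (cinv t))) with (Rabs t ^ 2 * Cmod (cinv t) ^ 2) by ring.
    rewrite pow2_abs, N1. lra.
  - rewrite pow2_abs, N2. exact Q.
Qed.

Lemma cinv_Cderive t : sin (t / 2) <> 0 -> Cderive cinv t (cinv' t).
Proof.
  intros H. split; unfold cinv, cinv', Re, Im; simpl fst; simpl snd.
  - apply (is_derive_const (V := R_NormedModule)).
  - auto_derive; [lra|].
    assert (E : cos (t * / 2) ^ 2 = 1 - sin (t * / 2) ^ 2).
    { generalize (sin2_cos2 (t * / 2)). unfold Rsqr. nra. }
    unfold Rdiv in *.
    match goal with |- ?l = ?r => replace l with
      (- (sin (t * / 2) ^ 2 + cos (t * / 2) ^ 2) / (4 * sin (t * / 2) ^ 2)) end.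
    + rewrite E. field. exact H.
    + field. exact H.
Qed.

Lemma cinv_Ccontinuous t : sin (t / 2) <> 0 -> Ccontinuous cinv t.
Proof.
  intros H. destruct (cinv_Cderive t H) as [A B].
  split; apply (ex_derive_continuous (V := R_NormedModule)); eexists; eassumption.
Qed.

Lemma cinv'_Ccontinuous t : sin (t / 2) <> 0 -> Ccontinuous cinv' t.
Proof.
  intros H. split; unfold cinv', Re, Im; simpl fst; simpl snd.
  - apply continuous_const.
  - apply (ex_derive_continuous (V := R_NormedModule)). auto_derive.
    assert (0 < sin (t * / 2) ^ 2) by (apply pow2_gt_0; exact H). simpl in *. lra.
Qed.


(** The coefficients of [(1 - e^{it})] times the Fourier series of [moment p]. *)
Definition moment_diff (p : Z -> R) (k : Z) : R := moment p k - moment p (k - 1)%Z.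

(** Monotonicity makes the differences of [k p(k)] summable against weights for
    which [k p(k)] itself would not be: by Abel summation a weight [g(k)] on
    [k (p(k-1) - p(k))] turns into the weight [(k+1) g(k+1) - k g(k)] on [p(k)],
    which is [O(g(k))] when [g] grows at most quadratically. *)
Lemma moment_diff_weighted p g : skip_free_decreasing p -> 0 < p 1%Z ->
  (forall k, 0 <= g k) -> g 0%Z = 0 ->
  (forall n, (1 <= n)%nat ->
     INR n ^ 2 * g (Z.of_nat (S n)) <= INR (S n) ^ 2 * g (Z.of_nat n)) ->
  Zsummable (fun k => p k * g k) ->
  Zsummable (fun k => moment_diff p k * g k) /\
  Zsum (fun k => Rabs (moment_diff p k) * g k)
    <= (12 + 2 * (p 0%Z / p 1%Z)) * Zsum (fun k => p k * g k).
Proof.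
  intros ((H0 & Hp & H1) & Hc & Hs & Hd) P1 G0 Gz Gg Sg.
  set (G := Zsum (fun k => p k * g k)).
  assert (pg0 : forall k, 0 <= p k * g k) by (intros; apply Rmult_le_pos; auto).
  assert (GG : 0 <= G) by now apply Zsum_nonneg.
  set (q := fun k => Rabs (moment_diff p k) * g k).
  set (P := fun n => sum_n_m (fun k => q (Z.of_nat k)) 1 n).
  set (A := fun n => sum_n_m (fun k => p (Z.of_nat k) * g (Z.of_nat k)) 1 n).
  assert (growth : forall n, (1 <= n)%nat ->
    INR (S n) * g (Z.of_nat (S n)) <= (INR n + 7) * g (Z.of_nat n) /\
    g (Z.of_nat (S n)) <= 4 * g (Z.of_nat n)).
  { intros n Hn. specialize (Gg n Hn). rewrite S_INR in *.
    assert (N1 : 1 <= INR n) by now apply (le_INR 1).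
    set (x := INR n) in *. set (a := g (Z.of_nat (S n))) in *. set (b := g (Z.of_nat n)) in *.
    assert (0 <= b) by apply G0. assert (X2 : 0 < x ^ 2) by nra. split.
    - apply Rmult_le_reg_l with (x ^ 2); [exact X2|].
      apply Rle_trans with ((x + 1) * ((x + 1) ^ 2 * b)).
      + replace (x ^ 2 * ((x + 1) * a)) with ((x + 1) * (x ^ 2 * a)) by ring.
        apply Rmult_le_compat_l; lra.
      + replace ((x + 1) * ((x + 1) ^ 2 * b)) with ((x + 1) ^ 3 * b) by ring.
        replace (x ^ 2 * ((x + 7) * b)) with ((x ^ 2 * (x + 7)) * b) by ring.
        apply Rmult_le_compat_r; [assumption|]. nra.
    - apply Rmult_le_reg_l with (x ^ 2); [exact X2|].
      eapply Rle_trans; [exact Gg|].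
      replace (x ^ 2 * (4 * b)) with ((4 * x ^ 2) * b) by ring.
      apply Rmult_le_compat_r; [assumption|]. nra. }
  assert (qn : forall n, q (Z.of_nat (S n)) <=
    (INR (S n) * (p (Z.of_nat n) - p (Z.of_nat (S n))) + p (Z.of_nat n)) * g (Z.of_nat (S n))).
  { intros n. unfold q. apply Rmult_le_compat_r; [apply G0|].
    unfold moment_diff, moment. replace (Z.of_nat (S n) - 1)%Z with (Z.of_nat n) by lia.
    rewrite <- !INR_IZR_INZ, S_INR. generalize (Hd n) (H0 (Z.of_nat n)) (pos_INR n). intros.
    apply Rabs_le. split; [nra|]. nra. }
  (* Abel summation: the boundary term is kept on the left to make the induction pass *)
  assert (Abel : forall n, P (S n) + INR (S n) * p (Z.of_nat (S n)) * g (Z.of_nat (S n))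
      <= 2 * (p 0%Z * g 1%Z) + 11 * A n).
  { induction n.
    - unfold P, A. rewrite sum_n_n, sum_n_m_zero by lia. unfold zero; simpl zero.
      generalize (qn 0%nat). simpl. lra.
    - assert (EP : P (S (S n)) = P (S n) + q (Z.of_nat (S (S n))))
        by exact (sum_n_Sm (fun k => q (Z.of_nat k)) 1 (S n) ltac:(lia)).
      assert (EA : A (S n) = A n + p (Z.of_nat (S n)) * g (Z.of_nat (S n)))
        by exact (sum_n_Sm (fun k => p (Z.of_nat k) * g (Z.of_nat k)) 1 n ltac:(lia)).
      rewrite EP, EA.
      destruct (growth (S n) ltac:(lia)) as [W1 W2].
      pose proof (qn (S n)) as Q. pose proof (H0 (Z.of_nat (S n))) as Hpn.
      apply Rmult_le_compat_l with (r := p (Z.of_nat (S n))) in W1, W2; try assumption.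
      lra. }
  assert (neg : forall M, sum_n (fun n => q (- Z.of_nat (S n))%Z) M = q (-1)%Z).
  { induction M; [now rewrite sum_O|]. rewrite sum_Sn, IHM.
    assert (E : q (- Z.of_nat (S (S M)))%Z = 0).
    { unfold q, moment_diff, moment. rewrite !Hs by lia.
      rewrite !Rmult_0_r, Rminus_0_r, Rabs_R0. ring. }
    rewrite E. exact (Rplus_0_r _). }
  assert (q1 : q (-1)%Z = p (-1)%Z * g (-1)%Z).
  { unfold q, moment_diff, moment. rewrite (Hs (-1 - 1)%Z) by lia.
    rewrite Rmult_0_r, Rminus_0_r.
    replace (-1 * p (-1)%Z) with (- p (-1)%Z) by ring. rewrite Rabs_Ropp, Rabs_pos_eq by apply H0. reflexivity. }
  assert (q0 : q 0%Z = 0) by (unfold q; rewrite Gz; ring).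
  assert (r1 : p 0%Z * g 1%Z <= p 0%Z / p 1%Z * G).
  { replace (p 0%Z * g 1%Z) with (p 0%Z / p 1%Z * (p 1%Z * g 1%Z)) by (field; lra).
    apply Rmult_le_compat_l.
    - apply Rmult_le_pos; [apply H0 | now apply Rlt_le, Rinv_0_lt_compat].
    - now apply (Zsum_term (fun k => p k * g k)). }
  assert (AG : forall n, A n <= G) by (intros; now apply (Zsum_ge_head (fun k => p k * g k))).
  assert (Bd : forall M, zpart q M <= (12 + 2 * (p 0%Z / p 1%Z)) * G).
  { intros M. unfold zpart. rewrite neg, q1, sum_n_first. change (Z.of_nat 0) with 0%Z. rewrite q0.
    pose proof (Zsum_term (fun k => p k * g k) (-1)%Z pg0 Sg) as E. fold G in E. cbv beta in E.
    assert (sum_n_m (fun n => q (Z.of_nat n)) 1 M <= 2 * (p 0%Z * g 1%Z) + 11 * G).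
    { destruct M.
      - rewrite sum_n_m_zero by lia. unfold zero; simpl. generalize (Rmult_le_pos _ _ (H0 0%Z) (G0 1%Z)). lra.
      - fold (P (S M)).
        assert (0 <= INR (S M) * p (Z.of_nat (S M)) * g (Z.of_nat (S M)))
          by (repeat apply Rmult_le_pos; auto using pos_INR).
        generalize (Abel M) (AG M). lra. }
    lra. }
  assert (Sq : Zsummable (fun k => moment_diff p k * g k)).
  { apply Zsummable_bound with ((12 + 2 * (p 0%Z / p 1%Z)) * G). intros M.
    rewrite (zpart_ext _ q); [apply Bd|]. intros k. unfold q.
    now rewrite Rabs_mult, (Rabs_pos_eq (g k)). }
  split; [exact Sq|]. apply Zsum_le_bound; [|exact Bd].
  eapply Zsummable_ext; [|exact (Zsummable_abs _ Sq)].
  intros k; simpl. now rewrite Rabs_mult, (Rabs_pos_eq (g k)).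
Qed.

Lemma moment_diff_moment_summable p : skip_free_decreasing p -> 0 < p 1%Z ->
  Zsummable (moment (moment_diff p)).
Proof.
  intros H P1. pose proof H as ((H0 & Hp & H1) & Hc & Hs & Hd).
  destruct (centered_moment p Hc) as [Mp _].
  destruct (moment_diff_weighted p (fun k => Rabs (IZR k)) H P1) as [A _].
  - intros; apply Rabs_pos.
  - apply Rabs_R0.
  - intros n Hn. rewrite <- !INR_IZR_INZ, !Rabs_pos_eq, S_INR by apply pos_INR.
    assert (1 <= INR n) by now apply (le_INR 1). nra.
  - apply Zsummable_le with (2 := Zsummable_abs _ Mp). intros k. unfold moment.
    rewrite !Rabs_mult, Rabs_Rabsolu. right; ring.
  - apply Zsummable_le with (2 := Zsummable_abs _ A). intros k. unfold moment at 1.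
    rewrite !Rabs_mult, Rabs_Rabsolu. right; ring.
Qed.

Lemma moment_diff_gauge_le p t : skip_free_decreasing p -> 0 < p 1%Z ->
  Zsummable (fun k => moment_diff p k * gauge (IZR k * t)) /\
  Zsum (fun k => Rabs (moment_diff p k) * gauge (IZR k * t))
    <= (12 + 2 * (p 0%Z / p 1%Z)) * gauge_sum p t.
Proof.
  intros H P1. pose proof H as ((H0 & Hp & H1) & Hc & Hs & Hd).
  destruct (centered_moment p Hc) as [Mp _].
  apply (moment_diff_weighted p (fun k => gauge (IZR k * t))); auto.
  - intros; apply gauge_nonneg.
  - now rewrite Rmult_0_l, gauge_0.
  - intros n Hn. rewrite <- !INR_IZR_INZ.
    assert (N1 : 1 <= INR n) by now apply (le_INR 1).
    assert (L : 1 <= INR (S n) / INR n).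
    { apply Rmult_le_reg_r with (INR n); [lra|]. unfold Rdiv.
      rewrite Rmult_assoc, Rinv_l, Rmult_1_r, S_INR by lra. lra. }
    pose proof (gauge_dilate_le _ (INR n * t) L) as Q.
    replace (INR (S n) / INR n * (INR n * t)) with (INR (S n) * t) in Q by (field; lra).
    apply Rmult_le_compat_l with (r := INR n ^ 2) in Q; [|apply pow2_ge_0].
    replace (INR n ^ 2 * ((INR (S n) / INR n) ^ 2 * gauge (INR n * t))) with
      (INR (S n) ^ 2 * gauge (INR n * t)) in Q by (field; lra). exact Q.
  - now apply gauge_sum_summable.
Qed.

Lemma moment_diff_summable p : Zsummable (moment p) -> Zsummable (moment_diff p).
Proof.
  intros Mp. apply Zsummable_minus; [exact Mp | now apply Zsummable_shift_minus1].
Qed.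

Lemma moment_diff_fourier p t : Zsummable (moment p) ->
  fourier (moment_diff p) t = ((1 - cis t) * fourier (moment p) t)%C.
Proof.
  intros Mp. unfold moment_diff.
  rewrite fourier_minus by auto using Zsummable_shift_minus1.
  rewrite (fourier_shift (moment p)) by assumption. ring.
Qed.

(** The sum is the derivative at [0] of [(1 - e^{it}) D(t)], up to the factor [i],
    where [D] is the Fourier series of [moment p]; it vanishes because [D(0) = 0]. *)
Lemma moment_diff_moment_sum p : skip_free_decreasing p -> 0 < p 1%Z ->
  Zsum (moment (moment_diff p)) = 0.
Proof.
  intros H P1. pose proof H as ((H0 & Hp & H1) & Hc & Hs & Hd).
  destruct (centered_moment p Hc) as [Mp M0].
  destruct (fourier_derive_parts (moment_diff p) 0 (moment_diff_summable p Mp)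
    (moment_diff_moment_summable p H P1)) as [_ D].
  rewrite fourier_0 in D. simpl Re in D.
  assert (D0 : is_derive (fun t => Im (fourier (moment_diff p) t)) 0 0).
  { apply is_derive_Reals. intros eps He.
    destruct (fourier_continuous_parts (moment p) 0 Mp) as [A B].
    apply (proj1 (filterlim_locally _ _)) with (eps := mkposreal (eps / 2) ltac:(lra)) in A, B.
    rewrite fourier_0, M0 in A, B. simpl in A, B.
    destruct (filter_and _ _ A B) as [d Hd0]. exists d. intros h Hn Hh.
    assert (Bh : ball 0 d h).
    { unfold ball; simpl. unfold AbsRing_ball, abs, minus, plus, opp; simpl. now rewrite Ropp_0, Rplus_0_r. }
    destruct (Hd0 h Bh) as [E F].
    unfold ball in E, F; simpl in E, F. unfold AbsRing_ball, abs, minus, plus, opp in E, F; simpl in E, F.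
    rewrite Ropp_0, Rplus_0_r in E, F.
    rewrite Rplus_0_l, !moment_diff_fourier by assumption.
    rewrite fourier_0, M0. rewrite Rminus_0_r.
    replace (Im ((1 - cis 0) * 0)%C) with 0 by (unfold Im; simpl; ring). rewrite Rminus_0_r.
    set (z := fourier (moment p) h) in *.
    replace (Im ((1 - cis h) * z)%C) with ((1 - cos h) * Im z - sin h * Re z)
      by (unfold Im, Re; simpl; ring).
    assert (X : Rabs ((1 - cos h) * Im z - sin h * Re z) <= Cmod z * chord h).
    { replace ((1 - cos h) * Im z - sin h * Re z) with (Re z * (- sin h) + Im z * (1 - cos h)) by ring.
      apply dot_le_Cmod; [apply chord_nonneg|]. rewrite chord_sq. right; ring. }
    assert (Y : chord h <= Rabs h).
    { unfold chord. generalize (abs_sin_le (h / 2)). unfold Rdiv.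
      rewrite (Rabs_mult h), (Rabs_pos_eq (/ 2)) by lra. lra. }
    assert (W : Cmod z < eps).
    { rewrite (surjective_pairing z). eapply Rle_lt_trans; [apply Cmod_pair_le|].
      apply Rlt_le_trans with (eps / 2 + eps / 2); [apply Rplus_lt_compat; assumption | lra]. }
    assert (Hp0 : 0 < Rabs h) by now apply Rabs_pos_lt.
    unfold Rdiv. rewrite Rabs_mult, Rabs_inv.
    apply Rmult_lt_reg_r with (Rabs h); [assumption|].
    rewrite Rmult_assoc, Rinv_l, Rmult_1_r by lra.
    eapply Rle_lt_trans; [exact X|]. generalize (Cmod_ge_0 z) (chord_nonneg h). nra. }
  apply is_derive_unique in D. apply is_derive_unique in D0. congruence.
Qed.

Lemma moment_diff_moment_fourier_le p t : skip_free_decreasing p -> 0 < p 1%Z ->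
  Rabs t * Cmod (fourier (moment (moment_diff p)) t)
    <= 4 * (12 + 2 * (p 0%Z / p 1%Z)) * gauge_sum p t.
Proof.
  intros H P1. pose proof H as ((H0 & Hp & H1) & Hc & Hs & Hd).
  destruct (moment_diff_gauge_le p t H P1) as [A B].
  destruct (Req_dec t 0) as [-> | Ht]; [rewrite Rabs_R0, gauge_sum_0; lra|].
  assert (Pt : 0 < Rabs t) by now apply Rabs_pos_lt.
  assert (S : Zsummable (fun k => Rabs (moment_diff p k) * gauge (IZR k * t))).
  { eapply Zsummable_ext; [|exact (Zsummable_abs _ A)]. intros k; simpl.
    now rewrite Rabs_mult, (Rabs_pos_eq (gauge _)) by apply gauge_nonneg. }
  assert (Q : Cmod (fourier (moment (moment_diff p)) t) <=
    Zsum (fun k => 4 / Rabs t * (Rabs (moment_diff p k) * gauge (IZR k * t)))).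
  { apply fourier_chord_bound; auto using Zsummable_scal, moment_diff_moment_summable, moment_diff_moment_sum.
    intros k. apply Rmult_le_reg_l with (Rabs t); [assumption|].
    replace (Rabs t * (4 / Rabs t * (Rabs (moment_diff p k) * gauge (IZR k * t)))) with
      (Rabs (moment_diff p k) * (4 * gauge (IZR k * t))) by (field; lra).
    unfold moment at 1. rewrite Rabs_mult.
    replace (Rabs t * (Rabs (IZR k) * Rabs (moment_diff p k) * chord (IZR k * t))) with
      (Rabs (moment_diff p k) * (Rabs (IZR k * t) * chord (IZR k * t))) by (rewrite (Rabs_mult (IZR k)); ring).
    apply Rmult_le_compat_l; [apply Rabs_pos | apply chord_le_gauge]. }
  rewrite Zsum_scal in Q. apply Rmult_le_compat_l with (r := Rabs t) in Q; [|lra].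
  eapply Rle_trans; [exact Q|].
  match goal with |- ?l <= _ => replace l with
    (4 * Zsum (fun k => Rabs (moment_diff p k) * gauge (IZR k * t))) by (field; lra) end.
  lra.
Qed.

(** Derivative of [D = fourier (moment p)], obtained by writing
    [D = fourier (moment_diff p) / (1 - e^{it})]. *)
Definition moment_fourier' (p : Z -> R) (t : R) : C :=
  (Ci * fourier (moment (moment_diff p)) t * cinv t + fourier (moment_diff p) t * cinv' t)%C.

Lemma locally_sin_half_neq_0 t : sin (t / 2) <> 0 -> locally t (fun s => sin (s / 2) <> 0).
Proof.
  intros H.
  assert (K : continuous (fun s => sin (s / 2)) t).
  { apply (ex_derive_continuous (V := R_NormedModule)). auto_derive. exact I. }
  apply (K (fun y => y <> 0)).
  exists (mkposreal (Rabs (sin (t / 2))) (Rabs_pos_lt _ H)). intros y Hy E. subst y.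
  unfold ball in Hy; simpl in Hy. unfold AbsRing_ball, abs, minus, plus, opp in Hy; simpl in Hy.
  rewrite Rplus_0_l, Rabs_Ropp in Hy. lra.
Qed.

Lemma moment_fourier_Cderive p t : skip_free_decreasing p -> 0 < p 1%Z -> sin (t / 2) <> 0 ->
  Cderive (fourier (moment p)) t (moment_fourier' p t).
Proof.
  intros H P1 Ht. pose proof H as ((H0 & Hp & H1) & Hc & Hs & Hd).
  destruct (centered_moment p Hc) as [Mp M0].
  apply Cderive_ext_loc with (fun s => fourier (moment_diff p) s * cinv s)%C.
  - apply filter_imp with (2 := locally_sin_half_neq_0 t Ht). intros s Hn.
    rewrite moment_diff_fourier by assumption.
    transitivity (((1 - cis s) * cinv s) * fourier (moment p) s)%C; [ring|].
    rewrite cinv_spec by assumption. ring.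
  - apply Cderive_mult; [|now apply cinv_Cderive].
    apply fourier_Cderive; auto using moment_diff_summable, moment_diff_moment_summable.
Qed.

Lemma moment_fourier'_Ccontinuous p t : skip_free_decreasing p -> 0 < p 1%Z -> sin (t / 2) <> 0 ->
  Ccontinuous (moment_fourier' p) t.
Proof.
  intros H P1 Ht. pose proof H as ((H0 & Hp & H1) & Hc & Hs & Hd).
  destruct (centered_moment p Hc) as [Mp M0].
  apply Ccontinuous_plus; apply Ccontinuous_mult.
  - apply Ccontinuous_mult; [apply Ccontinuous_const|].
    apply fourier_Ccontinuous. now apply moment_diff_moment_summable.
  - now apply cinv_Ccontinuous.
  - apply fourier_Ccontinuous. now apply moment_diff_summable.
  - now apply cinv'_Ccontinuous.
Qed.

Lemma Cmod_one_minus_cis t : Cmod (1 - cis t)%C = chord t.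
Proof.
  apply Rsqr_inj; [apply Cmod_ge_0 | apply chord_nonneg|].
  rewrite !Rsqr_pow2, chord_sq, Cmod2_alt. unfold cis, Re, Im; simpl. ring.
Qed.

Lemma moment_fourier'_le p : skip_free_decreasing p -> 0 < p 1%Z ->
  exists K, 0 < K /\ forall t, Ipi_star t ->
    t ^ 2 * Cmod (moment_fourier' p t) <= K * gauge_sum p t.
Proof.
  intros H P1. pose proof H as (Hprob & Hc & Hs & Hd). pose proof Hprob as (H0 & Hp & H1).
  destruct (centered_moment p Hc) as [Mp M0].
  set (B := 4 * (12 + 2 * (p 0%Z / p 1%Z))).
  assert (B0 : 0 < B).
  { unfold B. assert (0 <= p 0%Z / p 1%Z); [|lra].
    apply Rmult_le_pos; [apply H0 | now apply Rlt_le, Rinv_0_lt_compat]. }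
  exists (3 * B + 36). split; [lra|]. intros t Ht.
  destruct (cinv_bound t Ht) as [I1 I2].
  pose proof (moment_diff_moment_fourier_le p t H P1) as E1. fold B in E1.
  pose proof (moment_fourier_le p t Hprob Hc) as E2.
  pose proof (gauge_sum_nonneg p t H0 Mp) as G.
  assert (E3 : Cmod (fourier (moment_diff p) t) <= Rabs t * Cmod (fourier (moment p) t)).
  { rewrite moment_diff_fourier, Cmod_mult, Cmod_one_minus_cis by assumption.
    apply Rmult_le_compat_r; [apply Cmod_ge_0|].
    unfold chord. generalize (abs_sin_le (t / 2)). unfold Rdiv.
    rewrite (Rabs_mult t), (Rabs_pos_eq (/ 2)) by lra. lra. }
  rewrite <- (pow2_abs t). unfold moment_fourier'.
  apply Rle_trans with (Rabs t ^ 2 * (Cmod (fourier (moment (moment_diff p)) t) * Cmod (cinv t)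
     + Cmod (fourier (moment_diff p) t) * Cmod (cinv' t))).
  - apply Rmult_le_compat_l; [apply pow2_ge_0|].
    eapply Rle_trans; [apply Cmod_triangle|]. rewrite !Cmod_mult, Cmod_Ci. right; ring.
  - set (a := Cmod (fourier (moment (moment_diff p)) t)) in *.
    set (b := Cmod (fourier (moment_diff p) t)) in *.
    set (x := Cmod (cinv t)) in *. set (y := Cmod (cinv' t)) in *. set (s := Rabs t) in *.
    replace (s ^ 2 * (a * x + b * y)) with ((s * a) * (s * x) + b * (s ^ 2 * y)) by ring.
    assert (0 <= a) by apply Cmod_ge_0. assert (0 <= b) by apply Cmod_ge_0.
    assert (0 <= x) by apply Cmod_ge_0. assert (0 <= y) by apply Cmod_ge_0.
    assert (0 <= s) by apply Rabs_pos.
    assert ((s * a) * (s * x) <= (B * gauge_sum p t) * 3).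
    { apply Rmult_le_compat; try assumption; now apply Rmult_le_pos. }
    assert (b * (s ^ 2 * y) <= (4 * gauge_sum p t) * 9).
    { apply Rmult_le_compat; try assumption; try lra.
      apply Rmult_le_pos; [apply pow2_ge_0 | assumption]. }
    lra.
Qed.

(** * Perturbations with finite second moment *)

Definition square_close (p s : Z -> R) (c : R) : Prop :=
  0 < c /\ Zsummable (fun n : Z => IZR n ^ 2 * Rabs (s n - c * p n)).

Definition square_dist (p s : Z -> R) (c : R) : R :=
  Zsum (fun n => IZR n ^ 2 * Rabs (s n - c * p n)).

Lemma Zsum_square_perturbation p s c t (e : R -> R) B : Zsummable p -> Zsummable s ->
  square_close p s c -> 0 <= B ->
  (forall x, Rabs (e x) <= B * x ^ 2) ->
  Zsummable (fun k => p k * e (IZR k * t)) -> Zsummable (fun k => s k * e (IZR k * t)) ->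
  Rabs (Zsum (fun k => s k * e (IZR k * t)) - c * Zsum (fun k => p k * e (IZR k * t)))
    <= B * square_dist p s c * t ^ 2.
Proof.
  intros Hp Hs [Hc Hd] HB He Sp Ss.
  assert (E : Zsum (fun k => s k * e (IZR k * t)) - c * Zsum (fun k => p k * e (IZR k * t)) =
    Zsum (fun k => (s k - c * p k) * e (IZR k * t))).
  { rewrite <- Zsum_scal, <- Zsum_minus by auto using Zsummable_scal. apply Zsum_ext; intros; ring. }
  assert (S : Zsummable (fun k => (s k - c * p k) * e (IZR k * t))).
  { apply Zsummable_ext with (fun k => s k * e (IZR k * t) - c * (p k * e (IZR k * t))); [intros; ring|].
    auto using Zsummable_minus, Zsummable_scal. }
  rewrite E. eapply Rle_trans; [now apply Zsum_abs|]. unfold square_dist.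
  replace (B * Zsum (fun n => IZR n ^ 2 * Rabs (s n - c * p n)) * t ^ 2) with
    ((B * t ^ 2) * Zsum (fun n => IZR n ^ 2 * Rabs (s n - c * p n))) by ring.
  rewrite <- Zsum_scal. apply Zsum_le; auto using Zsummable_abs, Zsummable_scal.
  intros k. rewrite Rabs_mult. specialize (He (IZR k * t)). rewrite Rpow_mult_distr in He.
  generalize (Rabs_pos (s k - c * p k)). intros. nra.
Qed.

Lemma square_dist_nonneg p s c : square_close p s c -> 0 <= square_dist p s c.
Proof.
  intros [_ H]. apply Zsum_nonneg; [|exact H].
  intros. apply Rmult_le_pos; [apply pow2_ge_0 | apply Rabs_pos].
Qed.

(** If [s] has no two adjacent atoms, then [s - c p] carries at least one of any two
    consecutive values of [c p]; by monotonicity these control all of [p], so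
    that [p], and with it [s], has a finite second moment. *)
Lemma perturbation_strictly_aperiodic p s c : skip_free_decreasing p -> is_probability s ->
  square_close p s c -> (finite_second_moment s -> strictly_aperiodic s) -> strictly_aperiodic s.
Proof.
  intros ((H0 & Hp & H1) & _ & Hs & Hd) Hprob [Hc Hsq] Himp.
  destruct (classic (exists j, 0 < s j /\ 0 < s (j + 1)%Z)) as [[j [A B]] | N].
  { now apply (adjacent_atoms_strictly_aperiodic s j). }
  apply Himp. pose proof Hprob as (S0 & Ss & S1).
  assert (adj : forall j, s j = 0 \/ s (j + 1)%Z = 0).
  { intros j. destruct (Rle_lt_or_eq_dec _ _ (S0 j)) as [A | A]; [right | now left].
    apply Rle_antisym; [|apply S0]. apply Rnot_lt_le. intros B. apply N. now exists j. }
  set (r := fun k => IZR k ^ 2 * Rabs (s k - c * p k)) in *.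
  assert (r0 : forall k, 0 <= r k).
  { intros. apply Rmult_le_pos; [apply pow2_ge_0 | apply Rabs_pos]. }
  assert (rz : forall k, s k = 0 -> r k = IZR k ^ 2 * (c * p k)).
  { intros k E. unfold r. rewrite E, Rminus_0_l, Rabs_Ropp, Rabs_pos_eq; [ring|].
    apply Rmult_le_pos; [lra | apply H0]. }
  set (b := fun k => 6 * (r k + r (k - 1)%Z + Rabs (c * p k))).
  assert (Sb : Zsummable b).
  { apply Zsummable_scal, Zsummable_plus; [apply Zsummable_plus|].
    - exact Hsq.
    - now apply (Zsummable_shift_minus1 r).
    - now apply Zsummable_abs, Zsummable_scal. }
  unfold finite_second_moment. apply Zsummable_le with b; [|exact Sb].
  intros k. rewrite Rabs_pos_eq by (apply Rmult_le_pos; [apply pow2_ge_0 | apply S0]).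
  assert (cp : 0 <= c * p k) by (apply Rmult_le_pos; [lra | apply H0]).
  assert (Q : IZR k ^ 2 * (c * p k) <= r k + 4 * r (k - 1)%Z + c * p k).
  { destruct (Z_lt_le_dec k 2) as [L | L].
    - destruct (Z_lt_le_dec k (-1)) as [L' | L'].
      + rewrite (Hs k L'), !Rmult_0_r. generalize (r0 k) (r0 (k - 1)%Z). lra.
      + assert (IZR k ^ 2 <= 1).
        { assert (-1 <= IZR k) by (apply (IZR_le (-1)); lia).
          assert (IZR k <= 1) by (apply (IZR_le _ 1); lia). nra. }
        generalize (r0 k) (r0 (k - 1)%Z). nra.
    - destruct (adj (k - 1)%Z) as [E | E].
      + apply rz in E. rewrite minus_IZR in E.
        assert (2 <= IZR k) by (apply (IZR_le 2); lia).
        assert (D : p k <= p (k - 1)%Z).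
        { replace k with (Z.of_nat (S (Z.to_nat (k - 1)))) at 1 by lia.
          replace (k - 1)%Z with (Z.of_nat (Z.to_nat (k - 1))) at 2 by lia. apply Hd. }
        assert (X : IZR k ^ 2 * (c * p k) <= 4 * (IZR k - 1) ^ 2 * (c * p (k - 1)%Z)).
        { apply Rmult_le_compat; [apply pow2_ge_0 | exact cp | nra |].
          apply Rmult_le_compat_l; lra. }
        generalize (r0 k). lra.
      + replace (k - 1 + 1)%Z with k in E by lia. apply rz in E.
        generalize (r0 (k - 1)%Z). lra. }
  assert (T : IZR k ^ 2 * s k <= IZR k ^ 2 * (c * p k) + r k).
  { unfold r. rewrite <- Rmult_plus_distr_l. apply Rmult_le_compat_l; [apply pow2_ge_0|].
    generalize (Rle_abs (s k - c * p k)). lra. }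
  unfold b. rewrite (Rabs_pos_eq (c * p k)) by exact cp. generalize (r0 k) (r0 (k - 1)%Z). lra.
Qed.

Lemma gauge_sum_perturbation p s c t : skip_free_decreasing p -> is_probability s -> centered s ->
  square_close p s c ->
  Rabs (gauge_sum s t - c * gauge_sum p t) <= square_dist p s c * t ^ 2.
Proof.
  intros ((H0 & Hp & H1) & Hcp & _) (S0 & Ss & S1) Hcs Hsq.
  destruct (centered_moment p Hcp) as [Mp _]. destruct (centered_moment s Hcs) as [Ms _].
  eapply Rle_trans; [apply (Zsum_square_perturbation p s c t gauge 1)|]; auto using gauge_sum_summable; try lra.
  intros x. rewrite Rabs_pos_eq by apply gauge_nonneg. generalize (gauge_le_sq x) (pow2_ge_0 x). lra.
Qed.

(** The error [O(t^2)] of the perturbation is absorbed because any atom off the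
    origin already makes [Re (1 - s^)] of order at least [t^2]. *)
Lemma gauge_sum_le_real_part p s c K : skip_free_decreasing p -> is_probability s -> centered s ->
  square_close p s c -> strictly_aperiodic s -> 0 < K ->
  (forall t, 0 < t <= 1 -> gauge_sum p t <= K * Re (1 - fourier p t)%C) ->
  exists d K', 0 < d /\ 0 < K' /\
    forall t, 0 < t <= d -> gauge_sum s t <= K' * Re (1 - fourier s t)%C.
Proof.
  intros Hsf Hprob Hcs Hsq Hap HK HG.
  destruct (strictly_aperiodic_atom s Hprob Hap) as (n & Hn & Pn).
  pose proof Hsf as ((H0 & Hp & H1) & Hcp & _). pose proof Hprob as (S0 & Ss & S1).
  set (M := square_dist p s c). assert (HM : 0 <= M) by now apply square_dist_nonneg.
  pose proof (IZR_abs_ge_1 n Hn) as An.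
  exists (Rmin 1 (2 / Rabs (IZR n))), (K + 3 * (K + 1) * M / s n).
  assert (Q0 : 0 <= 3 * (K + 1) * M / s n).
  { apply Rmult_le_pos; [nra | now apply Rlt_le, Rinv_0_lt_compat]. }
  split; [apply Rmin_case; [lra | apply Rdiv_lt_0_compat; lra]|]. split; [lra|].
  intros t [Ht0 Ht]. assert (t1 : t <= 1) by (eapply Rle_trans; [exact Ht | apply Rmin_l]).
  assert (tn : Rabs (IZR n * t) <= 2).
  { rewrite Rabs_mult, (Rabs_pos_eq t) by lra.
    apply Rle_trans with (Rabs (IZR n) * (2 / Rabs (IZR n))).
    - apply Rmult_le_compat_l; [lra | eapply Rle_trans; [exact Ht | apply Rmin_r]].
    - right. field. lra. }
  pose proof (gauge_sum_perturbation p s c t Hsf Hprob Hcs Hsq) as E1. fold M in E1.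
  pose proof (HG t ltac:(lra)) as E2.
  assert (E3 : Rabs (Re (1 - fourier s t)%C - c * Re (1 - fourier p t)%C) <= M * t ^ 2).
  { rewrite !Re_one_minus_fourier by assumption.
    eapply Rle_trans; [apply (Zsum_square_perturbation p s c t (fun x => 1 - cos x) (1 / 2))|];
      auto using Zsummable_one_minus_cos; try lra.
    - intros x. generalize (one_minus_cos_le x) (COS_bound x). intros. rewrite Rabs_pos_eq; lra.
    - fold M. generalize (pow2_ge_0 t). nra. }
  assert (E4 : s n / 3 * t ^ 2 <= Re (1 - fourier s t)%C).
  { rewrite Re_one_minus_fourier by assumption.
    apply Rle_trans with (s n * (1 - cos (IZR n * t))).
    - pose proof (one_minus_cos_ge _ tn) as X. rewrite Rpow_mult_distr in X.
      assert (1 <= IZR n ^ 2) by (rewrite <- pow2_abs; nra).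
      assert (t ^ 2 <= IZR n ^ 2 * t ^ 2) by (generalize (pow2_ge_0 t); nra).
      replace (s n / 3 * t ^ 2) with (s n * (t ^ 2 / 3)) by field.
      apply Rmult_le_compat_l; lra.
    - apply (Zsum_term (fun k => s k * (1 - cos (IZR k * t)))); [|now apply Zsummable_one_minus_cos].
      intros k. apply Rmult_le_pos; [apply S0|]. generalize (COS_bound (IZR k * t)). lra. }
  destruct Hsq as [Hc _].
  set (R := Re (1 - fourier s t)%C) in *. set (Rp := Re (1 - fourier p t)%C) in *.
  apply Rabs_le_between in E1. apply Rabs_le_between in E3.
  assert (c * gauge_sum p t <= K * (c * Rp)).
  { replace (K * (c * Rp)) with (c * (K * Rp)) by ring. apply Rmult_le_compat_l; lra. }
  assert (K * (c * Rp) <= K * (R + M * t ^ 2)) by (apply Rmult_le_compat_l; lra).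
  assert (X : (K + 1) * (M * t ^ 2) <= 3 * (K + 1) * M / s n * R).
  { replace ((K + 1) * (M * t ^ 2)) with (3 * (K + 1) * M / s n * (s n / 3 * t ^ 2)) by (field; lra).
    now apply Rmult_le_compat_l. }
  rewrite Rmult_plus_distr_r. lra.
Qed.

(** The series of [k s(k)] is [c] times that of [k p(k)] plus a series with finite
    first moment. Its derivative is therefore [O(psi / t^2)] plus a bounded term, which is also
    [O(psi / t^2)] since [psi] is at least quadratic. *)
Lemma perturbation_class_H p s c c0 : skip_free_decreasing p -> 0 < p 1%Z ->
  is_probability s -> centered s -> square_close p s c -> strictly_aperiodic s ->
  0 < c0 -> (forall t, Rabs t <= PI -> Cmod (fourier s t) <= 1 - c0 * gauge_sum s t) ->
  class_H s.
Proof.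
  intros Hsf P1 Hprob Hcs Hsq Hap Hc0 Hgap. split; [exact Hprob|].
  destruct (strictly_aperiodic_atom s Hprob Hap) as (n & Hn & Pn).
  pose proof Hsf as ((H0 & Hp & H1) & Hcp & _). pose proof Hprob as (S0 & Ss & S1).
  destruct (centered_moment p Hcp) as [Mp _]. destruct (centered_moment s Hcs) as [Ms _].
  pose proof Hsq as [Hc Hr].
  set (M := square_dist p s c). assert (HM : 0 <= M) by now apply square_dist_nonneg.
  set (r := fun k => s k - c * p k).
  assert (Mr : Zsummable (moment r)).
  { apply Zsummable_ext with (fun k => moment s k - c * moment p k); [intros; unfold moment, r; ring|].
    auto using Zsummable_minus, Zsummable_scal. }
  assert (MMr : Zsummable (moment (moment r))).
  { apply Zsummable_le with (2 := Hr). intros k. unfold moment. fold (r k).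
    rewrite <- Rmult_assoc, Rabs_mult. right. f_equal.
    rewrite Rabs_pos_eq; [ring|]. generalize (pow2_ge_0 (IZR k)). nra. }
  set (D2 := fun t => (c * moment_fourier' p t + Ci * fourier (moment (moment r)) t)%C).
  assert (Der : forall t, sin (t / 2) <> 0 -> Cderive (fourier (moment s)) t (D2 t)).
  { intros t Ht. apply Cderive_ext_loc with (fun t => c * fourier (moment p) t + fourier (moment r) t)%C.
    - apply filter_forall. intros u.
      rewrite <- fourier_scal, <- fourier_plus by auto using Zsummable_scal.
      apply fourier_ext. intros k. unfold moment, r. ring.
    - apply Cderive_plus; [apply Cderive_scal, moment_fourier_Cderive | apply fourier_Cderive]; auto. }
  destruct (moment_fourier'_le p Hsf P1) as (K & HK & HD).
  exists (fun t => Ci * fourier (moment s) t)%C, (fun t => Ci * D2 t)%C.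
  split; [|split; [|split]].
  - intros t Ht. apply is_derive_on_of_is_derive; [exact Ht|].
    now apply Cderive_is_derive, fourier_Cderive.
  - intros t Ht. apply is_derive_on_of_is_derive; [exact Ht|].
    apply Cderive_is_derive, Cderive_scal, Der. now apply sin_half_neq_0.
  - apply continuous_on_forall. intros t Ht. apply sin_half_neq_0 in Ht.
    apply Ccontinuous_continuous. apply Ccontinuous_mult; [apply Ccontinuous_const|].
    apply Ccontinuous_plus; apply Ccontinuous_mult; try apply Ccontinuous_const.
    + now apply moment_fourier'_Ccontinuous.
    + now apply fourier_Ccontinuous.
  - exists (gauge_sum s), (gauge_sum' s). split; [|split; [|split; [|split; [|split]]]].
    + intros x _. apply gauge_sum_even.
    + apply continuous_on_forall. intros. now apply gauge_sum_continuous.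
    + apply gauge_sum_0.
    + intros x Hx. apply is_derive_on_of_is_derive; [exact Hx | now apply gauge_sum_derive].
    + apply continuous_on_forall. intros. now apply gauge_sum'_continuous.
    + set (K2 := K + (K * M + M) * (6 / s n)).
      assert (HK2 : 0 < K2).
      { unfold K2. assert (0 < 6 / s n) by (apply Rdiv_lt_0_compat; lra).
        assert (0 <= K * M) by (apply Rmult_le_pos; lra). nra. }
      exists c0, (4 + K2). split; [exact Hc0|]. split; [lra|].
      intros t Ht. generalize PI_4. intros HPI.
      pose proof (gauge_sum_nonneg s t S0 Ms) as G.
      pose proof (gauge_sum_le_mul_gauge_sum' s t S0 Ms) as G'.
      assert (F1 : t * Cmod (fourier (moment s) t) <= 4 * gauge_sum s t).
      { rewrite <- (Rabs_pos_eq t) at 1 by lra. now apply moment_fourier_le. }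
      assert (F2 : t ^ 2 * Cmod (D2 t) <= K2 * gauge_sum s t).
      { assert (It : Ipi_star t) by (unfold Ipi_star, Ipi; lra).
        pose proof (HD t It) as A.
        pose proof (gauge_sum_perturbation p s c t Hsf Hprob Hcs Hsq) as B. fold M in B.
        apply Rabs_le_between in B.
        assert (T2 : t ^ 2 <= 6 / s n * gauge_sum s t).
        { pose proof (gauge_sum_ge_sq s n t S0 Ms Hn) as X.
          rewrite Rabs_pos_eq in X by lra. specialize (X ltac:(lra)).
          replace (t ^ 2) with (6 / s n * (s n / 6 * t ^ 2)) by (field; lra).
          apply Rmult_le_compat_l; [|exact X]. apply Rlt_le, Rdiv_lt_0_compat; lra. }
        assert (C1 : Cmod (fourier (moment (moment r)) t) <= M).
        { eapply Rle_trans; [now apply fourier_bound|]. unfold M, square_dist. right.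
          apply Zsum_ext. intros k. unfold moment. fold (r k).
          rewrite <- Rmult_assoc, Rabs_mult. f_equal.
          rewrite Rabs_pos_eq; [ring|]. generalize (pow2_ge_0 (IZR k)). nra. }
        assert (C2 : Cmod (D2 t) <= c * Cmod (moment_fourier' p t) + M).
        { unfold D2. eapply Rle_trans; [apply Cmod_triangle|].
          rewrite !Cmod_mult, Cmod_Ci, Cmod_R, Rabs_pos_eq by lra. lra. }
        apply Rle_trans with (t ^ 2 * (c * Cmod (moment_fourier' p t) + M)).
        { apply Rmult_le_compat_l; [apply pow2_ge_0 | exact C2]. }
        assert (C3 : c * (t ^ 2 * Cmod (moment_fourier' p t)) <= c * (K * gauge_sum p t))
          by (apply Rmult_le_compat_l; lra).
        assert (C4 : K * (c * gauge_sum p t) <= K * (gauge_sum s t + M * t ^ 2))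
          by (apply Rmult_le_compat_l; lra).
        assert (C5 : (K * M + M) * t ^ 2 <= (K * M + M) * (6 / s n * gauge_sum s t)).
        { apply Rmult_le_compat_l; [|exact T2]. assert (0 <= K * M) by (apply Rmult_le_pos; lra). lra. }
        unfold K2. nra. }
      rewrite !Cmod_mult, Cmod_Ci, Cmod_R, !(Rabs_pos_eq t), !Rmult_1_l by lra.
      assert (Gp : gauge_sum s t <= t * gauge_sum' s t) by exact G'.
      split; [|split; [|split]].
      * apply Hgap. rewrite Rabs_pos_eq; lra.
      * nra.
      * apply Rmult_le_reg_l with t; [lra|].
        assert (0 <= K2 * (t * gauge_sum' s t)) by (apply Rmult_le_pos; lra). nra.
      * apply Rmult_le_reg_l with t; [lra|].
        assert (K2 * gauge_sum s t <= K2 * (t * gauge_sum' s t)) by (apply Rmult_le_compat_l; lra). nra.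
Qed.

(** * Bounded angular ratio *)

(** From [1 - |z| <= Re (1 - z)]. *)
Lemma BAR_angular_bound p : is_probability p -> BAR p ->
  exists K, 0 < K /\ forall t, 0 < t <= 1 -> Cmod (1 - fourier p t)%C <= K * Re (1 - fourier p t)%C.
Proof.
  intros Hprob [Ha [K HK]]. exists (Rmax K 1). split; [generalize (Rmax_r K 1); lra|].
  intros t Ht. assert (It : 0 < t < 2 * PI) by (generalize PI2_1; lra).
  specialize (HK t It). specialize (Ha t It).
  set (x := Cmod (fourier p t)) in *.
  assert (Rx : 1 - x <= Re (1 - fourier p t)%C).
  { assert (Re (fourier p t) <= x).
    { eapply Rle_trans; [apply Rle_abs | apply re_le_Cmod]. }
    replace (Re (1 - fourier p t)%C) with (1 - Re (fourier p t)) by (unfold Re; simpl; ring). lra. }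
  apply Rle_trans with (K * (1 - x)).
  - apply Rmult_le_reg_r with (/ (1 - x)); [apply Rinv_0_lt_compat; lra|].
    replace (K * (1 - x) * / (1 - x)) with K by (field; lra). exact HK.
  - apply Rle_trans with (Rmax K 1 * (1 - x)).
    + apply Rmult_le_compat_r; [lra | apply Rmax_l].
    + apply Rmult_le_compat_l; [generalize (Rmax_r K 1); lra | exact Rx].
Qed.

Lemma BAR_not_delta0 p : BAR p -> p <> delta0.
Proof.
  intros [Ha _] ->. specialize (Ha PI ltac:(generalize PI_RGT_0; lra)).
  rewrite fourier_delta0, Cmod_1 in Ha. lra.
Qed.

(** The numerator is at most [6 psi] and the denominator at least [c psi]; angles
    beyond [PI] are reached by periodicity. *)
Lemma BAR_of_gap p c : is_probability p -> centered p -> strictly_aperiodic p -> 0 < c ->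
  (forall t, Rabs t <= PI -> Cmod (fourier p t) <= 1 - c * gauge_sum p t) -> BAR p.
Proof.
  intros Hprob Hc Ha Hc0 Hgap. split; [exact Ha|]. exists (6 / c).
  assert (main : forall t, Rabs t <= PI -> Cmod (fourier p t) < 1 ->
    Cmod (1 - fourier p t)%C / (1 - Cmod (fourier p t)) <= 6 / c).
  { intros t Ht H1. apply Rmult_le_reg_r with (1 - Cmod (fourier p t)); [lra|].
    unfold Rdiv at 1. rewrite Rmult_assoc, Rinv_l, Rmult_1_r by lra.
    eapply Rle_trans; [now apply one_minus_fourier_le|].
    replace (6 * gauge_sum p t) with (6 / c * (c * gauge_sum p t)) by (field; lra).
    apply Rmult_le_compat_l; [apply Rlt_le, Rdiv_lt_0_compat; lra|].
    generalize (Hgap t Ht). lra. }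
  intros t Ht. destruct (Rle_lt_dec t PI).
  - apply main; [rewrite Rabs_pos_eq; lra | now apply Ha].
  - replace t with ((t - 2 * PI) + 2 * PI) by ring. rewrite fourier_2PI.
    apply main; [rewrite Rabs_left; lra|].
    replace (fourier p (t - 2 * PI)) with (fourier p t); [now apply Ha|].
    rewrite <- (fourier_2PI p (t - 2 * PI)). f_equal. ring.
Qed.

(** * Bessel's inequality *)

Lemma zpart_ext_loc f g M :
  (forall k, (- Z.of_nat (S M) <= k <= Z.of_nat M)%Z -> f k = g k) -> zpart f M = zpart g M.
Proof.
  intros H. unfold zpart. f_equal; apply sum_n_ext_loc; intros; apply H; lia.
Qed.

Lemma is_RInt_ext_R (f g : R -> R) a b l :
  (forall x, f x = g x) -> is_RInt f a b l -> is_RInt g a b l.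
Proof. intros H. apply is_RInt_ext. intros; apply H. Qed.

Lemma is_RInt_plus_R (f g : R -> R) a b lf lg : is_RInt f a b lf -> is_RInt g a b lg ->
  is_RInt (fun x => f x + g x) a b (lf + lg).
Proof. exact (is_RInt_plus (V := R_NormedModule) f g a b lf lg). Qed.

Lemma is_RInt_scal_R (f : R -> R) c a b l : is_RInt f a b l ->
  is_RInt (fun x => c * f x) a b (c * l).
Proof. exact (is_RInt_scal (V := R_NormedModule) f a b c l). Qed.

Lemma is_RInt_zpart (f : Z -> R -> R) (l : Z -> R) a b M :
  (forall k, is_RInt (f k) a b (l k)) ->
  is_RInt (fun t => zpart (fun k => f k t) M) a b (zpart l M).
Proof.
  intros H. induction M.
  - rewrite zpart_O. apply is_RInt_ext_R with (fun t => f 0%Z t + f (-1)%Z t).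
    + intros; now rewrite zpart_O.
    + now apply is_RInt_plus_R.
  - rewrite zpart_S.
    apply is_RInt_ext_R with (fun t => zpart (fun k => f k t) M + (f (Z.of_nat (S M)) t + f (- Z.of_nat (S (S M)))%Z t)).
    + intros; now rewrite zpart_S.
    + apply is_RInt_plus_R; [exact IHM | now apply is_RInt_plus_R].
Qed.

Lemma is_RInt_cos_integer m : m <> 0%Z -> is_RInt (fun t => cos (IZR m * t)) (- PI) PI 0.
Proof.
  intros Hm. assert (N : IZR m <> 0) by (now apply not_0_IZR).
  replace 0 with (minus (sin (IZR m * PI) / IZR m) (sin (IZR m * - PI) / IZR m)).
  - apply (is_RInt_derive (V := R_CompleteNormedModule) (fun t => sin (IZR m * t) / IZR m)).
    + intros x _. auto_derive; [exact I | field; exact N].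
    + intros x _. apply (ex_derive_continuous (V := R_NormedModule)). auto_derive. exact I.
  - unfold minus, plus, opp; simpl.
    rewrite <- Ropp_mult_distr_r, sin_neg.
    assert (E : sin (IZR m * PI) = 0) by (apply sin_eq_0_1; now exists m).
    rewrite E. field. exact N.
Qed.

Lemma is_RInt_1 : is_RInt (fun _ => 1) (- PI) PI (2 * PI).
Proof.
  replace (2 * PI) with (scal (PI - - PI) 1) by (unfold scal; simpl; unfold mult; simpl; ring).
  apply (is_RInt_const (V := R_NormedModule)).
Qed.

Lemma zpart_parseval (a : Z -> R) M :
  is_RInt (fun t => zpart (fun k => a k * cos (IZR k * t)) M ^ 2 + zpart (fun k => a k * sin (IZR k * t)) M ^ 2)
    (- PI) PI (2 * PI * zpart (fun k => a k ^ 2) M).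
Proof.
  (* the cross terms with a frequency outside the window integrate to zero *)
  assert (cross : forall n k, ~ (- Z.of_nat (S n) <= k <= Z.of_nat n)%Z ->
    is_RInt (fun t => zpart (fun j => a j * cos (IZR (j - k) * t)) n) (- PI) PI 0).
  { intros n k Hk.
    replace 0 with (zpart (fun j => a j * (if Z.eq_dec j k then 2 * PI else 0)) n).
    - apply is_RInt_zpart. intros j. apply is_RInt_scal_R. destruct Z.eq_dec as [-> | N].
      + apply is_RInt_ext_R with (2 := is_RInt_1). intros x.
        rewrite Z.sub_diag, Rmult_0_l, cos_0. reflexivity.
      + apply is_RInt_cos_integer. lia.
    - rewrite (zpart_ext_loc _ (fun _ => 0)); [apply zpart_0|].
      intros j Hj. destruct Z.eq_dec; [subst; contradiction | ring]. }
  assert (cs : forall x, sin x * sin x + cos x * cos x = 1) by exact sin2_cos2.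
  induction M.
  - rewrite zpart_O.
    apply is_RInt_ext_R with (fun t => (a 0%Z ^ 2 + a (-1)%Z ^ 2) * 1 + (2 * a 0%Z * a (-1)%Z) * cos (IZR 1 * t)).
    + intros t. rewrite !zpart_O, !Rmult_0_l, cos_0, sin_0, Rmult_1_l.
      replace (-1 * t) with (- t) by ring. rewrite cos_neg, sin_neg. generalize (cs t). intros.
      replace ((a 0%Z * 1 + a (-1)%Z * cos t) ^ 2 + (a 0%Z * 0 + a (-1)%Z * - sin t) ^ 2) with
        (a 0%Z ^ 2 + 2 * a 0%Z * a (-1)%Z * cos t + a (-1)%Z ^ 2 * (sin t * sin t + cos t * cos t)) by ring.
      rewrite H. ring.
    + replace (2 * PI * (a 0%Z ^ 2 + a (-1)%Z ^ 2)) with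
        ((a 0%Z ^ 2 + a (-1)%Z ^ 2) * (2 * PI) + (2 * a 0%Z * a (-1)%Z) * 0) by ring.
      apply is_RInt_plus_R; apply is_RInt_scal_R; [apply is_RInt_1 | apply is_RInt_cos_integer; lia].
  - rewrite zpart_S. set (x := Z.of_nat (S M)). set (y := (- Z.of_nat (S (S M)))%Z).
    apply is_RInt_ext_R with (fun t =>
      (zpart (fun k => a k * cos (IZR k * t)) M ^ 2 + zpart (fun k => a k * sin (IZR k * t)) M ^ 2)
      + ((a x ^ 2 + a y ^ 2) * 1
      + (2 * a x * zpart (fun j => a j * cos (IZR (j - x) * t)) M
      + (2 * a y * zpart (fun j => a j * cos (IZR (j - y) * t)) M
      + 2 * a x * a y * cos (IZR (x - y) * t))))).
    + intros t. rewrite !zpart_S. fold x y.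
      assert (E : forall z, zpart (fun j => a j * cos (IZR (j - z) * t)) M =
        cos (IZR z * t) * zpart (fun k => a k * cos (IZR k * t)) M
        + sin (IZR z * t) * zpart (fun k => a k * sin (IZR k * t)) M).
      { intros z. rewrite <- !zpart_scal, <- zpart_plus. apply zpart_ext. intros k.
        replace (IZR (k - z) * t) with (IZR k * t - IZR z * t) by (rewrite minus_IZR; ring).
        rewrite cos_minus. ring. }
      rewrite !E. replace (IZR (x - y) * t) with (IZR x * t - IZR y * t) by (rewrite minus_IZR; ring).
      rewrite cos_minus.
      set (P := zpart (fun k => a k * cos (IZR k * t)) M). set (Q := zpart (fun k => a k * sin (IZR k * t)) M).
      generalize (cs (IZR x * t)) (cs (IZR y * t)).
      set (cx := cos (IZR x * t)). set (sx := sin (IZR x * t)).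
      set (cy := cos (IZR y * t)). set (sy := sin (IZR y * t)). intros X Y.
      replace ((a x ^ 2 + a y ^ 2) * 1) with (a x ^ 2 * (sx * sx + cx * cx) + a y ^ 2 * (sy * sy + cy * cy))
        by (rewrite X, Y; ring).
      ring.
    + replace (2 * PI * (zpart (fun k => a k ^ 2) M + (a x ^ 2 + a y ^ 2))) with
        (2 * PI * zpart (fun k => a k ^ 2) M + ((a x ^ 2 + a y ^ 2) * (2 * PI) +
          (2 * a x * 0 + (2 * a y * 0 + 2 * a x * a y * 0)))) by ring.
      apply is_RInt_plus_R; [exact IHM|]. apply is_RInt_plus_R; [apply is_RInt_scal_R, is_RInt_1|].
      apply is_RInt_plus_R; [apply is_RInt_scal_R, cross; unfold x; lia|].
      apply is_RInt_plus_R; [apply is_RInt_scal_R, cross; unfold y; lia|].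
      apply is_RInt_scal_R, is_RInt_cos_integer. unfold x, y; lia.
Qed.

(** The partial sums converge uniformly, so that the majorant [G] of the limit also
    majorises them up to a factor [2] and a small error. *)
Lemma bessel_majorant (a : Z -> R) (G : R -> R) J M : Zsummable a ->
  (forall t, Rabs t <= PI -> Cmod (fourier a t) ^ 2 <= G t) ->
  is_RInt G (- PI) PI J -> PI * zpart (fun k => a k ^ 2) M <= J.
Proof.
  intros Ha HG HJ. pose proof PI_RGT_0 as Pi0.
  apply Rnot_lt_le. intros C.
  set (gap := PI * zpart (fun k => a k ^ 2) M - J). assert (gap0 : 0 < gap) by (unfold gap; lra).
  set (e := Rmin 1 (gap / (8 * PI))).
  assert (e0 : 0 < e) by (apply Rmin_case; [lra | apply Rdiv_lt_0_compat; lra]).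
  destruct (Zsummable_tail_small a e Ha e0) as [N0 HN].
  set (N := Nat.max M N0). specialize (HN N ltac:(lia)).
  assert (tail : forall b t, (forall x, Rabs (b x) <= 1) ->
    Rabs (Zsum (fun k => a k * b (IZR k * t)) - zpart (fun k => a k * b (IZR k * t)) N) <= e).
  { intros b t Hb.
    assert (Sb : Zsummable (fun k => a k * b (IZR k * t))) by (apply Zsummable_mult with 1; auto).
    eapply Rle_trans; [now apply Zsum_tail|].
    assert (Q : zpart (fun k => Rabs (a k) - Rabs (a k * b (IZR k * t))) N
       <= Zsum (fun k => Rabs (a k) - Rabs (a k * b (IZR k * t)))).
    { apply zpart_le_Zsum; [|apply Zsummable_minus; now apply Zsummable_abs].
      intros k. rewrite Rabs_mult. generalize (Hb (IZR k * t)) (Rabs_pos (a k)). nra. }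
    rewrite Zsum_minus in Q by now apply Zsummable_abs.
    rewrite (zpart_ext _ (fun k => Rabs (a k) + (-1) * Rabs (a k * b (IZR k * t)))) in Q by (intros; ring).
    rewrite zpart_plus, zpart_scal in Q. lra. }
  assert (pt : forall t, - PI < t < PI ->
    zpart (fun k => a k * cos (IZR k * t)) N ^ 2 + zpart (fun k => a k * sin (IZR k * t)) N ^ 2
    <= 2 * G t + (4 * e ^ 2) * 1).
  { intros t Ht. specialize (HG t ltac:(apply Rabs_le; lra)).
    rewrite Cmod2_alt, Re_fourier, Im_fourier in HG.
    pose proof (tail cos t (fun x => Rabs_le _ _ (COS_bound x))) as T1.
    pose proof (tail sin t (fun x => Rabs_le _ _ (SIN_bound x))) as T2.
    set (X := Zsum (fun k => a k * cos (IZR k * t))) in *. set (Y := Zsum (fun k => a k * sin (IZR k * t))) in *.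
    set (x := zpart (fun k => a k * cos (IZR k * t)) N) in *. set (y := zpart (fun k => a k * sin (IZR k * t)) N) in *.
    assert (sq : forall u v, Rabs (u - v) <= e -> v ^ 2 <= 2 * u ^ 2 + 2 * e ^ 2).
    { intros u v H. assert ((u - v) ^ 2 <= e ^ 2).
      { rewrite <- (pow2_abs (u - v)). apply pow_incr. split; [apply Rabs_pos | exact H]. }
      generalize (pow2_ge_0 (2 * u - v)). nra. }
    generalize (sq _ _ T1) (sq _ _ T2). lra. }
  assert (ab : - PI <= PI) by lra.
  pose proof (is_RInt_le _ _ _ _ _ _ ab (zpart_parseval a N)
    (is_RInt_plus_R _ _ _ _ _ _ (is_RInt_scal_R _ 2 _ _ _ HJ) (is_RInt_scal_R _ (4 * e ^ 2) _ _ _ is_RInt_1)) pt) as B.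
  assert (Mon : zpart (fun k => a k ^ 2) M <= zpart (fun k => a k ^ 2) N).
  { apply zpart_incr; [intros; apply pow2_ge_0 | lia]. }
  assert (E1 : e ^ 2 <= gap / (8 * PI)).
  { assert (e <= 1) by apply Rmin_l. assert (e <= gap / (8 * PI)) by apply Rmin_r. nra. }
  apply Rmult_le_compat_l with (r := 8 * PI) in E1; [|lra].
  replace (8 * PI * (gap / (8 * PI))) with gap in E1 by (field; lra).
  assert (PI * zpart (fun k => a k ^ 2) M <= PI * zpart (fun k => a k ^ 2) N)
    by (apply Rmult_le_compat_l; lra).
  unfold gap in *. lra.
Qed.

Lemma is_RInt_lorentz A h : 0 < h ->
  is_RInt (fun t => A / (h ^ 2 + t ^ 2)) (- PI) PI (A * (2 * (atan (PI / h) / h))).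
Proof.
  intros Hh.
  replace (A * (2 * (atan (PI / h) / h))) with (minus (A * (atan (PI / h) / h)) (A * (atan (- PI / h) / h))).
  - apply (is_RInt_derive (V := R_CompleteNormedModule) (fun t => A * (atan (t / h) / h))).
    + intros x _. assert (0 < h ^ 2 + x ^ 2) by nra.
      auto_derive; [lra|]. unfold Rsqr. field. split; [nra | lra].
    + intros x _. apply (ex_derive_continuous (V := R_NormedModule)). auto_derive. nra.
  - unfold minus, plus, opp; simpl. replace (- PI / h) with (- (PI / h)) by (field; lra).
    rewrite atan_opp. field. lra.
Qed.

Lemma bessel_lorentz (a : Z -> R) A h M : Zsummable a -> 0 < h -> 0 <= A ->
  (forall t, Rabs t <= PI -> Cmod (fourier a t) ^ 2 <= A / (h ^ 2 + t ^ 2)) ->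
  zpart (fun k => a k ^ 2) M <= A / h.
Proof.
  intros Ha Hh HA H. pose proof PI_RGT_0 as Pi0.
  pose proof (bessel_majorant a _ _ M Ha H (is_RInt_lorentz A h Hh)) as B.
  assert (T : 2 * atan (PI / h) <= PI) by (generalize (atan_bound (PI / h)); lra).
  apply Rmult_le_reg_l with PI; [exact Pi0|]. eapply Rle_trans; [exact B|].
  replace (A * (2 * (atan (PI / h) / h))) with (A / h * (2 * atan (PI / h))) by (field; lra).
  rewrite (Rmult_comm PI). apply Rmult_le_compat_l; [|exact T].
  apply Rmult_le_pos; [exact HA | now apply Rlt_le, Rinv_0_lt_compat].
Qed.

(** Telescoping, as [1 / (1 + y^2) <= 2 / ((1 + x) (1 + y))] for [0 <= x <= y]. *)
Lemma zpart_lorentz_le h M : 0 < h -> zpart (fun k => / (1 + (IZR k * h) ^ 2)) M <= 1 + 4 / h.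
Proof.
  intros Hh.
  assert (term : forall n, / (1 + (INR (S n) * h) ^ 2) <= 2 / h * (/ (1 + INR n * h) - / (1 + INR (S n) * h))).
  { intros n. rewrite S_INR. set (x := INR n * h). assert (X : 0 <= x) by (apply Rmult_le_pos; [apply pos_INR | lra]).
    replace ((INR n + 1) * h) with (x + h) by (unfold x; ring).
    replace (2 / h * (/ (1 + x) - / (1 + (x + h)))) with (2 * / ((1 + x) * (1 + (x + h)))) by (field; lra).
    assert (P : 0 < (1 + x) * (1 + (x + h))) by nra.
    apply Rmult_le_reg_r with (1 + (x + h) ^ 2); [nra|]. rewrite Rinv_l by nra.
    apply Rmult_le_reg_r with ((1 + x) * (1 + (x + h))); [exact P|].
    replace (2 * / ((1 + x) * (1 + (x + h))) * (1 + (x + h) ^ 2) * ((1 + x) * (1 + (x + h))))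
      with (2 * (1 + (x + h) ^ 2)) by (field; lra).
    assert (0 <= h * (1 + (x + h))) by (apply Rmult_le_pos; lra).
    generalize (pow2_ge_0 (1 - (x + h))). nra. }
  assert (tele : forall n, sum_n (fun k => / (1 + (INR (S k) * h) ^ 2)) n <= 2 / h * (1 - / (1 + INR (S n) * h))).
  { induction n.
    - rewrite sum_O. generalize (term 0%nat). replace (1 + INR 0 * h) with 1 by (simpl; ring). rewrite Rinv_1. auto.
    - rewrite sum_Sn. apply Rle_trans with (2 / h * (1 - / (1 + INR (S n) * h)) +
        2 / h * (/ (1 + INR (S n) * h) - / (1 + INR (S (S n)) * h))).
      + apply Rplus_le_compat; [exact IHn | apply term].
      + right; ring. }
  assert (B : forall n, sum_n (fun k => / (1 + (INR (S k) * h) ^ 2)) n <= 2 / h).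
  { intros n. eapply Rle_trans; [apply tele|].
    assert (0 < 2 / h) by (apply Rdiv_lt_0_compat; lra).
    assert (0 < / (1 + INR (S n) * h)).
    { apply Rinv_0_lt_compat. generalize (Rmult_le_pos _ _ (pos_INR (S n)) (Rlt_le _ _ Hh)). lra. }
    nra. }
  unfold zpart.
  assert (P1 : sum_n (fun n => / (1 + (IZR (Z.of_nat n) * h) ^ 2)) M <= 1 + 2 / h).
  { destruct M.
    - rewrite sum_O. simpl. rewrite Rmult_0_l, Rmult_0_l, Rplus_0_r, Rinv_1.
      assert (0 < 2 / h) by (apply Rdiv_lt_0_compat; lra). lra.
    - unfold sum_n. rewrite sum_Sn_m by lia. apply Rplus_le_compat.
      + simpl. rewrite Rmult_0_l, Rmult_0_l, Rplus_0_r, Rinv_1. lra.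
      + rewrite <- sum_n_m_S. eapply Rle_trans; [|exact (B M)]. right.
        apply sum_n_m_ext. intros k. now rewrite INR_IZR_INZ. }
  assert (P2 : sum_n (fun n => / (1 + (IZR (- Z.of_nat (S n)) * h) ^ 2)) M <= 2 / h).
  { eapply Rle_trans; [|exact (B M)]. right. apply sum_n_ext. intros k.
    rewrite opp_IZR, <- INR_IZR_INZ. f_equal. ring. }
  replace (4 / h) with (2 / h + 2 / h) by (field; lra). lra.
Qed.

(** Carlson's inequality: the weight [1 + (k h)^2] splits [|a k|] into a summable part and a
    square-summable one. *)
Lemma l1_of_lorentz (a : Z -> R) A h d : Zsummable a -> Zsummable (moment a) ->
  0 < h -> 0 < d -> 0 <= A ->
  (forall t, Rabs t <= PI -> Cmod (fourier a t) ^ 2 <= d ^ 2 * A * h ^ 2 / (h ^ 2 + t ^ 2)) ->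
  (forall t, Rabs t <= PI -> Cmod (fourier (moment a) t) ^ 2 <= d ^ 2 * A / (h ^ 2 + t ^ 2)) ->
  l1norm a <= d * (h + 4 + 2 * A).
Proof.
  intros Ha Hm Hh Hd HA B1 B2. unfold l1norm.
  assert (dA : 0 <= d ^ 2 * A) by (apply Rmult_le_pos; [apply pow2_ge_0 | exact HA]).
  apply Zsum_le_bound; [now apply Zsummable_abs|]. intros M.
  pose proof (bessel_lorentz a _ h M Ha Hh ltac:(apply Rmult_le_pos; [exact dA | apply pow2_ge_0]) B1) as E1.
  pose proof (bessel_lorentz (moment a) _ h M Hm Hh dA B2) as E2.
  pose proof (zpart_lorentz_le h M Hh) as E3.
  set (D := h * d). assert (D0 : 0 < D) by (apply Rmult_lt_0_compat; lra).
  apply Rle_trans with (zpart (fun k => / 2 * (D * / (1 + (IZR k * h) ^ 2))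
     + / 2 * (/ D * (a k ^ 2 + h ^ 2 * moment a k ^ 2))) M).
  - apply zpart_le. intros k. set (w := 1 + (IZR k * h) ^ 2).
    assert (W : 0 < w) by (unfold w; generalize (pow2_ge_0 (IZR k * h)); lra).
    replace (a k ^ 2 + h ^ 2 * moment a k ^ 2) with (w * Rabs (a k) ^ 2)
      by (rewrite pow2_abs; unfold w, moment; ring).
    (* arithmetic-geometric mean, balanced by [D = h d] *)
    assert (Q : 0 <= / 2 * (/ (D * w)) * (D - w * Rabs (a k)) ^ 2).
    { apply Rmult_le_pos; [|apply pow2_ge_0]. apply Rmult_le_pos; [lra|].
      apply Rlt_le, Rinv_0_lt_compat. now apply Rmult_lt_0_compat. }
    replace (/ 2 * (D * / w) + / 2 * (/ D * (w * Rabs (a k) ^ 2))) with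
      (Rabs (a k) + / 2 * (/ (D * w)) * (D - w * Rabs (a k)) ^ 2) by (field; lra). lra.
  - rewrite zpart_plus, !zpart_scal, zpart_plus, !zpart_scal.
    assert (F1 : D * zpart (fun k => / (1 + (IZR k * h) ^ 2)) M <= d * (h + 4)).
    { replace (d * (h + 4)) with (D * (1 + 4 / h)) by (unfold D; field; lra).
      apply Rmult_le_compat_l; [lra | exact E3]. }
    assert (F2 : / D * (zpart (fun k => a k ^ 2) M + h ^ 2 * zpart (fun k => moment a k ^ 2) M) <= 2 * (d * A)).
    { apply Rmult_le_reg_l with D; [exact D0|]. rewrite <- Rmult_assoc, Rinv_r, Rmult_1_l by lra.
      assert (h ^ 2 * zpart (fun k => moment a k ^ 2) M <= h ^ 2 * (d ^ 2 * A / h))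
        by (apply Rmult_le_compat_l; [apply pow2_ge_0 | exact E2]).
      replace (D * (2 * (d * A))) with (d ^ 2 * A * h ^ 2 / h + h ^ 2 * (d ^ 2 * A / h))
        by (unfold D; field; lra). lra. }
    assert (0 <= d * (h + 4)) by (apply Rmult_le_pos; lra).
    assert (0 <= d * A) by (apply Rmult_le_pos; lra).
    replace (d * (h + 4 + 2 * A)) with (d * (h + 4) + 2 * (d * A)) by ring. lra.
Qed.

(** * The Ritt property *)

Lemma mul_exp_neg_le y : 0 <= y -> y * exp (- y) <= 1.
Proof.
  intros Hy. rewrite exp_Ropp. apply Rmult_le_reg_r with (exp y); [apply exp_pos|].
  rewrite Rmult_assoc, Rinv_l by (generalize (exp_pos y); lra).
  generalize (exp_ineq1_le y). lra.
Qed.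

Lemma sq_mul_exp_neg_le y : 0 <= y -> y ^ 2 * exp (- y) <= 4.
Proof.
  intros Hy. pose proof (mul_exp_neg_le (y / 2) ltac:(lra)) as H.
  replace (- y) with (- (y / 2) + - (y / 2)) by field. rewrite exp_plus.
  assert (0 <= y / 2 * exp (- (y / 2))).
  { apply Rmult_le_pos; [lra | generalize (exp_pos (- (y / 2))); lra]. }
  replace (y ^ 2 * (exp (- (y / 2)) * exp (- (y / 2)))) with
    (4 * ((y / 2 * exp (- (y / 2))) * (y / 2 * exp (- (y / 2))))) by field.
  nra.
Qed.

Lemma pow_le_exp_neg x y n : 0 <= x -> x <= 1 - y -> x ^ n <= exp (- (INR n * y)).
Proof.
  intros H0 H. assert (L : x <= exp (- y)) by (generalize (exp_ineq1_le (- y)); lra).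
  induction n.
  - simpl. rewrite Rmult_0_l, Ropp_0, exp_0. lra.
  - rewrite S_INR. replace (- ((INR n + 1) * y)) with (- y + - (INR n * y)) by ring.
    rewrite exp_plus. simpl. apply Rmult_le_compat; auto. now apply pow_le.
Qed.

(** Interpolates the regimes [s <= h] and [s >= h] by one Lorentzian, whose integral is
    an arctangent. *)
Lemma two_regime_bound y s h B : 0 <= y -> 0 <= s -> 0 < h ->
  (s <= h -> y <= B) -> (h <= s -> y * s <= B * h) -> y ^ 2 <= 2 * B ^ 2 * h ^ 2 / (h ^ 2 + s ^ 2).
Proof.
  intros Hy Hs Hh L R. assert (P : 0 < h ^ 2 + s ^ 2) by nra.
  apply Rmult_le_reg_r with (h ^ 2 + s ^ 2); [exact P|].
  unfold Rdiv. rewrite Rmult_assoc, Rinv_l, Rmult_1_r by lra.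
  destruct (Rle_lt_dec s h) as [C | C].
  - specialize (L C). assert (y ^ 2 <= B ^ 2) by (apply pow_incr; lra).
    assert (h ^ 2 + s ^ 2 <= 2 * h ^ 2) by nra.
    apply Rle_trans with (B ^ 2 * (2 * h ^ 2)); [|right; ring].
    apply Rmult_le_compat; try assumption; try lra. apply pow2_ge_0.
  - specialize (R (Rlt_le _ _ C)).
    assert ((y * s) ^ 2 <= (B * h) ^ 2) by (apply pow_incr; split; [now apply Rmult_le_pos | exact R]).
    assert (y ^ 2 * h ^ 2 <= y ^ 2 * s ^ 2) by (apply Rmult_le_compat_l; [apply pow2_ge_0 | nra]).
    nra.
Qed.

(** At the scale [h] with [n psi(h) = 1], where [psi] is the gauge sum,
    [n |p^|^n |1 - p^| <= 6 u e^{-cu}] with [u = n psi(t)], and [u] is at most, respectively at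
    least, [t / h] below and above [h].  So [n p^{*n} * (delta_0 - p)] has a Fourier transform
    bounded in terms of [t / h] alone, and so has its derivative up to a factor [1 / h]; the
    [l^1] estimate is uniform in this scaling as long as [h] is bounded. *)
Lemma Ritt_of_gap p c j : is_probability p -> centered p -> j <> 0%Z -> 0 < p j -> 0 < c ->
  (forall t, Rabs t <= PI -> Cmod (fourier p t) <= 1 - c * gauge_sum p t) -> class_R p.
Proof.
  intros Hprob Hcent Hj Pj Hc Hgap. split; [exact Hprob|].
  pose proof Hprob as (H0 & Hp & H1). destruct (centered_moment p Hcent) as [Mp M0].
  set (psi := gauge_sum p).
  assert (psi0 : forall t, 0 <= psi t) by (intros; now apply gauge_sum_nonneg).
  assert (psi1 : 0 < psi 1).
  { eapply Rlt_le_trans; [|apply (gauge_sum_ge_sq p j 1 H0 Mp Hj)]; [lra | rewrite Rabs_R1; lra]. }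
  (* [psi] grows at least linearly beyond [1], so it has passed the value [1] at [h1] *)
  set (h1 := 1 + / psi 1).
  assert (ip : 0 < / psi 1) by now apply Rinv_0_lt_compat.
  assert (psih1 : 1 <= psi h1).
  { apply Rle_trans with (h1 * psi 1).
    - unfold h1. rewrite Rmult_plus_distr_r, Rinv_l by lra. lra.
    - rewrite <- (Rmult_1_r h1) at 2. apply gauge_sum_dilate; auto. unfold h1; lra. }
  (* a common bound for the four regimes: [6] and [6 u^2 e^{-cu}] for [f], then
     [84 = 12 * 7] and [12 u (6 u + 1) e^{-cu}] for its derivative *)
  set (B := 90 + 24 / c ^ 2 + 12 * (24 / c ^ 2 + / c)).
  assert (ic : 0 < / c) by now apply Rinv_0_lt_compat.
  assert (ic2 : 0 < 24 / c ^ 2) by (apply Rdiv_lt_0_compat; [lra | nra]).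
  set (A := 2 * B ^ 2).
  exists (h1 + 4 + 2 * A). intros n Hn.
  assert (n1 : 1 <= INR n) by now apply (le_INR 1).
  destruct (IVT_gen psi 0 h1 (/ INR n)) as (h & Hh & Eh).
  { intros t. apply continuity_pt_filterlim. now apply gauge_sum_continuous. }
  { unfold psi at 1 3. rewrite gauge_sum_0. fold psi.
    rewrite Rmin_left, Rmax_right by auto. split.
    - apply Rlt_le, Rinv_0_lt_compat; lra.
    - apply Rle_trans with 1; [|exact psih1]. rewrite <- Rinv_1. apply Rinv_le_contravar; lra. }
  rewrite Rmin_left, Rmax_right in Hh by (unfold h1; lra).
  assert (h0 : 0 < h).
  { destruct (proj1 Hh) as [L | <-]; [exact L | exfalso].
    unfold psi in Eh. rewrite gauge_sum_0 in Eh. assert (0 < / INR n) by (apply Rinv_0_lt_compat; lra). lra. }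
  assert (nh : INR n * psi h = 1) by (rewrite Eh; apply Rinv_r; lra).
  set (a := fun k => conv_pow p n k - conv_pow p (S n) k).
  assert (Sa : Zsummable a) by (apply Zsummable_minus; now apply conv_pow_summable).
  assert (Ea : forall k, moment a k = moment (conv_pow p n) k - moment (conv_pow p (S n)) k)
    by (intros; unfold moment, a; ring).
  assert (Sma : Zsummable (moment a)).
  { apply Zsummable_ext with (fun k => moment (conv_pow p n) k - moment (conv_pow p (S n)) k).
    - intros; now rewrite Ea.
    - apply Zsummable_minus; now apply conv_pow_moment_summable. }
  assert (below : forall t, Rabs t <= h -> INR n * psi t * h <= Rabs t).
  { intros t Ht. destruct (Req_dec t 0) as [-> | Nt].
    - unfold psi. rewrite gauge_sum_0, Rabs_R0. lra.
    - assert (P : 0 < Rabs t) by now apply Rabs_pos_lt.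
      assert (E : psi t = psi (Rabs t)) by (unfold Rabs; destruct Rcase_abs; [symmetry; apply gauge_sum_even | reflexivity]).
      assert (L : 1 <= h / Rabs t).
      { apply Rmult_le_reg_r with (Rabs t); [exact P|]. unfold Rdiv.
        rewrite Rmult_assoc, Rinv_l by lra. lra. }
      pose proof (gauge_sum_dilate p _ (Rabs t) H0 Mp L) as Q. fold psi in Q. rewrite <- E in Q.
      replace (h / Rabs t * Rabs t) with h in Q by (field; lra).
      apply Rmult_le_compat_l with (r := INR n * Rabs t) in Q; [|apply Rmult_le_pos; lra].
      replace (INR n * Rabs t * (h / Rabs t * psi t)) with (INR n * psi t * h) in Q by (field; lra).
      replace (INR n * Rabs t * psi h) with (INR n * psi h * Rabs t) in Q by ring.
      rewrite nh in Q. lra. }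
  assert (above : forall t, h <= Rabs t -> Rabs t <= INR n * psi t * h).
  { intros t Ht.
    assert (E : psi t = psi (Rabs t)) by (unfold Rabs; destruct Rcase_abs; [symmetry; apply gauge_sum_even | reflexivity]).
    assert (L : 1 <= Rabs t / h).
    { apply Rmult_le_reg_r with h; [exact h0|]. unfold Rdiv.
      rewrite Rmult_assoc, Rinv_l by lra. lra. }
    pose proof (gauge_sum_dilate p _ h H0 Mp L) as Q. fold psi in Q.
    replace (Rabs t / h * h) with (Rabs t) in Q by (field; lra). rewrite <- E in Q.
    apply Rmult_le_compat_l with (r := INR n * h) in Q; [|apply Rmult_le_pos; lra].
    replace (INR n * h * (Rabs t / h * psi h)) with (INR n * psi h * Rabs t) in Q by (field; lra).
    rewrite nh in Q. lra. }
  assert (decay1 : forall u, 0 <= u -> u * exp (- (c * u)) <= / c).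
  { intros u Hu. apply Rmult_le_reg_l with c; [exact Hc|]. rewrite Rinv_r by lra.
    rewrite <- Rmult_assoc. apply mul_exp_neg_le. apply Rmult_le_pos; lra. }
  assert (decay2 : forall u, 0 <= u -> u ^ 2 * exp (- (c * u)) <= 4 / c ^ 2).
  { intros u Hu. apply Rmult_le_reg_l with (c ^ 2); [nra|].
    replace (c ^ 2 * (4 / c ^ 2)) with 4 by (field; lra).
    replace (c ^ 2 * (u ^ 2 * exp (- (c * u)))) with ((c * u) ^ 2 * exp (- (c * u))) by ring.
    apply sq_mul_exp_neg_le. apply Rmult_le_pos; lra. }
  assert (main : l1norm a <= / INR n * (h + 4 + 2 * A)).
  { apply l1_of_lorentz; auto.
    - apply Rinv_0_lt_compat; lra.
    - unfold A. generalize (pow2_ge_0 B). lra.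
    - intros t Ht. set (u := INR n * psi t).
      assert (u0 : 0 <= u) by (apply Rmult_le_pos; [lra | apply psi0]).
      set (y := INR n * Cmod (fourier a t)).
      assert (y0 : 0 <= y) by (apply Rmult_le_pos; [lra | apply Cmod_ge_0]).
      assert (Y : y <= 6 * u * exp (- (c * u))).
      { assert (E : fourier a t = (fourier p t ^ n * (1 - fourier p t))%C).
        { unfold a. rewrite fourier_minus, !conv_pow_fourier by auto using conv_pow_summable.
          simpl Cpow. ring. }
        unfold y. rewrite E, Cmod_mult, Cmod_pow.
        pose proof (pow_le_exp_neg _ _ n (Cmod_ge_0 _) (Hgap t Ht)) as X. fold psi in X.
        replace (INR n * (c * psi t)) with (c * u) in X by (unfold u; ring).
        pose proof (one_minus_fourier_le p t Hprob Hcent) as W. fold psi in W.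
        apply Rle_trans with (INR n * (exp (- (c * u)) * (6 * psi t))).
        - apply Rmult_le_compat_l; [lra|].
          apply Rmult_le_compat; auto using Cmod_ge_0. apply pow_le, Cmod_ge_0.
        - right. unfold u. ring. }
      assert (Ex : exp (- (c * u)) <= 1).
      { rewrite <- exp_0. destruct (Rle_lt_or_eq_dec 0 (c * u)) as [L | <-].
        - apply Rmult_le_pos; lra.
        - apply Rlt_le, exp_increasing. lra.
        - rewrite Ropp_0. lra. }
      assert (Z : y ^ 2 <= 2 * B ^ 2 * h ^ 2 / (h ^ 2 + Rabs t ^ 2)).
      { apply two_regime_bound; auto using Rabs_pos.
        - intros L. pose proof (below t L) as U. fold u in U. assert (u <= 1) by nra.
          assert (u * exp (- (c * u)) <= 1 * 1) by (apply Rmult_le_compat; auto; generalize (exp_pos (- (c * u))); lra).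
          unfold B. lra.
        - intros L. pose proof (above t L) as U. fold u in U.
          apply Rle_trans with (6 * u * exp (- (c * u)) * (u * h)).
          + apply Rmult_le_compat; auto using Rabs_pos.
          + replace (6 * u * exp (- (c * u)) * (u * h)) with (6 * (u ^ 2 * exp (- (c * u))) * h) by ring.
            apply Rmult_le_compat_r; [lra|]. generalize (decay2 u u0). unfold B. lra. }
      rewrite pow2_abs in Z. unfold A.
      replace ((/ INR n) ^ 2 * (2 * B ^ 2) * h ^ 2 / (h ^ 2 + t ^ 2)) with
        ((/ INR n) ^ 2 * (2 * B ^ 2 * h ^ 2 / (h ^ 2 + t ^ 2))) by (unfold Rdiv; ring).
      replace (Cmod (fourier a t) ^ 2) with ((/ INR n) ^ 2 * y ^ 2) by (unfold y; field; lra).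
      apply Rmult_le_compat_l; [apply pow2_ge_0 | exact Z].
    - intros t Ht. set (u := INR n * psi t).
      assert (u0 : 0 <= u) by (apply Rmult_le_pos; [lra | apply psi0]).
      set (F := fourier (moment a) t). set (m := fourier (moment p) t).
      assert (FE : exists l : nat, n = S l /\ F = (fourier p t ^ l * m * (INR n * (1 - fourier p t) - fourier p t))%C).
      { destruct n as [|l]; [lia|]. exists l. split; [reflexivity|]. unfold F.
        rewrite (fourier_ext _ _ t Ea).
        rewrite fourier_minus by now apply conv_pow_moment_summable.
        rewrite !conv_pow_moment_fourier by assumption. fold m.
        rewrite (S_INR (S l)), RtoC_plus. simpl Cpow. ring. }
      destruct FE as (l & El & FE).
      set (y := INR n * Cmod F).
      assert (y0 : 0 <= y) by (apply Rmult_le_pos; [lra | apply Cmod_ge_0]).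
      assert (mt : Rabs t * Cmod m <= 4 * psi t) by now apply moment_fourier_le.
      assert (cpsi : c * psi t <= 1).
      { generalize (Hgap t Ht) (Cmod_ge_0 (fourier p t)). fold psi. lra. }
      assert (Y : y * Rabs t <= 12 * u * (6 * u + 1) * exp (- (c * u))).
      { unfold y. rewrite FE, !Cmod_mult, Cmod_pow.
        pose proof (pow_le_exp_neg _ _ l (Cmod_ge_0 _) (Hgap t Ht)) as X. fold psi in X.
        (* the missing power of [p^] costs [e^{c psi(t)} <= e] *)
        assert (X' : Cmod (fourier p t) ^ l <= 3 * exp (- (c * u))).
        { apply Rle_trans with (1 := X).
          replace (- (INR l * (c * psi t))) with (c * psi t + - (c * u))
            by (unfold u; rewrite El, S_INR; ring).
          rewrite exp_plus. apply Rmult_le_compat_r; [generalize (exp_pos (- (c * u))); lra|].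
          apply Rle_trans with (exp 1); [|exact exp_le_3].
          destruct (Rle_lt_or_eq_dec _ _ cpsi) as [L | ->]; [apply Rlt_le, exp_increasing, L | lra]. }
        assert (W : Cmod (INR n * (1 - fourier p t) - fourier p t)%C <= 6 * u + 1).
        { unfold Cminus at 1. eapply Rle_trans; [apply Cmod_triangle|]. rewrite Cmod_opp, Cmod_mult, Cmod_R, Rabs_pos_eq by lra.
          pose proof (one_minus_fourier_le p t Hprob Hcent) as W1. fold psi in W1.
          pose proof (fourier_le_1 p t Hprob) as W2.
          apply Rplus_le_compat; [|exact W2]. unfold u.
          apply Rmult_le_compat_l with (r := INR n) in W1; lra. }
        set (x := Cmod (fourier p t) ^ l) in *. assert (x0 : 0 <= x) by (apply pow_le, Cmod_ge_0).
        set (w := Cmod (INR n * (1 - fourier p t) - fourier p t)%C) in *.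
        assert (w0 : 0 <= w) by apply Cmod_ge_0.
        replace (INR n * (x * Cmod m * w) * Rabs t) with (x * (INR n * (Rabs t * Cmod m)) * w) by ring.
        replace (12 * u * (6 * u + 1) * exp (- (c * u))) with
          ((3 * exp (- (c * u))) * (INR n * (4 * psi t)) * (6 * u + 1)) by (unfold u; ring).
        assert (0 <= INR n * (Rabs t * Cmod m)).
        { apply Rmult_le_pos; [lra|]. apply Rmult_le_pos; [apply Rabs_pos | apply Cmod_ge_0]. }
        apply Rmult_le_compat; auto; [now apply Rmult_le_pos|].
        apply Rmult_le_compat; auto. apply Rmult_le_compat_l; lra. }
      assert (Ex : exp (- (c * u)) <= 1).
      { rewrite <- exp_0. destruct (Rle_lt_or_eq_dec 0 (c * u)) as [L | <-].
        - apply Rmult_le_pos; lra.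
        - apply Rlt_le, exp_increasing. lra.
        - rewrite Ropp_0. lra. }
      assert (Z : (y * h) ^ 2 <= 2 * B ^ 2 * h ^ 2 / (h ^ 2 + Rabs t ^ 2)).
      { apply two_regime_bound; auto using Rabs_pos; [apply Rmult_le_pos; lra| |].
        - intros L. pose proof (below t L) as U. fold u in U.
          destruct (Req_dec t 0) as [T0 | Nt].
          + (* at the origin the transform of the first moment vanishes *)
            assert (m = 0)%C as Em by (unfold m; rewrite T0, fourier_0, M0; reflexivity).
            assert (y = 0) as ->.
            { unfold y. rewrite FE, Em, !Cmod_mult, Cmod_0. ring. }
            unfold B. lra.
          + assert (P : 0 < Rabs t) by now apply Rabs_pos_lt.
            assert (u <= 1) by nra.
            apply Rmult_le_reg_r with (Rabs t); [exact P|].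
            replace (y * h * Rabs t) with (y * Rabs t * h) by ring.
            apply Rle_trans with (84 * u * h).
            * apply Rmult_le_compat_r; [lra|]. eapply Rle_trans; [exact Y|].
              replace (84 * u) with (12 * u * 7 * 1) by ring.
              apply Rmult_le_compat; try assumption; try nra.
              generalize (exp_pos (- (c * u))); lra.
            * apply Rle_trans with (84 * Rabs t); [lra|]. apply Rmult_le_compat_r; [lra|].
              unfold B. lra.
        - intros L. replace (y * h * Rabs t) with (y * Rabs t * h) by ring.
          apply Rmult_le_compat_r; [lra|]. eapply Rle_trans; [exact Y|].
          replace (12 * u * (6 * u + 1) * exp (- (c * u))) with
            (12 * (6 * (u ^ 2 * exp (- (c * u))) + u * exp (- (c * u)))) by ring.
          generalize (decay1 u u0) (decay2 u u0). unfold B. lra. }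
      rewrite pow2_abs in Z. unfold A.
      assert (P : 0 < h ^ 2 + t ^ 2) by nra.
      apply Rmult_le_reg_l with (INR n ^ 2 * h ^ 2); [apply Rmult_lt_0_compat; nra|].
      replace (INR n ^ 2 * h ^ 2 * Cmod F ^ 2) with ((y * h) ^ 2) by (unfold y; ring).
      replace (INR n ^ 2 * h ^ 2 * ((/ INR n) ^ 2 * (2 * B ^ 2) / (h ^ 2 + t ^ 2))) with
        (2 * B ^ 2 * h ^ 2 / (h ^ 2 + t ^ 2)) by (field; repeat split; try lra; nra).
      exact Z. }
  apply Rmult_le_compat_l with (r := INR n) in main; [|lra].
  eapply Rle_trans; [exact main|]. rewrite <- Rmult_assoc, Rinv_r, Rmult_1_l by lra. lra.
Qed.

(** * Angular ratio, hypothesis (H) and Ritt property *)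

Lemma perturbation_gap p s c C : skip_free_decreasing p -> 0 < p 1%Z -> 0 < C ->
  (forall n, (1 <= n)%nat -> INR n * tail_moment p n <= C * head_moment p n) ->
  is_probability s -> centered s -> square_close p s c -> strictly_aperiodic s ->
  exists c0, 0 < c0 /\ forall t, Rabs t <= PI -> Cmod (fourier s t) <= 1 - c0 * gauge_sum s t.
Proof.
  intros Hsf P1 HC HT Hprob Hc Hsq Hap.
  destruct (gauge_sum_le_of_tail_condition p C Hsf P1 HC HT) as (K & HK & HG).
  destruct (gauge_sum_le_real_part p s c K) as (d & K' & Hd & HK' & HG'); auto.
  now apply modulus_gap with K' d.
Qed.

Lemma square_close_refl p : square_close p p 1.
Proof.
  split; [lra|]. apply Zsummable_ext with (2 := Zsummable_0). intros n.
  replace (p n - 1 * p n) with 0 by ring. rewrite Rabs_R0. ring.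
Qed.

Theorem theorem1p5 (mu : Z -> R)
  (Hprob : is_probability mu)
  (Hcent : centered mu)
  (Hsupp : forall n : Z, (n < -1)%Z -> mu n = 0)
  (Hcm : completely_monotone (fun n : nat => mu (Z.of_nat n))) :
  (mu <> delta0 ->
     (BAR mu <->
      exists C : R, 0 < C /\
        forall n : nat, (1 <= n)%nat ->
          INR n * Series (fun j : nat => INR (n + j) * mu (Z.of_nat (n + j)))
          <= C * sum_n_m (fun k : nat => INR k ^ 2 * mu (Z.of_nat k)) 1 n))
  /\
  (BAR mu ->
     (forall sigma : Z -> R,
        is_probability sigma ->
        centered sigma ->
        (finite_second_moment sigma -> strictly_aperiodic sigma) ->
        (exists c : R, 0 < c /\
           Zsummable (fun n : Z => IZR n ^ 2 * Rabs (sigma n - c * mu n))) ->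
        class_H sigma /\ class_R sigma)
     /\ (class_H mu /\ class_R mu)).
Proof.
  assert (Hsf : skip_free_decreasing mu).
  { split; [exact Hprob | split; [exact Hcent | split; [exact Hsupp|]]].
    intros n. assert (H : 0 <= mu (Z.of_nat n) - mu (Z.of_nat (S n))) by exact (Hcm 1%nat n). lra. }
  assert (tail_of_BAR : BAR mu -> exists C, 0 < C /\
    forall n, (1 <= n)%nat -> INR n * tail_moment mu n <= C * head_moment mu n).
  { intros HB. pose proof (skip_free_atom_1 mu Hsf (BAR_not_delta0 mu HB)) as P1.
    destruct (BAR_angular_bound mu Hprob HB) as (K & HK & H).
    now apply tail_condition_of_angular_bound with K. }
  split.
  - intros Hne. split; [exact tail_of_BAR|]. intros (C & HC & HT).
    pose proof (skip_free_strictly_aperiodic mu Hsf Hne) as Ha.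
    destruct (perturbation_gap mu mu 1 C Hsf (skip_free_atom_1 mu Hsf Hne) HC HT Hprob Hcent
      (square_close_refl mu) Ha) as (c0 & Hc0 & Hgap).
    now apply BAR_of_gap with c0.
  - intros HB. pose proof (skip_free_atom_1 mu Hsf (BAR_not_delta0 mu HB)) as P1.
    destruct (tail_of_BAR HB) as (C & HC & HT).
    assert (main : forall s, is_probability s -> centered s ->
      (finite_second_moment s -> strictly_aperiodic s) ->
      (exists c, square_close mu s c) -> class_H s /\ class_R s).
    { intros s Hs Hcs Himp (c & Hsq).
      pose proof (perturbation_strictly_aperiodic mu s c Hsf Hs Hsq Himp) as Ha.
      destruct (perturbation_gap mu s c C Hsf P1 HC HT Hs Hcs Hsq Ha) as (c0 & Hc0 & Hgap).
      destruct (strictly_aperiodic_atom s Hs Ha) as (j & Hj & Pj).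
      split; [now apply perturbation_class_H with mu c c0 | now apply Ritt_of_gap with c0 j]. }
    split; [exact main|]. apply main; auto.
    + intros _. apply HB.
    + exists 1. apply square_close_refl.
Qed.
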